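(* Let $F$ be a field of characteristic $p>0$ and let $G$ be a finite basic group (with respect to $p$) satisfying $Z(G')=G''$. Then the following are equivalent: (i) $\operatorname{soc}(ZFG)$ is an ideal in $FG$. (ii) $G$ is a central product of groups $G_1,\dots,G_n$ of the form $G_i=K_i\rtimes\langle\varphi_i\rangle$ ($i=1,\dots,n$), where (a) $K_i$ is a Camina $p$-group of nilpotency class $2$, (b) $\varphi_i$ is an automorphism of $K_i$ of order $|K_i:K_i'|-1$ such that $\langle\varphi_i\rangle$ permutes the nontrivial cosets of $K_i'$ in $K_i$ transitively, and (c) the action of $\langle\varphi_i\rangle$ on $K_i'$ is not faithful.
   Context: For a finite group $X$, $X'$ is the derived subgroup, $X''=(X')'$, $Z(X)$ the center, $O_{p'}(X)$ the largest normal subgroup of order prime to $p$. $FG$ is the group algebra, $ZFG$ its center, and $\operatorname{soc}(ZFG)$ the socle of the ring $ZFG$ (sum of its minimal ideals). ''Ideal in $FG$'' means two-sided ideal. A finite group $G$ is called basic (with respect to the prime $p$) if $G'$ is a Sylow $p$-subgroup of $G$ and $O_{p'}(G)=1$. A finite group $K$ is a Camina group if for every $g\in K\setminus K'$ the conjugacy class of $g$ in $K$ equals the coset $gK'$. $G$ is the central product of subgroups $G_1,\dots,G_n$ if $G=\langle G_1,\dots,G_n\rangle$ and $[G_i,G_j]=1$ for all $i\neq j$. The number $n$ is a nonnegative integer (for $n=0$, the central product is the trivial group). *)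

(* Defs.v *)
From mathcomp Require Import all_boot all_order all_fingroup all_algebra.
From mathcomp Require Import all_solvable all_character.

Set Implicit Arguments.
Unset Strict Implicit.
Unset Printing Implicit Defensive.

Import GroupScope GRing.Theory.

Section Socle.

Local Open Scope ring_scope.

Variables (F : fieldType) (m n : nat).

(* R encodes, through its row space, a ring of n x n matrices. Ideals are     *)
(* plain additive subgroups absorbing multiplication by R; they are not       *)
(* required to be F-subspaces, although this is automatic when R contains the *)
(* scalar matrices.                                                           *)
Definition ring_ideal (R : 'A[F]_(m, n)) (I : 'M[F]_n -> Prop) : Prop :=
  [/\ forall A, I A -> (A \in R)%MS,
      I 0,
      forall A B, I A -> I B -> I (A - B)
    & forall X A, (X \in R)%MS -> I A -> I (X *m A) /\ I (A *m X)].

Definition minimal_ring_ideal (R : 'A[F]_(m, n)) (I : 'M[F]_n -> Prop) : Prop :=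
  [/\ ring_ideal R I,
      exists2 A, I A & A <> 0
    & forall J : 'M[F]_n -> Prop, ring_ideal R J -> (exists2 A, J A & A <> 0) ->
        (forall A, J A -> I A) -> forall A, I A -> J A].

Definition ring_socle (R : 'A[F]_(m, n)) (A : 'M[F]_n) : Prop :=
  exists k (B : 'I_k -> 'M[F]_n),
    (forall i, exists2 I, minimal_ring_ideal R I & I (B i))
    /\ A = \sum_(i < k) B i.

End Socle.

Section Groups.

Variable gT : finGroupType.
Implicit Types G K : {group gT}.

Definition basic_group (p : nat) G : Prop :=
  p.-Sylow(G) G^`(1) /\ 'O_p^'(G) = 1.

Definition camina_group K : Prop :=
  forall g, g \in K :\: K^`(1) -> g ^: K = g *: K^`(1).

Definition central_product_of (n : nat) (Gs : 'I_n -> {group gT}) G : Prop :=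
  << \bigcup_(i < n) Gs i >> = G
  /\ forall i j : 'I_n, i != j -> [~: Gs i, Gs j] = 1.

(* G is the semidirect product of K with <[f]>, for f in Aut K: an internal   *)
(* complement H of K is identified with <[f]> through its conjugation action  *)
(* on K.                                                                      *)
Definition sdprod_cycle_aut K (f : {perm gT}) G : Prop :=
  f \in Aut K
  /\ exists2 H : {group gT}, K ><| H = G & isom H <[f]> (conj_aut K).

Definition camina_sdprod_cycle (p : nat) G : Prop :=
  exists (K : {group gT}) (f : {perm gT}),
    [/\ sdprod_cycle_aut K f G,
        [/\ camina_group K, p.-group K & nil_class K = 2],
        #[f] = (#|K : K^`(1)| - 1)%N
          /\ [transitive <[f]>, on rcosets K^`(1) K :\ (K^`(1) : {set gT}) | 'P^*]
      & ~~ [faithful <[f]>, on K^`(1) | 'P]].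

End Groups.

(* Main.v *)
Require Import Defs.
From mathcomp Require Import all_boot all_order all_fingroup all_algebra.
From mathcomp Require Import all_solvable all_character ring.

Set Implicit Arguments.
Unset Strict Implicit.
Unset Printing Implicit Defensive.

Import GroupScope GRing.Theory.

(** Why the theorem holds.

    In both directions $G = PH$ is the semidirect product of the $p$-group
    $P = G'$, with centre $Z = P'$, and an abelian $p'$-group $H$ acting
    faithfully on it; an element of $ZFG$ is a class function on $G$, and
    everything is read off its coefficients.

    Socle and functions.  If the socle is an ideal of $FG$, each of its
    elements $z$ is constant on the cosets of $G'$: for $a, b$ in $G$ the
    element $az$ is central, so that $abz = baz$.  A class function $z$ that
    every class sum multiplies by a scalar spans a minimal ideal of $ZFG$,
    hence must be constant on the cosets of $G'$ (socle_ideal_class_fun).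
    Conversely, if every minimal ideal consists of such functions, then $G$
    permutes the minimal ideals and the socle is an ideal
    (socle_ideal_of_invariant).

    From (ii) to (i).  If a central element $X$ annihilates all vectors fixed
    by some $p$-subgroup of $G$, it annihilates every minimal ideal of $ZFG$
    (minimal_ideal_kill).  Applied to class sums, minus their augmentation,
    this gives linear relations for the coefficients of an element of a minimal
    ideal.  In one factor $K \rtimes \langle\varphi\rangle$, the relations
    for the classes inside $K'$ and for the class of a nontrivial power of
    $\varphi$ that centralises $K'$ already force the coefficients to be
    constant on the cosets of $K$ (camina_frobenius_const).

    From (i) to (ii).  Now (i) is only used through functions: eigen_criterion
    lists conditions under which a class function $z$ supported on $P$ is an
    eigenvector of all class sums, and then $z$ is constant on $P$.  Three
    choices of $z$ are made.

    - The indicator function of a normal subgroup $U$ of $G$ with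
      $Z \le U \le P$ and $C_H(U) = 1$ shows that $U = P$
      (normal_cent_triv_eq).  So $C_H(U) \ne 1$ for each maximal normal $U$
      with $Z \le U < P$, and coprime action makes $K_U = [P, C_H(U)]$ a
      supplement of $U$ in $P$ that centralises $U$ and meets it in $K_U'$.
      These groups $K_U$ generate $P$ and commute pairwise.

    - For $g_0$ in $P$ outside all the $U$, the function
      $w \mapsto \sum_{x \in H} \prod_U ([w \in g_0^x U] - [w \in U])$
      shows that $H$ permutes transitively the families of nontrivial cosets
      of the $K_U'$ in the $K_U$ (max_normal_trans).  Therefore the subgroup
      $B_U$ of the elements of $H$ that centralise all the other $K_W$ permutes
      the nontrivial cosets of $K_U'$ in $K_U$ regularly; it is cyclic, and the
      $B_U$ generate $H$.  The factors of $G$ are the groups $K_U B_U$.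

    - It remains to see that $[v, K] = K'$ for $K = K_U$ and $v$ in $K$
      outside $K'$.  This is elementary if some such $v$ has $|[v, K]| = 2$
      (comm_set_card2), or if $B_U$ fixes a nontrivial element of $K'$
      (fixed_center_comm_set).  Otherwise, if $[v, K] \ne K'$, there is a
      nonzero additive function $f$ from $U$ to $F$ which vanishes on $[v, K]$
      and on all $K_W$ with $W \ne U$, and for a suitable $g$ the function
      $w \mapsto \sum_{x \in H} [w^x \in gU] f(g^{-1} w^x)$ is not constant
      on $P$ although it satisfies the criterion (not_camina_fun0). *)

(** * Elements of the group algebra as functions on the group *)

Section GroupAlgebra.

Local Open Scope ring_scope.

Variables (F : fieldType) (gT : finGroupType) (G : {group gT}).
Implicit Types (x y g a : gT) (f : gT -> F) (A : {set gT}).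

Local Notation nG := #|pred_of_set (gval G)|.
Local Notation aG := (regular_repr F G).
Local Notation R_G := (group_ring F G).
Local Notation Z_G := 'Z(group_ring F G)%MS.

(** The group algebra is encoded by its regular representation, so the
    coefficients of an element form its row indexed by the identity. *)
Definition gring_coef (B : 'M[F]_nG) g : F := gring_row B 0 (gring_index G g).

Definition gring_of_fun f : 'M[F]_nG := \sum_(g in G) f g *: aG g.

Lemma gring_coefG x g : x \in G -> g \in G ->
  gring_coef (aG x) g = (g == x)%:R.
Proof.
move=> Gx Gg; rewrite /gring_coef /gring_row /= !mxE gring_indexK // mul1g.
by rewrite eqxx /= (can_in_eq (@gring_indexK _ G)).
Qed.

Lemma gring_coef_sum I (r : seq I) (P : pred I) (B : I -> 'M[F]_nG) g :
  gring_coef (\sum_(i <- r | P i) B i) g = \sum_(i <- r | P i) gring_coef (B i) g.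
Proof. by rewrite /gring_coef linear_sum summxE. Qed.

Lemma gring_coefZ c (B : 'M[F]_nG) g : gring_coef (c *: B) g = c * gring_coef B g.
Proof. by rewrite /gring_coef linearZ mxE. Qed.

Lemma gring_of_funK f g : g \in G -> gring_coef (gring_of_fun f) g = f g.
Proof.
move=> Gg; rewrite gring_coef_sum (bigD1 g) //= gring_coefZ gring_coefG // eqxx.
rewrite mulr1 big1 ?addr0 // => x /andP[Gx /negPf xg].
by rewrite gring_coefZ gring_coefG // eq_sym xg mulr0.
Qed.

Lemma mem_gring_of_fun f : (gring_of_fun f \in R_G)%MS.
Proof. by apply/envelop_mxP; exists f. Qed.

Lemma gring_coefK B : (B \in R_G)%MS -> gring_of_fun (gring_coef B) = B.
Proof.
case/envelop_mxP=> f ->; apply: eq_bigr => g Gg.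
by rewrite -[in RHS](gring_of_funK f Gg).
Qed.

Lemma gring_coef_inj B1 B2 : (B1 \in R_G)%MS -> (B2 \in R_G)%MS ->
  {in G, gring_coef B1 =1 gring_coef B2} -> B1 = B2.
Proof.
move=> R1 R2 eqB; rewrite -(gring_coefK R1) -(gring_coefK R2).
by apply: eq_bigr => g Gg; rewrite eqB.
Qed.

Lemma mem_regular_gring x : x \in G -> (aG x \in R_G)%MS.
Proof. exact: envelop_mx_id. Qed.

Lemma gring_mul_mem B1 B2 :
  (B1 \in R_G)%MS -> (B2 \in R_G)%MS -> (B1 *m B2 \in R_G)%MS.
Proof. exact: envelop_mxM. Qed.

Lemma gring_coef_mulr B x g : (B \in R_G)%MS -> x \in G -> g \in G ->
  gring_coef (B *m aG x) g = gring_coef B (g * x^-1)%g.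
Proof.
move=> RB Gx Gg; rewrite -{1}(gring_coefK RB) /gring_of_fun mulmx_suml.
rewrite gring_coef_sum (bigD1 (g * x^-1)%g) ?groupM ?groupV //=.
rewrite -scalemxAl gring_coefZ -repr_mxM ?groupM ?groupV // mulgKV.
rewrite gring_coefG // eqxx mulr1 big1 ?addr0 // => y /andP[Gy /negPf yg].
rewrite -scalemxAl gring_coefZ -repr_mxM // gring_coefG ?groupM //.
by rewrite -(can2_eq (mulgKV x) (mulgK x)) eq_sym yg mulr0.
Qed.

Lemma gring_coef_mull B x g : (B \in R_G)%MS -> x \in G -> g \in G ->
  gring_coef (aG x *m B) g = gring_coef B (x^-1 * g)%g.
Proof.
move=> RB Gx Gg; rewrite -{1}(gring_coefK RB) /gring_of_fun mulmx_sumr.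
rewrite gring_coef_sum (bigD1 (x^-1 * g)%g) ?groupM ?groupV //=.
rewrite -scalemxAr gring_coefZ -repr_mxM ?groupM ?groupV // mulKVg.
rewrite gring_coefG // eqxx mulr1 big1 ?addr0 // => y /andP[Gy /negPf yg].
rewrite -scalemxAr gring_coefZ -repr_mxM // gring_coefG ?groupM //.
by rewrite -(can2_eq (mulKVg x) (mulKg x)) eq_sym yg mulr0.
Qed.

Lemma gring_centerP B :
  reflect ((B \in R_G)%MS /\ {in G, forall x, aG x *m B = B *m aG x})
          (B \in Z_G)%MS.
Proof.
apply: (iffP center_mxP) => -[RB cB]; split=> //.
  by move=> x Gx; apply: cB; apply: mem_regular_gring.
move=> _ /envelop_mxP[f ->]; rewrite mulmx_suml mulmx_sumr.
by apply: eq_bigr => x Gx; rewrite -scalemxAl -scalemxAr cB.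
Qed.

Lemma gring_coef_class B : (B \in Z_G)%MS ->
  {in G &, forall g x, gring_coef B (g ^ x)%g = gring_coef B g}.
Proof.
case/gring_centerP=> RB cB g x Gg Gx; have := cB x Gx.
move/(congr1 (fun C => gring_coef C (g * x)%g)).
by rewrite gring_coef_mull ?gring_coef_mulr ?groupM // mulgK.
Qed.

Lemma class_fun_center f : {in G &, forall g x, f (g ^ x)%g = f g} ->
  (gring_of_fun f \in Z_G)%MS.
Proof.
move=> cf; have Rf := mem_gring_of_fun f; apply/gring_centerP; split=> // x Gx.
apply: gring_coef_inj; rewrite ?gring_mul_mem ?mem_regular_gring // => g Gg.
rewrite gring_coef_mull ?gring_coef_mulr ?gring_of_funK ?groupM ?groupV //.
by rewrite -(cf (g * x^-1)%g x) ?groupM ?groupV // conjgE mulgKV.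
Qed.

Lemma center_gring_sub B : (B \in Z_G)%MS -> (B \in R_G)%MS.
Proof. by case/gring_centerP. Qed.

Lemma scalar_gring_center c : (c%:M \in Z_G)%MS.
Proof.
rewrite -scalemx1; apply/gring_centerP; split=> [|x Gx].
  by rewrite linearZ /= scalemx_sub // envelop_mx1.
by rewrite -scalemxAl -scalemxAr mul1mx mulmx1.
Qed.

Lemma center_mulZ c B : (B \in Z_G)%MS -> (c *: B \in Z_G)%MS.
Proof. by move=> ZB; rewrite linearZ /= scalemx_sub. Qed.

Lemma center_gring_mul B1 B2 :
  (B1 \in Z_G)%MS -> (B2 \in Z_G)%MS -> (B1 *m B2 \in Z_G)%MS.
Proof.
case/gring_centerP=> R1 c1 /gring_centerP[R2 c2]; apply/gring_centerP.
split=> [|x Gx]; first exact: gring_mul_mem.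
by rewrite mulmxA c1 // -[LHS]mulmxA c2 // mulmxA.
Qed.

Lemma center_gring_comm B1 B2 : (B1 \in Z_G)%MS -> (B2 \in R_G)%MS ->
  B2 *m B1 = B1 *m B2.
Proof. by case/center_mxP=> _ c1; apply: c1. Qed.

Lemma center_idealZ I c B : ring_ideal Z_G I -> I B -> I (c *: B).
Proof.
case=> _ _ _ IM IB; rewrite -mul_scalar_mx.
by have [] := IM _ _ (scalar_gring_center c) IB.
Qed.

(** * The socle of the centre of the group algebra *)

Section Socle.

Local Notation soc := (ring_socle Z_G).

Lemma ring_socle0 : soc 0.
Proof.
exists 0%N, (fun _ => 0); split=> [[]//|]; by rewrite big_ord0.
Qed.

Lemma ring_socle_id I B : minimal_ring_ideal Z_G I -> I B -> soc B.
Proof.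
move=> minI IB; exists 1%N, (fun _ => B); split; first by move=> i; exists I.
by rewrite big_ord1.
Qed.

Lemma ring_socleD B C : soc B -> soc C -> soc (B + C).
Proof.
case=> k [A_ [mA ->]] [l [B_ [mB ->]]].
exists (k + l)%N.
exists (fun i => match split i with inl j => A_ j | inr j => B_ j end); split.
  by move=> i; case: split => j.
rewrite big_split_ord /=; congr (_ + _); apply: eq_bigr => i _.
  by have := unsplitK (inl i : 'I_k + 'I_l) => /= ->.
by have := unsplitK (inr i : 'I_k + 'I_l) => /= ->.
Qed.

Lemma ring_socle_sum I (r : seq I) (P : pred I) (B : I -> 'M[F]_nG) :
  (forall i, P i -> soc (B i)) -> soc (\sum_(i <- r | P i) B i).
Proof.
by move=> sB; apply: big_ind => //; [apply: ring_socle0 | apply: ring_socleD].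
Qed.

Lemma ring_socle_sub B : soc B -> (B \in Z_G)%MS.
Proof.
case=> k [B_ [mB ->]]; rewrite linear_sum /= summx_sub // => i _.
by have [I [[sI _ _ _] _ _] /sI] := mB i.
Qed.

Lemma regular_mulK x (B : 'M[F]_nG) : x \in G -> aG x^-1%g *m (aG x *m B) = B.
Proof. by move=> Gx; rewrite mulmxA -repr_mxM ?groupV // mulVg repr_mx1 mul1mx. Qed.

(** The row space of a central element is a module for G, and a p-group acting
    on a nonzero module in characteristic p fixes a nonzero vector. *)
Lemma center_pgroup_fixed p (U : {group gT}) (B : 'M[F]_nG) :
    p \in [pchar F] -> p.-group U -> U \subset G -> (B \in Z_G)%MS -> B != 0 ->
  exists2 v : 'rV_nG, (v <= B)%MS && (v != 0) & {in U, forall u, v *m aG u = v}.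
Proof.
move=> hp pU sUG /gring_centerP[RB cB] nzB.
have modB: mxmodule aG B.
  by apply/mxmoduleP=> x Gx; rewrite -cB // submxMl.
have := rfix_pgroup_pchar hp (submod_repr modB) _ pU sUG.
rewrite lt0n mxrank_eq0 nzB => /(_ isT).
rewrite (eqmx_eq0 (rfix_submod modB sUG)) in_submod_eq0 => nz; have: (B :&: rfix_mx aG U)%MS != 0.
  apply: contra nz => /eqP->; exact: sub0mx.
case/rowV0Pn=> v; rewrite sub_capmx => /andP[vB vU] nzv; exists v.
  by rewrite vB.
exact/rfix_mxP.
Qed.

(** The products B *m X with B in I form an ideal contained in I. If they do
    not all vanish, minimality makes every B in I of the form C *m X with C in
    I; then C has larger rank than B, as it has a nonzero U-fixed vector in
    its row space and X kills this vector. So I would contain matrices of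
    unbounded rank. *)
Lemma minimal_ideal_kill p (U : {group gT}) I (X : 'M[F]_nG) :
    p \in [pchar F] -> p.-group U -> U \subset G ->
    minimal_ring_ideal Z_G I -> (X \in Z_G)%MS ->
    (forall v : 'rV_nG, {in U, forall u, v *m aG u = v} -> v *m X = 0) ->
  forall B, I B -> B *m X = 0.
Proof.
move=> hp pU sUG [idI _ minI] ZX kX B0 IB0; apply/eqP/negP=> /negP nzB0X.
have [sI I0 IB IM] := idI.
pose J (C : 'M[F]_nG) := exists2 B, I B & C = B *m X.
have defI: forall C, I C -> J C.
  apply: minI; last 2 first.
  - by exists (B0 *m X); [exists B0 | apply/eqP].
  - by move=> _ [B IB' ->]; have [] := IM X B ZX IB'.
  split.
  - by move=> _ [B IB' ->]; apply: center_gring_mul => //; apply: sI.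
  - by exists 0; rewrite ?mul0mx.
  - move=> _ _ [B IB' ->] [C IC ->]; exists (B - C); first exact: IB.
    by rewrite mulmxBl.
  move=> Y _ ZY [B IB' ->]; have [IYB IBY] := IM Y B ZY IB'; split.
    by exists (Y *m B); rewrite // mulmxA.
  exists (B *m Y); rewrite // -!mulmxA; congr (_ *m _).
  by apply: center_gring_comm; rewrite ?center_gring_sub.
suff: forall k, exists2 B, I B & (k < \rank B)%N.
  by case/(_ nG)=> B _; rewrite ltnNge rank_leq_row.
elim=> [|k [B IB' ltkB]].
  exists B0 => //; rewrite lt0n mxrank_eq0; apply: contraNneq nzB0X => ->.
  by rewrite mul0mx.
have [C IC defB] := defI B IB'; exists C => //.
apply: (leq_ltn_trans ltkB); rewrite -(mxrank_mul_ker C X) -defB -addn1 leq_add2l.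
rewrite lt0n mxrank_eq0.
have nzC: C != 0.
  by apply: contraTneq ltkB => C0; rewrite defB C0 mul0mx mxrank0.
have [v /andP[vC nzv] fv] := center_pgroup_fixed hp pU sUG (sI C IC) nzC.
apply: contraNneq nzv => cap0; rewrite -submx0 -cap0 sub_capmx vC /=.
by apply/sub_kermxP; apply: kX.
Qed.

(** For x in G and a minimal ideal I fixed by G', the set x I consists of
    central elements because y x = x y [y, x], and it is again a minimal
    ideal. So multiplication by elements of G preserves the socle. *)
Lemma socle_ideal_of_invariant :
    (forall I, minimal_ring_ideal Z_G I ->
       forall B, I B -> {in G^`(1)%g, forall u, aG u *m B = B}) ->
  ring_ideal R_G soc.
Proof.
move=> fixI.
have mulG I x B : minimal_ring_ideal Z_G I -> I B -> x \in G ->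
    soc (aG x *m B) /\ soc (B *m aG x).
  move=> mI IB Gx; have [[sI I0 IB' IM] nzI minI] := mI.
  have ZB C : I C -> (aG x *m C \in Z_G)%MS.
    move=> IC; have [RC cC] := gring_centerP _ (sI C IC).
    apply/gring_centerP; split=> [|y Gy].
      by rewrite gring_mul_mem ?mem_regular_gring.
    rewrite -[RHS]mulmxA -cC // !mulmxA -!repr_mxM // (commgC y x).
    have dyx: [~ y, x]%g \in G^`(1)%g by rewrite derg1 mem_commg.
    rewrite (repr_mxM _ (groupM Gx Gy)) ?groupR // -mulmxA.
    by rewrite (fixI I mI C IC _ dyx).
  suff mxI: minimal_ring_ideal Z_G (fun C => I (aG x^-1%g *m C)).
    have sxB: soc (aG x *m B) by apply: ring_socle_id mxI _; rewrite regular_mulK.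
    by split=> //; have [_ cB] := gring_centerP _ (sI B IB); rewrite -cB.
  have Gx' := groupVr Gx.
  have recC (C : 'M[F]_nG) : aG x *m (aG x^-1%g *m C) = C.
    by have := regular_mulK C Gx'; rewrite invgK.
  split.
  - split.
    + by move=> C IC; rewrite -[C]recC; apply: ZB.
    + by rewrite mulmx0.
    + by move=> C D IC ID; rewrite mulmxBr; apply: IB'.
    move=> Y C ZY IC; have [IYC ICY] := IM Y _ ZY IC.
    have [RY cY] := gring_centerP _ ZY.
    by rewrite !mulmxA cY // -[Y *m _ *m _]mulmxA.
  - have [C IC nzC] := nzI; exists (aG x *m C); first by rewrite regular_mulK.
    by move=> /(congr1 (mulmx (aG x^-1%g))); rewrite regular_mulK // mulmx0.
  move=> J [sJ J0 JB JM] [C JC nzC] sJI D ID.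
  have:= minI (fun C => J (aG x *m C)) _ _ _ _ ID; rewrite recC; apply.
  - split.
    + move=> E JE; apply: sI; rewrite -[E](regular_mulK E Gx); exact: sJI.
    + by rewrite mulmx0.
    + by move=> E E' JE JE'; rewrite mulmxBr; apply: JB.
    move=> Y E ZY JE; have [JYE JEY] := JM Y _ ZY JE.
    have [RY cY] := gring_centerP _ ZY.
    by rewrite !mulmxA cY // -[Y *m _ *m _]mulmxA.
  - exists (aG x^-1%g *m C); first by rewrite recC.
    by move=> /(congr1 (mulmx (aG x))); rewrite recC mulmx0.
  by move=> E JE; rewrite -[E](regular_mulK E Gx); apply: sJI.
split.
- by move=> B /ring_socle_sub/center_gring_sub.
- exact: ring_socle0.
- move=> B C sB [k [C_ [mC ->]]]; apply: ring_socleD => //.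
  rewrite -sumrN; apply: ring_socle_sum => i _.
  have [I mI IC] := mC i; apply: (ring_socle_id mI); rewrite -scaleN1r.
  by apply: center_idealZ IC; case: mI.
move=> _ _ /envelop_mxP[f ->] [k [B_ [mB ->]]]; split.
  rewrite mulmx_suml; apply: ring_socle_sum => x Gx.
  rewrite -scalemxAl mulmx_sumr scaler_sumr; apply: ring_socle_sum => i _.
  have [I mI IC] := mB i; rewrite scalemxAr.
  have [] // := mulG I x (f x *: B_ i) mI _ Gx.
  by apply: center_idealZ IC; case: mI.
rewrite mulmx_sumr; apply: ring_socle_sum => x Gx.
rewrite -scalemxAr mulmx_suml scaler_sumr; apply: ring_socle_sum => i _.
have [I mI IC] := mB i; rewrite scalemxAl.
have [] // := mulG I x (f x *: B_ i) mI _ Gx.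
by apply: center_idealZ IC; case: mI.
Qed.

Lemma gring_coef_gset (B : 'M[F]_nG) (A : {set gT}) g :
    (B \in R_G)%MS -> A \subset G -> g \in G ->
  gring_coef (B *m gset_mx F G A) g = \sum_(x in A) gring_coef B (g * x^-1)%g.
Proof.
move=> RB /subsetP sAG Gg; rewrite mulmx_sumr gring_coef_sum.
by apply: eq_bigr => x /sAG Gx; rewrite gring_coef_mulr.
Qed.

Lemma gset_class_center x : x \in G -> (gset_mx F G (x ^: G) \in Z_G)%MS.
Proof.
move=> Gx; rewrite -classg_base_center.
apply: (eq_row_sub (enum_rank_in (mem_classes Gx) (x ^: G))).
by rewrite rowK enum_rankK_in ?mem_classes.
Qed.

Lemma center_gset_ind (B : 'M[F]_nG) :
    (B \in Z_G)%MS ->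
  exists u : {set gT} -> F, B = \sum_(C in classes G) u C *: gset_mx F G C.
Proof.
rewrite -classg_base_center => /submxP[u defB].
pose v C := \sum_(i | enum_val i == C :> {set gT}) u 0 i.
exists v; apply: (can_inj mxvecK); rewrite defB mulmx_sum_row.
rewrite (partition_big (fun i => enum_val i) (fun C => C \in classes G)) /=; last first.
  by move=> i _; apply: enum_valP.
rewrite linear_sum; apply: eq_bigr => C clC; rewrite linearZ /= scaler_suml.
by apply: eq_bigr => i /eqP iC; rewrite rowK iC.
Qed.

(** The hypotheses on f say that the element z with coefficients f is central
    and that every class sum multiplies it by a scalar, so that F z is a
    minimal ideal unless z = 0. Once the socle is an ideal, z times an element
    of G is central as well, which makes z invariant under all commutators. *)
Lemma socle_ideal_class_fun f :
    ring_ideal R_G soc -> {in G &, forall g x, f (g ^ x)%g = f g} ->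
    {in G, forall x, exists c, {in G, forall g,
       \sum_(y in x ^: G) f (g * y^-1)%g = c * f g}} ->
  {in G & G^`(1)%g, forall g u, f (g * u)%g = f g}.
Proof.
move=> idS cf eigf; pose z := gring_of_fun f.
have Zz : (z \in Z_G)%MS by apply: class_fun_center.
have Rz := center_gring_sub Zz.
have zE: {in G, gring_coef z =1 f} by move=> g Gg; rewrite gring_of_funK.
have eigz (Y : 'M[F]_nG) : (Y \in Z_G)%MS -> exists c, z *m Y = c *: z.
  case/center_gset_ind=> u ->; rewrite mulmx_sumr.
  apply: (big_ind (fun Y => exists c, Y = c *: z)).
  - by exists 0; rewrite scale0r.
  - by move=> _ _ [c ->] [d ->]; exists (c + d); rewrite scalerDl.
  move=> _ /imsetP[x Gx ->]; rewrite -scalemxAr.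
  have [c cE] := eigf x Gx; exists (u (x ^: G) * c); rewrite -scalerA.
  congr (_ *: _); apply: gring_coef_inj => [||g Gg].
  - by rewrite gring_mul_mem // center_gring_sub ?gset_class_center.
  - by rewrite linearZ /= scalemx_sub.
  rewrite gring_coef_gset ?class_subG // gring_coefZ zE // -cE //.
  by apply: eq_bigr => y /(subsetP (class_subG Gx (subxx G))) Gy; rewrite zE ?groupM ?groupV.
have sz: soc z.
  have [->|nzz] := eqVneq z 0; first exact: ring_socle0.
  have idI: minimal_ring_ideal Z_G (fun Y => exists c, Y = c *: z).
    split.
    - split.
      + by move=> _ [c ->]; apply: center_mulZ.
      + by exists 0; rewrite scale0r.
      + by move=> _ _ [c ->] [d ->]; exists (c - d); rewrite scalerBl.
      move=> Y _ ZY [c ->]; have [d dE] := eigz Y ZY.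
      rewrite -scalemxAl -scalemxAr.
      rewrite -(center_gring_comm ZY Rz) dE.
      by split; exists (c * d); rewrite scalerA.
    - by exists z; [exists 1; rewrite scale1r | apply/eqP].
    move=> J idJ [A JA nzA] sJ _ [c ->]; have [d defA] := sJ A JA.
    suff <-: (c / d) *: A = c *: z by apply: center_idealZ JA.
    rewrite defA scalerA mulfVK //; apply: contra_not_neq nzA => d0.
    by rewrite defA d0 scale0r.
  by apply: (ring_socle_id idI); exists 1; rewrite scale1r.
(* The element z a^-1 lies in the socle, so it commutes with b^-1; comparing
   coefficients at g a^-1 b^-1 gives the equality. *)
have fR: {in G & G, forall a b, {in G, forall g, f (g * [~ a, b])%g = f g}}.
  move=> a b Ga Gb g Gg; have [_ _ _ idM] := idS.
  have Rx x : x \in G -> (aG x \in R_G)%MS by apply: mem_regular_gring.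
  have [_ cz] := gring_centerP _ Zz.
  have [Ra Rb] := (groupVr Ga, groupVr Gb).
  have [_ /ring_socle_sub/gring_centerP[_ cza]] := idM _ _ (Rx _ Ra) sz.
  have := cza _ Rb; rewrite mulmxA cz // -!mulmxA -!repr_mxM //.
  move/(congr1 (fun C => gring_coef C (g * (a^-1 * b^-1))%g)).
  rewrite !gring_coef_mulr ?groupM // !zE ?groupM ?groupV ?groupM // mulgK => <-.
  by rewrite commgEl conjgE !invMg !invgK !mulgA.
pose S := [set u in G | [forall g in G, f (g * u)%g == f g]].
have SP u : reflect (u \in G /\ {in G, forall g, f (g * u)%g = f g}) (u \in S).
  rewrite inE; apply: (iffP andP) => -[Gu fu]; split=> //.
    by move=> g Gg; apply/eqP; apply: (forall_inP fu).
  by apply/forall_inP=> g Gg; rewrite fu.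
have gS: group_set S.
  apply/group_setP; split; first by apply/SP; split=> // g _; rewrite mulg1.
  move=> u v /SP[Gu fu] /SP[Gv fv]; apply/SP; split=> [|g Gg]; first exact: groupM.
  by rewrite mulgA fv ?fu ?groupM.
suff sG'S: G^`(1)%g \subset Group gS.
  by move=> g u Gg /(subsetP sG'S)/SP[_ ->].
rewrite derg1 gen_subG; apply/subsetP=> _ /imset2P[a b Ga Gb ->].
by apply/SP; split=> [|g Gg]; rewrite ?groupR ?fR.
Qed.

End Socle.
End GroupAlgebra.

(** * Fixed-point-free action modulo a normal subgroup *)

Section CommSurj.
Variable gT : finGroupType.
Implicit Types (K D H L : {group gT}).

(** An element y without nontrivial fixed points on K / D makes the map X |->
    [y, X] injective on this finite group, hence onto. *)
Lemma commg_onto K D y : D <| K -> y \in 'N(K) -> y \in 'N(D) ->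
    {in K, forall k, [~ y, k] \in D -> k \in D} ->
  {in K, forall k, exists2 k1, k1 \in K & [~ y, k1]^-1 * k \in D}.
Proof.
move=> nDK nKy nDy fpf k Kk; have [sDK nDKs] := andP nDK.
have nDx x : x \in K -> x \in 'N(D) by apply: subsetP nDKs x.
pose c X := [~ coset D y, X].
have injc: {in K / D &, injective c}.
  move=> _ _ /morphimP[a Na Ka ->] /morphimP[b Nb Kb ->] /= eqc.
  have{eqc}: coset D y ^ coset D a = coset D y ^ coset D b.
    by apply: (mulgI (coset D y)^-1); rewrite -!commgEl.
  move/(canRL (conjgK _)); rewrite -conjgM -morphV // -morphM ?groupV // => eqy.
  have: [~ y, b * a^-1] \in D.
    apply: coset_idr; first by rewrite groupR ?groupM ?groupV.
    by rewrite morphR ?groupM ?groupV //= commgEl -eqy mulVg.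
  move/fpf; rewrite groupM ?groupV // => /(_ isT) Dab.
  apply/eqP; rewrite eq_sym eq_mulgV1 -morphV // -morphM ?groupV //.
  by rewrite /= coset_id.
have: c @: (K / D) = K / D.
  apply/eqP; rewrite eqEcard (card_in_imset injc) leqnn andbT.
  apply/subsetP=> _ /imsetP[_ /morphimP[a Na Ka ->] ->].
  rewrite /c -morphR //= mem_quotient // commgEr groupM // memJ_norm ?groupV //.
have Nk := nDx k Kk; move/setP/(_ (coset D k)); rewrite mem_quotient //.
case/imsetP=> _ /morphimP[a Na Ka ->] eqk; exists a => //.
have Nya: [~ y, a] \in 'N(D) by rewrite groupR.
apply: coset_idr; first by rewrite groupM ?groupV.
by rewrite morphM ?groupV // morphV //= eqk /c morphR //= mulVg.
Qed.

Lemma class_sdprod_abelian K H L h : K ><| H = L -> abelian H -> h \in H ->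
  h ^: L = h ^: K.
Proof.
move=> defL cHH Hh; have [/= nKL sHL defKH nKH tiKH] := sdprod_context defL.
have sKL := normal_sub nKL.
apply/eqP; rewrite eqEsubset (classS _ sKL) andbT.
apply/subsetP=> _ /imsetP[l Ll ->]; move: Ll; rewrite -defKH.
case/mulsgP=> k x Kk Hx ->.
have -> : h ^ (k * x) = (h ^ x) ^ (k ^ x) by rewrite -conjJg -conjgM.
rewrite [h ^ x]conjgE (centsP cHH h Hh x Hx) mulKg memJ_class //.
by rewrite memJ_norm ?(subsetP nKH).
Qed.

Lemma sdprod_abelian_der1 K H L : K ><| H = L -> abelian H -> L^`(1) \subset K.
Proof.
move=> defL cHH; have [/= /andP[sKL nKL] _ _ _ _] := sdprod_context defL.
rewrite der1_min // -(isog_abelian (sdprod_isog defL)) //.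
Qed.

Lemma cent1_fpf K h : h \in 'C(K^`(1)) ->
    {in K, forall k, [~ h, k] \in K^`(1) -> k \in K^`(1)} ->
  'C_K[h] = K^`(1).
Proof.
move=> cDh fpfh; apply/eqP; rewrite eqEsubset; apply/andP; split.
  apply/subsetP=> k /setIP[Kk /cent1P chk]; apply: (fpfh k Kk).
  by rewrite (eqP (introT commgP _)) // /commute chk.
rewrite subsetI der_sub /=; apply/subsetP=> d Dd; apply/cent1P.
by apply: commute_sym; apply: (centP cDh).
Qed.

Lemma pgroup_dvd_index_der1 p K : prime p -> p.-group K -> K :!=: 1 -> p %| #|K : K^`(1)|.
Proof.
move=> p_pr pK ntK; apply: contraT; rewrite -p'natE // => p'i.
have pi: p.-nat #|K : K^`(1)| by apply: pnat_dvd pK; apply: dvdn_indexg.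
have /eqP := pnat_1 pi p'i; rewrite indexg_eq1 => sKD.
have := sol_der1_proper (nilpotent_sol (pgroup_nil pK)) (subxx K) ntK.
by rewrite properE sKD andbF.
Qed.

End CommSurj.

(** * Class functions on one factor K ><| H *)

Section CaminaFrobenius.

Variables (F : fieldType) (p : nat) (gT : finGroupType).
Variables (K H L : {group gT}) (f : gT -> F) (h : gT).
Local Notation D := K^`(1).

Hypotheses (hp : p \in [pchar F]%R) (defL : K ><| H = L) (cHH : abelian H).
Hypotheses (p'H : p^'.-group H) (pKD : p %| #|K : D|).
Hypotheses (camK : camina_group K) (sDZ : D \subset 'Z(K)).
Hypothesis trH : {in K :\: D &, forall g g',
  exists2 x, x \in H & g ^ x * g'^-1 \in D}.
Hypothesis fpfH : {in H^#, forall y, {in K, forall k, [~ y, k] \in D -> k \in D}}.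
Hypotheses (Hh : h \in H^#) (cDh : h \in 'C(D)).
Hypothesis cf : {in L &, forall g x, f (g ^ x) = f g}.
Hypothesis sumD : {in D, forall x, {in L, forall g,
  (\sum_(c in x ^: L) f (g * c^-1)%g = #|x ^: L|%:R * f g)%R}}.
Hypothesis sumh : {in L, forall g, (\sum_(c in h ^: L) f (g * c^-1)%g = 0)%R}.

(** The function f stands for the coefficients of an element of a minimal
    ideal. The relations for the classes inside D = K' make f constant on y D
    for y in H; fixed-point-freeness spreads this to y K when y <> 1, and the
    Camina property with the transitivity of H makes f constant on K outside
    D. The relation for the class of h, which has order divisible by p,
    compares the last value with f 1. *)
Lemma camina_frobenius_const : {in L & K, forall l k, f (l * k) = f l}.
Proof.
have [/= nKL sHL defKH nKH tiKH] := sdprod_context defL.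
have sKL := normal_sub nKL; have nDL: D <| L by apply: char_normal_trans (der_char 1 K) nKL.
have nDK := der_normal 1 K; have sDK := normal_sub nDK.
have sDL := normal_sub nDL.
have Ll: forall l, l \in L -> exists2 k, k \in K & exists2 y, y \in H & l = k * y.
  by move=> l; rewrite -defKH => /mulsgP[k y Kk Hy ->]; exists k => //; exists y.
have cDK : {in D & K, forall d k, d ^ k = d}.
  move=> d k Dd Kk; apply/conjg_fixP/commgP.
  by have /setIP[_ /centP] := subsetP sDZ d Dd; apply.
have p_pr := pcharf_prime hp.
(* The class of d^-1 is its H-orbit, of order prime to p, and f takes the same
   value f (y * d) at all the points of the sum. *)
have fa: {in H & D, forall y d, f (y * d) = f y}.
  move=> y d Hy Dd; have Dd' := groupVr Dd; have Ly := subsetP sHL y Hy.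
  have clE: d^-1 ^: L = d^-1 ^: H.
    apply/eqP; rewrite eqEsubset (classS _ sHL) andbT.
    apply/subsetP=> _ /imsetP[_ /Ll[k Kk [x Hx ->]] ->].
    by rewrite conjgM (cDK _ k Dd') // memJ_class.
  have := sumD Dd' Ly; rewrite clE.
  rewrite (eq_bigr (fun _ => f (y * d)%g)) => [|_ /imsetP[x Hx ->]]; last first.
    have [Lx Ld] := (subsetP sHL x Hx, subsetP sDL d Dd).
    rewrite -(cf (x := y * d) (y := x)) ?groupM //.
    by rewrite conjMg -conjVg invgK [y ^ x]conjgE (centsP cHH y Hy x Hx) mulKg.
  rewrite sumr_const -[LHS]mulr_natl; apply: mulfI.
  rewrite -(dvdn_pcharf hp) -p'natE //; apply: pnat_dvd p'H.
  by rewrite -index_cent1 dvdn_indexg.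
(* Every element of y K is K-conjugate to an element of y D. *)
have fb: {in H^# & K, forall y k, f (y * k) = f y}.
  move=> y k Hy1 Kk; have /setD1P[_ Hy] := Hy1; have Ly := subsetP sHL y Hy.
  have nKy := subsetP nKH y Hy.
  have nDy : y \in 'N(D) by apply: (subsetP (char_norm_trans (der_char 1 K) nKH)).
  have [k1 Kk1 Dk1] := commg_onto nDK nKy nDy (fpfH Hy1) Kk.
  have Lk1 := subsetP sKL k1 Kk1; have Ld := subsetP sDL _ Dk1.
  have -> : y * k = (y * ([~ y, k1]^-1 * k)) ^ k1.
    by rewrite conjMg (cDK _ k1 Dk1) // commgEl invMg invgK !mulgA mulgV mul1g.
  by rewrite (cf (groupM Ly Ld) Lk1) fa.
(* All the cosets k D other than D are single K-classes, and H permutes them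
   transitively. *)
have fc: {in K :\: D &, forall g g', f g = f g'}.
  move=> g g' KDg KDg'; have [x Hx Dgx] := trH KDg KDg'.
  have /setDP[Kg _] := KDg; have /setDP[Kg' _] := KDg'.
  have [Lg Lg'] := (subsetP sKL g Kg, subsetP sKL g' Kg').
  rewrite -(cf Lg (subsetP sHL x Hx)).
  have: g ^ x \in g' ^: K.
    rewrite camK // mem_lcoset; suff ->: g'^-1 * g ^ x = (g ^ x * g'^-1) ^ g'.
      by rewrite cDK.
    by rewrite [RHS]conjgE mulgKV.
  by case/imsetP=> k Kk ->; rewrite cf // (subsetP sKL).
have /setD1P[nt_h Hh'] := Hh; have Lh := subsetP sHL h Hh'.
have nKh := subsetP nKH h Hh'.
have clh := class_sdprod_abelian defL cHH Hh'.
have cKh := cent1_fpf cDh (fpfH Hh).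
(* In the relation for the class of h, evaluated at h, one term is f 1; the
   other terms all lie in K outside D, and there are -1 of them modulo p. *)
have f1: {in K, forall k, f k = f 1}.
  move=> k Kk; have [Dk|nDk] := boolP (k \in D).
    by rewrite -[k]mul1g fa.
  have := sumh Lh; rewrite clh (bigD1 h) ?class_refl //= mulgV.
  rewrite (eq_bigr (fun _ => f k)) => [|c /andP[/imsetP[x Kx ->] ntc]]; last first.
    apply: fc; last by rewrite inE nDk.
    have -> : h * (h ^ x)^-1 = [~ h^-1, x] by rewrite commgEl invgK conjVg.
    have Kc : [~ h^-1, x] \in K.
      by rewrite commgEr groupM // memJ_norm ?groupV.
    rewrite inE Kc andbT; apply: contra ntc => Dc; apply/eqP.
    have: x \in 'C_K[h]; last by case/setIP=> _ /cent1P cx; apply/conjg_fixP/commgP.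
    rewrite cKh; apply: (@fpfH h^-1 _ x Kx) => //.
    by rewrite !inE invg_eq1 nt_h groupV.
  have dvd_cl: p %| #|h ^: K| by rewrite -index_cent1 cKh.
  rewrite sumr_const; set m := #|_|.
  have Em: #|h ^: K| = m.+1.
    rewrite (cardsD1 h (h ^: K)) class_refl /= /m; congr (_.+1); apply: eq_card => c.
    by rewrite !inE andbC.
  have: (f k *+ m.+1 = 0)%R.
    have /dvdnP[q Eq] := dvd_cl; rewrite -Em Eq.
    by rewrite mulnC mulrnA (mulrn_pchar hp) mul0rn.
  by rewrite mulrS => <- /addIr.
move=> _ k /Ll[k0 Kk0 [y Hy ->]] Kk.
have fKy: {in K, forall k, f (k * y) = f y}.
  move=> {}k {}Kk; have Kky: k ^ y \in K by rewrite memJ_norm ?(subsetP nKH).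
  rewrite conjgC; have [->|nty] := eqVneq y 1; last by rewrite fb // !inE nty.
  by rewrite mul1g conjg1 f1.
have Kky: k ^ y^-1 \in K by rewrite memJ_norm ?groupV ?(subsetP nKH).
rewrite -mulgA [y * k]conjgCV mulgA.
by rewrite (fKy _ (groupM Kk0 Kky)) fKy.
Qed.
End CaminaFrobenius.

(** * The factors, described by conjugation inside the group *)

Section CaminaSdprod.

Variable gT : finGroupType.
Implicit Types (K H L : {group gT}).

(** A transitive group of the same order as the set it permutes acts
    regularly. *)
Lemma regular_coset_fpf K H : H \subset 'N(K) ->
    #|H| = (#|K : K^`(1)| - 1)%N ->
    {in K :\: K^`(1) &, forall g g', exists2 x, x \in H & g ^ x * g'^-1 \in K^`(1)} ->
  {in H^#, forall y, {in K, forall k, [~ y, k] \in K^`(1) -> k \in K^`(1)}}.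
Proof.
move=> nKH oH trH y /setD1P[nty Hy] k Kk Dyk; apply: contraR nty => nDk.
have nDH: H \subset 'N(K^`(1)) by apply: char_norm_trans (der_char 1 K) nKH.
have nDK := der_norm 1 K.
have KDk: k \in K :\: K^`(1) by rewrite inE nDk.
pose phi x := coset K^`(1) (k ^ x).
have Kkx x : x \in H -> k ^ x \in K by move=> Hx; rewrite memJ_norm ?(subsetP nKH).
have Nkx x : x \in H -> k ^ x \in 'N(K^`(1)) by move=> Hx; rewrite (subsetP nDK) ?Kkx.
have im_phi: phi @: H = (K / K^`(1))^#.
  apply/eqP; rewrite eqEsubset; apply/andP; split.
    apply/subsetP=> _ /imsetP[x Hx ->]; rewrite !inE mem_quotient ?Kkx // andbT.
    apply: contra nDk => /eqP; rewrite /phi => /coset_idr; rewrite Nkx // => /(_ isT).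
    by rewrite memJ_norm ?(subsetP nDH).
  apply/subsetP=> X /setD1P[nt /morphimP[g Ng Kg def_g]]; rewrite {X}def_g /= in nt *.
  have KDg: g \in K :\: K^`(1).
    by rewrite inE Kg andbT; apply: contra nt => Dg; rewrite coset_id.
  have [x Hx Dx] := trH k g KDk KDg; apply/imsetP; exists x => //.
  rewrite /phi; apply/eqP; rewrite eq_sym eq_mulgV1 -morphV // -morphM ?groupV ?Nkx //=.
  by rewrite coset_id.
have inj_phi: {in H &, injective phi}.
  apply/imset_injP/eqP; rewrite im_phi oH -card_quotient //.
  by rewrite (cardsD1 1 (K / _)) group1 addKn.
apply/eqP; apply: inj_phi => //; rewrite /phi conjg1.
have Dky: [~ k, y] \in K^`(1) by rewrite -invg_comm groupV.
have Nk: k \in 'N(K^`(1)) by apply: (subsetP nDK).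
have Nky: [~ k, y] \in 'N(K^`(1)) by apply: (subsetP (normG _)) Dky.
by rewrite conjg_mulR morphM //= (coset_id Dky) mulg1.
Qed.

(** The conditions on the automorphism are restated for the complement H
    acting by conjugation; the element h comes from the failure of
    faithfulness on K'. *)
Lemma camina_sdprod_cycleE p L : camina_sdprod_cycle p L ->
  exists K H h,
   [/\ [/\ K ><| H = L, abelian H & #|H| = (#|K : K^`(1)| - 1)%N],
       [/\ camina_group K, p.-group K & nil_class K = 2],
       {in K :\: K^`(1) &, forall g g',
          exists2 x, x \in H & g ^ x * g'^-1 \in K^`(1)},
       h \in H^# & h \in 'C(K^`(1))].
Proof.
case=> K [f [[Af [H defL isoH]] camK [of1 trf] nff]].
have [nKL _ _ nKH _] := sdprod_context defL.
pose g := restrm nKH (conj_aut K).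
have isoHg: isom H <[f]> g by [].
have [injg img] := isomP isoHg.
have fP a : a \in <[f]> -> exists2 x, x \in H & a = conj_aut K x.
  by rewrite -img => /morphimP[x _ Hx ->]; exists x.
have gE x k : x \in H -> k \in K -> aperm k (conj_aut K x) = k ^ x.
  by move=> Hx Kk; rewrite /aperm norm_conj_autE // (subsetP nKH).
have cHH: abelian H by rewrite -(injm_abelian injg) // img cycle_abelian.
have oH: #|H| = (#|K : K^`(1)| - 1)%N by rewrite (isom_card isoHg) -of1.
move: nff; rewrite /faithful => /subsetPn[a /setIP[/fP[h Hh defa] caD] nta].
exists K, H, h; split=> //.
- move=> x y /setDP[Kx nDx] /setDP[Ky nDy].
  have mem z : z \in K -> z \notin K^`(1) -> K^`(1) :* z \in rcosets K^`(1) K :\ (K^`(1) : {set gT}).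
    move=> Kz nDz; rewrite !inE mem_rcosets (mulSGid (der_sub 1 K)) Kz andbT.
    by apply: contra nDz => /eqP <-; rewrite rcoset_refl.
  have [b /fP[z Hz ->] defy] := atransP2 trf (mem x Kx nDx) (mem y Ky nDy).
  exists z => //; rewrite -mem_rcoset defy.
  by rewrite -(gE _ _ Hz Kx) mem_setact ?rcoset_refl.
- rewrite !inE Hh andbT; apply: contraNneq nta => h1.
  by rewrite defa h1 morph1 set11.
apply/centP=> d Dd; apply/commute_sym/commgP/conjg_fixP.
have Kd := subsetP (der_sub 1 K) d Dd.
by rewrite -(gE _ _ Hh Kd) -defa; apply: (astab_act caD).
Qed.

End CaminaSdprod.

(** * Central products of such factors have an ideal socle *)

Section CentralProductSocle.

Variables (F : fieldType) (p : nat) (gT : finGroupType) (G : {group gT}).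
Hypothesis hp : p \in [pchar F]%R.

Local Notation aG := (regular_repr F G).
Local Notation R_G := (group_ring F G).
Local Notation Z_G := 'Z(group_ring F G)%MS.

(** The central element C - #|C|, where C is the class of x, kills the vectors
    v fixed by U: as C lies in U y, the sum of C maps v to #|C| v y, and this
    is #|C| v if y = 1 and 0 if p divides #|C|. *)
Lemma minimal_ideal_class_sum (U : {group gT}) I x y :
    p.-group U -> U \subset G -> minimal_ring_ideal Z_G I ->
    x \in G -> y \in G -> x ^: G \subset U :* y ->
    y = 1 \/ p %| #|x ^: G| ->
  forall B, I B -> {in G, forall g,
    (\sum_(c in x ^: G) gring_coef B (g * c^-1)%g
      = #|x ^: G|%:R * gring_coef B g)%R}.
Proof.
move=> pU sUG mI Gx Gy sCU oC B IB g Gg.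
have ZC := gset_class_center F Gx; have sCG: x ^: G \subset G by apply: class_subG.
pose X := (gset_mx F G (x ^: G) - #|x ^: G|%:R%:M)%R.
have ZX : (X \in Z_G)%MS.
  by rewrite linearB /= addmx_sub ?eqmx_opp ?scalar_gring_center.
have [[sI _ _ _] _ _] := mI; have RB := center_gring_sub (sI B IB).
have kX (v : 'rV_#|G|) : {in U, forall u, v *m aG u = v}%R -> (v *m X = 0)%R.
  move=> fixv; rewrite mulmxBr mulmx_sumr.
  rewrite (eq_bigr (fun _ => v *m aG y)%R) => [|c Cc]; last first.
    have /rcosetP[u Uu ->] := subsetP sCU c Cc.
    by rewrite (repr_mxM _ (subsetP sUG u Uu) Gy) mulmxA (fixv u Uu).
  rewrite sumr_const mul_mx_scalar -scaler_nat.
  case: oC => [->|]; first by rewrite repr_mx1 mulmx1 subrr.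
  by rewrite (dvdn_pcharf hp) => /eqP->; rewrite !scale0r subrr.
have := minimal_ideal_kill hp pU sUG mI ZX kX IB.
rewrite mulmxBr => /eqP; rewrite subr_eq0 => /eqP/(congr1 (fun C => gring_coef C g)).
by rewrite gring_coef_gset // mul_mx_scalar gring_coefZ.
Qed.

(** Let f be the coefficient function of an element B of a minimal ideal. The
    translations that leave f invariant form a normal subgroup TG of G, which
    contains each K_i by the study of one factor: elements of the other
    factors commute with G_i, so a translate of f by them restricts to a class
    function on G_i satisfying the same relations. Hence TG contains the
    derived subgroups of all factors, and so G'. *)
Lemma central_product_camina_socle n (Gs : 'I_n -> {group gT}) :
    central_product_of Gs G -> (forall i, camina_sdprod_cycle p (Gs i)) ->
  ring_ideal R_G (ring_socle Z_G).
Proof.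
case=> genG commGG camG; apply: socle_ideal_of_invariant => I mI B IB.
have [[sI _ _ _] _ _] := mI; have ZB := sI B IB; have RB := center_gring_sub ZB.
pose f := gring_coef B; have p_pr := pcharf_prime hp.
have cf : {in G &, forall g x, f (g ^ x) = f g} by apply: gring_coef_class.
pose T := [set u in G | [forall g in G, f (g * u) == f g]].
have TP u : reflect (u \in G /\ {in G, forall g, f (g * u) = f g}) (u \in T).
  rewrite inE; apply: (iffP andP) => -[Gu fu]; split=> //.
    by move=> g Gg; apply/eqP; apply: (forall_inP fu).
  by apply/forall_inP=> g Gg; rewrite fu.
have gT0: group_set T.
  apply/group_setP; split; first by apply/TP; split=> // g _; rewrite mulg1.
  move=> u v /TP[Gu fu] /TP[Gv fv]; apply/TP; split=> [|g Gg]; first exact: groupM.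
  by rewrite mulgA fv ?fu ?groupM.
pose TG := Group gT0.
have nTG: G \subset 'N(TG).
  apply/subsetP=> x Gx; rewrite inE; apply/subsetP=> _ /imsetP[u /TP[Gu fu] ->].
  apply/TP; split=> [|g Gg]; first exact: groupJ.
  rewrite -(cf _ x^-1) ?groupM ?groupJ ?groupV // conjMg conjgK fu ?groupJ ?groupV //.
  by rewrite cf ?groupV.
have sGsG i : Gs i \subset G.
  by rewrite -genG sub_gen // (bigcup_sup i).
have sDT i : (Gs i)^`(1) \subset TG.
  have [K [H [h [[defL cHH oH] [camK pK nilK] trH Hh cDh]]]] := camina_sdprod_cycleE (camG i).
  have [/= nKL sHL defKH nKH tiKH] := sdprod_context defL.
  have sKL := normal_sub nKL; have sKG := subset_trans sKL (sGsG i).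
  apply: subset_trans (sdprod_abelian_der1 defL cHH) _.
  have ntK: K :!=: 1 by rewrite -nil_class0 nilK.
  have pKD := pgroup_dvd_index_der1 p_pr pK ntK.
  have sDZ: K^`(1) \subset 'Z(K).
    rewrite subsetI der_sub; apply/commG1P; rewrite -lcn2 -lcnSn.
    by apply/(lcn_nil_classP 2 (pgroup_nil pK)); rewrite nilK.
  have p'H: p^'.-group H.
    rewrite /pgroup oH p'natE //; apply/negP=> pdv.
    have : p %| #|K : K^`(1)| - (#|K : K^`(1)| - 1) by apply: dvdn_sub.
    by rewrite subKn // dvdn1 => /eqP p1; rewrite p1 in p_pr.
  have fpfH := regular_coset_fpf nKH oH trH.
  have defG: G \subset Gs i * 'C_G(Gs i).
    rewrite -cent_joinEr ?subsetIr // -{1}genG gen_subG.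
    apply/bigcupsP=> j _; have [->|ji] := eqVneq j i; first exact: joing_subl.
    by apply: subset_trans (joing_subr _ _); rewrite subsetI sGsG; apply/commG1P/commGG.
  have clG x : x \in Gs i -> x ^: G = x ^: Gs i.
    move=> Lx; apply/eqP; rewrite eqEsubset (classS _ (sGsG i)) andbT.
    apply/subsetP=> _ /imsetP[_ /(subsetP defG)/mulsgP[a b La /setIP[_ cb] ->] ->].
    rewrite conjgM (conjg_fixP (y := b) _) ?memJ_class //.
    by apply/commgP/commute_sym; apply: (centP cb); rewrite groupJ.
  apply/subsetP=> k Kk; apply/TP; split=> [|g Gg]; first exact: (subsetP sKG).
  have /(subsetP defG)/mulsgP[a b La /setIP[Gb cb] defg] := Gg.
  have cbL x : x \in Gs i -> commute b x by apply: (centP cb).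
  rewrite {g}defg in Gg *; have ->: a * b * k = a * k * b.
    by rewrite -!mulgA (cbL k) // (subsetP sKL).
  pose fb y := f (y * b).
  have GsG x : x \in Gs i -> x \in G by apply: (subsetP (sGsG i)).
  have /setD1P[nth Hh'] := Hh; have Lh := subsetP sHL h Hh'.
  apply: (@camina_frobenius_const F p gT K H (Gs i) fb h) => //.
  - move=> x y Lx Ly; rewrite /fb -(cf _ _ (groupM (GsG x Lx) Gb) (GsG y Ly)) conjMg.
    by congr (f (_ * _)); apply/esym/conjg_fixP/commgP/cbL.
  - move=> x Dx g Lg; have Kx := subsetP (der_sub 1 K) x Dx.
    have Lx := subsetP sKL x Kx; rewrite -clG //.
    have sxK: x ^: G \subset K :* 1.
      by rewrite rcoset1 clG // class_sub_norm ?normal_norm.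
    have /= <- := minimal_ideal_class_sum pK sKG mI (GsG x Lx) (group1 G) sxK
                  (or_introl (erefl 1)) IB (groupM (GsG g Lg) Gb).
    apply: eq_bigr => c; rewrite clG // => /(subsetP (class_subG Lx (subxx _))) Lc.
    by rewrite /fb -!mulgA (cbL c^-1) ?groupV.
  move=> g Lg; rewrite -clG //.
  have clhK: h ^: G = h ^: K by rewrite clG // (class_sdprod_abelian defL).
  have dvdcl : p %| #|h ^: G|.
    by rewrite clhK -index_cent1 (cent1_fpf cDh (fpfH _ Hh)).
  transitivity (\sum_(c in h ^: G) gring_coef B ((g * b) * c^-1)%g)%R.
    apply: eq_bigr => c; rewrite clG // => /(subsetP (class_subG Lh (subxx _))) Lc.
    by rewrite /fb -!mulgA (cbL c^-1) ?groupV.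
  have shK: h ^: G \subset K :* h.
    rewrite clhK; apply/subsetP=> _ /imsetP[k1 Kk1 ->]; rewrite mem_rcoset.
    have ->: h ^ k1 * h^-1 = k1^-1 * k1 ^ h^-1 by rewrite !conjgE invgK !mulgA.
    by rewrite groupM ?groupV // memJ_norm ?groupV ?(subsetP nKH).
  have /= -> := minimal_ideal_class_sum pK sKG mI (GsG h Lh) (GsG h Lh) shK
                (or_intror dvdcl) IB (groupM (GsG g Lg) Gb).
  by move: dvdcl; rewrite (dvdn_pcharf hp) => /eqP->; rewrite mul0r.
have sG'T: G^`(1) \subset TG.
  have sUN: \bigcup_(i < n) Gs i \subset 'N(TG) by rewrite -gen_subG genG.
  rewrite der1_min // /abelian -[X in X / _]genG quotient_gen //.
  rewrite cent_gen gen_subG quotient_cents2 //.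
  rewrite gen_subG; apply/subsetP=> _ /imset2P[x y /bigcupP[i _ Gx] /bigcupP[j _ Gy] ->].
  have [eij|nij] := eqVneq i j.
    by rewrite -eij in Gy; apply: (subsetP (sDT i)); rewrite derg1 mem_commg.
  have: [~ x, y] \in [~: Gs i, Gs j] by apply: mem_commg.
  by rewrite commGG // => /set1P->; apply: group1.
move=> u /(subsetP sG'T)/TP[Gu fu].
apply: gring_coef_inj => [||g Gg] //; first by rewrite gring_mul_mem ?mem_regular_gring.
rewrite gring_coef_mull //.
rewrite -/f -(cf _ u^-1) ?groupM ?groupV // conjgE invgK -mulgA mulKVg.
by rewrite -{2}[g](mulgKV u) fu ?groupM ?groupV.
Qed.
End CentralProductSocle.

(** * Recognition of a factor *)

Section CaminaI.
Variable gT : finGroupType.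
Implicit Types K H L : {group gT}.

(** The automorphism is conjugation by a generator of H; the power of it that
    acts trivially on K' is conjugation by h. *)
Lemma camina_sdprod_cycleI (p : nat) K H L h :
    K ><| H = L -> cyclic H -> 'C_H(K) = 1 -> #|H| = (#|K : K^`(1)| - 1)%N ->
    camina_group K -> p.-group K -> nil_class K = 2 ->
    {in K :\: K^`(1) &, forall g g',
       exists2 x, x \in H & g ^ x * g'^-1 \in K^`(1)} ->
    h \in H^# -> h \in 'C(K^`(1)) ->
  camina_sdprod_cycle p L.
Proof.
move=> defL /cyclicP[x0 defH] faithH oH camK pK nilK trH /setD1P[nth Hh] cDh.
have [nKL _ _ nKH _] := sdprod_context defL.
have Hx0 : x0 \in H by rewrite defH cycle_id.
pose g := restrm nKH (conj_aut K).
have gE x k : x \in H -> k \in K -> aperm k (g x) = k ^ x.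
  by move=> Hx Kk; rewrite /aperm norm_conj_autE // (subsetP nKH).
have injg : 'injm g.
  by rewrite /g ker_restrm ker_conj_aut faithH.
have img : g @* H = <[g x0]>.
  apply/eqP; rewrite eqEsubset cycle_subG mem_morphim // andbT.
  apply/subsetP=> _ /morphimP[x _ Hx ->].
  have /cycleP[i ->] : x \in <[x0]> by rewrite -defH.
  by rewrite morphX // mem_cycle.
have isoH : isom H <[g x0]> g by apply/isomP.
have of1 : #[g x0] = (#|K : K^`(1)| - 1)%N by rewrite orderE -img card_injm.
have Kc k : k \in K -> (K^`(1) :* k \in rcosets K^`(1) K :\ (K^`(1) : {set gT})) = (k \notin K^`(1)).
  move=> Kk; rewrite in_setD1 mem_rcosets (mulSGid (der_sub 1 K)) Kk andbT; congr (~~ _).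
  by apply/eqP/idP=> [<-|]; [apply: rcoset_refl | apply: rcoset_id].
have nDH x : x \in H -> x \in 'N(K^`(1)).
  by apply: subsetP; apply: char_norm_trans (der_char 1 K) nKH.
have cJ x k : x \in H -> k \in K -> ('P^*)%act (K^`(1) :* k) (g x) = K^`(1) :* k ^ x.
  move=> Hx Kk.
  have -> : ('P^*)%act (K^`(1) :* k) (g x) = (K^`(1) :* k) :^ x.
    apply: eq_in_imset => /= _ /rcosetP[d Dd ->]; apply: gE => //.
    by rewrite groupM // (subsetP (der_sub 1 K)).
  by rewrite conjsMg conjg_set1 (normP _) ?nDH.
exists K, (g x0); split=> //.
- split; last by exists H.
  exact: Aut_aut.
- split=> //; have /subsetPn[k Kk nDk] : ~~ (K \subset K^`(1)).
    by rewrite -indexg_eq1; move: (cardG_gt0 H); rewrite oH subn_gt0 ltn_neqAle eq_sym => /andP[].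
  have nDJ x : x \in H -> (k ^ x \notin K^`(1)) = (k \notin K^`(1)).
    by move=> Hx; rewrite memJ_norm // nDH.
  apply/imsetP; exists (K^`(1) :* k); first by rewrite Kc.
  apply/eqP; rewrite eqEsubset; apply/andP; split.
    apply/subsetP=> X SX; have /setD1P[_ /rcosetsP[k' Kk' defX]] := SX.
    move: SX; rewrite defX Kc // => nDk'.
    have [|| x Hx Dx] := trH k k' _ _; rewrite ?inE ?nDk ?nDk' //.
    apply/imsetP; exists (g x); first by rewrite -img mem_morphim.
    by rewrite cJ //; apply/esym/rcoset_eqP; rewrite mem_rcoset.
  apply/subsetP=> _ /imsetP[a Aa ->]; move: Aa; rewrite -img => /morphimP[x _ Hx ->].
  by rewrite cJ // Kc ?nDJ // memJ_norm // (subsetP nKH).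
apply/subsetPn; exists (g h).
  rewrite in_setI -img mem_morphim //=; apply/astabP=> d Dd.
  rewrite /= gE ?(subsetP (der_sub 1 K)) //; apply/conjg_fixP/commgP/commute_sym.
  exact: (centP cDh).
by rewrite inE -(morph1 g) (inj_in_eq (injmP injg)).
Qed.

End CaminaI.

(** * Coprime action and sums over classes *)

Section Coprime.
Variable gT : finGroupType.
Implicit Types A P K U : {group gT}.

(** A acts trivially on P / [P, A], and fixed points of a coprime action
    lift. *)
Lemma coprime_commg_cent A P : A \subset 'N(P) -> coprime #|P| #|A| -> solvable P ->
  [~: P, A] * 'C_P(A) = P.
Proof.
move=> nPA coPA solP.
have sRP: [~: P, A] \subset P by rewrite commg_subl.
have nRA: A \subset 'N([~: P, A]) by apply: commg_normr.
have nRP: P \subset 'N([~: P, A]) by apply: commg_norml.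
have := coprime_quotient_cent sRP nRA coPA solP.
have /setIidPl->: P / [~: P, A] \subset 'C(A / [~: P, A]).
  by rewrite quotient_cents2.
move=> eqC; apply/eqP; rewrite eqEsubset mul_subG ?subsetIl //=.
have nRC: 'C_P(A) \subset 'N([~: P, A]) by rewrite subIset ?nRP.
by rewrite -quotientSK //= eqC.
Qed.

Lemma coprime_commg_id A P : A \subset 'N(P) -> coprime #|P| #|A| -> solvable P ->
  [~: P, A, A] = [~: P, A].
Proof.
move=> nPA coPA solP; apply/eqP; rewrite eqEsubset.
rewrite commSg /=; last by rewrite commg_subl.
rewrite -{1}(coprime_commg_cent nPA coPA solP) commMG /=; last first.
  apply: normsR; first by rewrite subIset // commg_norml.
  exact: subset_trans (subsetIr _ _) (cent_sub _).
by rewrite [[~: 'C_P(A), A]](commG1P _) ?subsetIr ?mulg1.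
Qed.

Lemma sum_class_orbits (R : nmodType) (N : {group gT}) (C : {set gT}) (f : gT -> R) :
    (forall c, c \in C -> c ^: N \subset C) ->
    (forall c, c \in C -> \sum_(d in c ^: N) f d = 0)%R ->
  (\sum_(c in C) f c = 0)%R.
Proof.
move=> stC sum0; rewrite (partition_big_imset (fun c => c ^: N)) /=.
apply: big1 => _ /imsetP[c Cc ->]; rewrite -[RHS](sum0 c Cc); apply: eq_bigl => d.
apply/andP/idP=> [[_ /eqP<-]|cd]; first exact: class_refl.
by rewrite (subsetP (stC c Cc)) // (class_eqP cd).
Qed.

Lemma class_commg (N : {set gT}) c : c ^: N = [set c * m | m in [set [~ c, y] | y in N]].
Proof.
by rewrite -imset_comp; apply: eq_imset => y /=; rewrite conjg_mulR.
Qed.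

Lemma sum_class_commg (R : nmodType) (N : {set gT}) c (f : gT -> R) :
  (\sum_(d in c ^: N) f d = \sum_(m in [set [~ c, y] | y in N]) f (c * m)%g)%R.
Proof.
by rewrite class_commg big_imset //= => x y _ _ /mulgI.
Qed.

Lemma sum_classV (R : nmodType) (N : {group gT}) c (f : gT -> R) :
  (\sum_(d in c ^: N) f (d^-1)%g = \sum_(d in c^-1 ^: N) f d)%R.
Proof.
rewrite (reindex_inj invg_inj) /=; apply: eq_big => [d|d _]; last by rewrite invgK.
by rewrite classVg inE.
Qed.

End Coprime.

(** * Additive functions from a p-group to a field of characteristic p *)

Section AdditiveFunctions.

Variables (F : fieldType) (p : nat) (gT : finGroupType).
Hypothesis hp : p \in [pchar F]%R.
Let p_pr : prime p := pcharf_prime hp.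
Implicit Types U Y M : {group gT}.

Lemma natr_FpD (a b : 'F_p) : ((a + b : 'F_p)%R%:R = a%:R + b%:R :> F)%R.
Proof.
have e : nat_of_ord (a + b)%R = ((nat_of_ord a + nat_of_ord b) %% p)%N.
  by rewrite /=; congr (_ %% _)%N; apply: Fp_cast.
rewrite e -natrD {2}(divn_eq (a + b) p) natrD natrM (pcharf0 hp).
by rewrite mulr0 add0r.
Qed.

(** The quotient of U by a maximal subgroup containing Y is elementary
    abelian; one of its coordinate functions, read in F through the prime
    field, is not zero. *)
Lemma additive_fun_exists U Y : p.-group U -> Y \subset U -> Y :!=: U ->
  exists f : gT -> F, [/\ {in U &, forall x y, (f (x * y)%g = f x + f y)%R},
    {in Y, forall y, f y = 0%R} & exists2 u, u \in U & f u != 0%R].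
Proof.
move=> pU sYU neYU; have [eqYU|[M maxM sYM]] := maximal_exists sYU.
  by rewrite eqYU eqxx in neYU.
have nMU := p_maximal_normal pU maxM; have iM := p_maximal_index pU maxM.
have oE: #|U / M| = p by rewrite card_quotient ?normal_norm.
have ntE: U / M != 1 by rewrite -cardG_gt1 oE prime_gt1.
have abE: p.-abelem (U / M) by rewrite prime_abelem ?oE.
pose r u := abelem_rV abE ntE (coset M u).
have NU u : u \in U -> u \in 'N(M) by apply: (subsetP (normal_norm nMU)).
have /trivgPn[_ /morphimP[u0 Nu0 Uu0 ->] ntu0] := ntE.
have [i nzi] : exists i, r u0 ord0 i != 0%R.
  apply/existsP; apply: contraR ntu0; rewrite negb_exists => /forallP r0.
  apply/eqP; apply: (@abelem_rV_inj _ _ _ abE ntE); rewrite ?mem_quotient ?group1 //.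
  rewrite abelem_rV_1; apply/rowP=> i; rewrite [RHS]mxE; apply/eqP.
  by have := r0 i; rewrite negbK.
exists (fun u => (r u ord0 i)%:R)%R; split.
- move=> x y Ux Uy; rewrite /r morphM ?NU // abelem_rV_M ?mem_quotient //.
  by rewrite mxE natr_FpD.
- by move=> y Yy; rewrite /r coset_id ?(subsetP sYM) // abelem_rV_1 mxE.
exists u0 => //; apply: contra nzi; rewrite -(dvdn_pcharf hp) => pdv.
(* A nonzero residue of the prime field is represented by a positive number
   less than p, which p does not divide. *)
apply/eqP/val_inj; move: (r u0 ord0 i) pdv => [a lta] /= pdv.
apply/eqP; rewrite -leqn0 leqNgt; apply/negP=> a_gt0.
by have := dvdn_leq a_gt0 pdv; rewrite leqNgt -{1}(Fp_cast p_pr) lta.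
Qed.

(** For p odd, inversion pairs f m with - f m. For p = 2, split M into an
    index-two subgroup N and its coset N t: the sum is 2 times the sum over N
    plus #|N| f t, and N has even order since M does not have order two, apart
    from the trivial case M = 1. *)
Lemma sum_additive0 M (f : gT -> F) : {in M &, forall x y, (f (x * y)%g = f x + f y)%R} ->
  p.-group M -> #|M| != 2 -> (\sum_(m in M) f m = 0)%R.
Proof.
move=> fM pM neM2; have f1 : f 1 = 0%R.
  by apply: (addrI (f 1)); rewrite addr0 -fM // mulg1.
have fV m : m \in M -> f m^-1 = (- f m)%R.
  by move=> Mm; apply/eqP; rewrite -addr_eq0 -fM ?groupV // mulVg f1.
have [p2|podd] := eqVneq p 2; last first.
  set S := (\sum_(m in M) _)%R.
  have SN : S = (- S)%R.
    rewrite {1}/S (reindex_inj invg_inj) /= -sumrN; apply: eq_big => m.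
      by rewrite groupV.
    by rewrite groupV => Mm; rewrite fV.
  have: (2%:R * S == 0)%R by rewrite mulr_natl mulr2n {1}SN addNr.
  rewrite mulf_eq0 -(dvdn_pcharf hp) => /orP[|/eqP//].
  by rewrite dvdn_prime2 // (negPf podd).
have [M1|ntM] := eqVneq (M : {set gT}) 1; first by rewrite M1 big_set1.
have [eq1|[N maxN _]] := maximal_exists (sub1G M).
  by rewrite -eq1 eqxx in ntM.
have iN := p_maximal_index pM maxN; have /andP[sNM _] := p_maximal_normal pM maxN.
have oM := Lagrange sNM; rewrite iN p2 in oM.
have evN : 2 %| #|N|.
  rewrite -p2; have pN := pgroupS sNM pM; apply: contraR neM2; rewrite -p'natE //.
  by move/(pnat_1 pN) => N1; rewrite -oM N1.
have /subsetPn[t Mt nNt] : ~~ (M \subset N) by have /andP[] := maxgroupp maxN.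
have defMN : M :\: N = N :* t.
  apply/eqP; rewrite eq_sym eqEcard card_rcoset; apply/andP; split.
    apply/subsetP=> _ /rcosetP[n Nn ->]; rewrite inE groupMl // nNt.
    by rewrite groupM // (subsetP sNM).
  by rewrite cardsD (setIidPr sNM) -oM muln2 -addnn addnK.
rewrite (big_setID N) /= (setIidPr sNM) defMN.
have -> : (\sum_(m in N :* t) f m = \sum_(m in N) f (m * t)%g)%R.
  by rewrite -rcosetE /rcoset big_imset //= => x y _ _ /mulIg.
rewrite [X in (_ + X)%R](eq_bigr (fun m => f m + f t)%R) => [|m Nm]; last first.
  by rewrite fM // (subsetP sNM).
rewrite big_split /= addrA -mulr2n sumr_const.
have z2 (x : F) n : 2 %| n -> (x *+ n = 0)%R.
  by case/dvdnP=> q ->; rewrite mulnC mulrnA -p2 (mulrn_pchar hp) mul0rn.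
by rewrite !z2 // addr0.
Qed.

End AdditiveFunctions.

(** * Eigenvectors of all class sums that are supported on P *)

Section Basic.

Variables (F : fieldType) (p : nat) (gT : finGroupType) (G P H : {group gT}).
Hypotheses (hp : p \in [pchar F]%R) (defG : P ><| H = G) (cHH : abelian H).
Hypotheses (pP : p.-group P) (p'H : p^'.-group H) (faithH : 'C_H(P) = 1).
Hypothesis defZ : 'Z(P) = P^`(1).

Local Notation Z := 'Z(P).

(** The coefficient functions of the central elements that every class sum
    multiplies by a scalar. *)
Definition eigen_class_fun (f : gT -> F) :=
  {in G &, forall g x, f (g ^ x)%g = f g}
  /\ {in G, forall x, exists c, {in G, forall g,
       (\sum_(y in x ^: G) f (g * y^-1)%g = c * f g)%R}}.

Hypothesis eigenP :
  forall f, eigen_class_fun f -> {in G & P, forall g u, f (g * u) = f g}.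

Let p_pr : prime p := pcharf_prime hp.
Let nPG : P <| G. Proof. by have [] := sdprod_context defG. Qed.
Let sPG : P \subset G. Proof. exact: normal_sub nPG. Qed.
Let sHG : H \subset G. Proof. by have [] := sdprod_context defG. Qed.
Let nPH : H \subset 'N(P). Proof. by have [] := sdprod_context defG. Qed.
Let defPH : P * H = G. Proof. by have [] := sdprod_context defG. Qed.
Let sZP : Z \subset P. Proof. exact: center_sub. Qed.
Let cPZ : P \subset 'C(Z). Proof. by rewrite centsC subsetIr. Qed.
Let nZG : Z <| G. Proof. exact: char_normal_trans (center_char P) nPG. Qed.
Let coPH : coprime #|P| #|H|. Proof. exact: pnat_coprime pP p'H. Qed.
Let solP : solvable P. Proof. exact: nilpotent_sol (pgroup_nil pP). Qed.
Let derPZ : [~: P, P] \subset Z. Proof. by rewrite defZ derg1. Qed.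

Let hallP : p.-Hall(G) P.
Proof. by rewrite /pHall sPG pP /= -(index_sdprod defG). Qed.

Let hallH : p^'.-Hall(G) H.
Proof.
rewrite /pHall sHG p'H -divgS // -(sdprod_card defG) mulnK ?cardG_gt0 //.
by rewrite pnatNK.
Qed.

Let solG : solvable G.
Proof.
rewrite (series_sol nPG) solP -(isog_sol (sdprod_isog defG)).
exact: abelian_sol.
Qed.

Let commPZ a y : a \in P -> y \in P -> [~ a, y] \in Z.
Proof. by move=> Pa Py; rewrite (subsetP derPZ) ?mem_commg. Qed.

(** Three subgroup lemma: A centralises C_P(A), and [C_P(A), P] lies in Z,
    which A centralises as well. *)
Lemma commg_cent_comm (A : {group gT}) : A \subset 'C(Z) -> A \subset 'N(P) ->
  [~: [~: P, A], 'C_P(A)] = 1.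
Proof.
move=> cZA nPA; apply: three_subgroup.
  have /commG1P->: A \subset 'C('C_P(A)) by rewrite centsC subsetIr.
  exact: comm1G.
apply/commG1P; rewrite centsC; apply: subset_trans cZA (centS _).
by apply: subset_trans derPZ; rewrite commSg ?subsetIl.
Qed.

Lemma p'elt_conj s : s \in G -> p^'.-elt s ->
  exists2 h, h \in H & exists2 y, y \in P & s = h ^ y.
Proof.
move=> Gs p's; have sG: <[s]> \subset G by rewrite cycle_subG.
have [x] := Hall_subJ (K := <[s]>%G) solG hallH sG p's.
rewrite -{1}defPH -(normC nPH) => /mulsgP[h y Hh Py ->].
rewrite cycle_subG => /imsetP[k Hk ->].
by exists (k ^ h); [rewrite groupJ | exists y; rewrite ?conjgM].
Qed.

Section EigenCriterion.

Variable z : gT -> F.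
Hypothesis z0 : forall w, w \notin P -> z w = 0%R.
Hypothesis zJ : {in G &, forall w x, z (w ^ x) = z w}.
Hypothesis zZ : {in Z & P, forall c0 w,
  (\sum_(c in c0 ^: G) z (w * c)%g = #|c0 ^: G|%:R * z w)%R}.
Hypothesis zP : {in P & P, forall a w, a \notin Z ->
  (\sum_(m in [set [~ a, y] | y in P]) z (w * m)%g = 0)%R}.
Hypothesis zC : {in G & P, forall a w, a \notin 'C(Z) ->
  (\sum_(m in [set [~ a, y] | y in Z]) z (w * m)%g = 0)%R}.
Hypothesis zH : {in H^# & G, forall h w, h \in 'C(Z) ->
  (\sum_(d in h ^: P) z (w * d)%g = 0)%R}.

Let zM0 g m : m \in P -> g \notin P -> z (g * m) = 0%R.
Proof. by move=> Pm nPg; rewrite z0 // groupMr. Qed.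

Let zP' a w : a \in P -> a \notin Z ->
  (\sum_(m in [set [~ a, y] | y in P]) z (w * m)%g = 0)%R.
Proof.
move=> Pa nZa; have [Pw|nPw] := boolP (w \in P); first exact: zP.
by apply: big1 => _ /imsetP[y Py ->]; rewrite zM0 // groupR.
Qed.

Let zC' a w : a \in G -> a \notin 'C(Z) ->
  (\sum_(m in [set [~ a, y] | y in Z]) z (w * m)%g = 0)%R.
Proof.
move=> Ga nCa; have [Pw|nPw] := boolP (w \in P); first exact: zC.
apply: big1 => _ /imsetP[y Zy ->]; rewrite zM0 // commgEr.
by rewrite groupM ?memJ_norm ?groupV ?(subsetP (normal_norm nPG)) ?(subsetP sZP).
Qed.

(* Three kinds of orbits inside a class are treated: P-orbits inside P,
   Z-orbits of elements acting nontrivially on Z, and P-orbits of elements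
   outside P that centralise Z. *)
Let sum0_P a w : a \in P -> a \notin Z -> (\sum_(d in a ^: P) z (w * d)%g = 0)%R.
Proof.
move=> Pa nZa; rewrite sum_class_commg -[RHS](zP' (w * a) Pa nZa).
by apply: eq_bigr => m _; rewrite mulgA.
Qed.

Let sum0_nC a w : a \in G -> a \notin 'C(Z) -> (\sum_(d in a ^: Z) z (w * d)%g = 0)%R.
Proof.
move=> Ga nCa; rewrite sum_class_commg -[RHS](zC' (w * a) Ga nCa).
by apply: eq_bigr => m _; rewrite mulgA.
Qed.

(** Write x = u s with u and s its p-part and its p'-part. If u is in Z, then
    s is conjugate to an element of H and the orbit of x is u times that of s.
    Otherwise let N = C_P(s): the N-orbit of a conjugate u^y s^y only moves
    u^y, and since P = [P, s] N with [P, s] centralising N, the commutators of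
    u^y with N are all its commutators with P. *)
Let sum0_C x w : x \in G -> x \notin P -> x \in 'C(Z) -> w \in G ->
  (\sum_(d in x ^: P) z (w * d)%g = 0)%R.
Proof.
move=> Gx nPx cx Gw; pose s := x.`_p^'; pose u := x.`_p.
have defx : x = u * s by rewrite consttC.
have comm_us: commute u s by apply/commuteX/commute_sym/commuteX.
have xs: s \in <[x]> by rewrite mem_cycle.
have xu: u \in <[x]> by rewrite mem_cycle.
have Gs : s \in G by apply: groupX.
have Gu : u \in G by apply: groupX.
have cs : s \in 'C(Z) by apply: groupX.
have Pu : u \in P by rewrite (mem_normal_Hall hallP) ?p_elt_constt.
have nts: s != 1 by apply: contraNneq nPx => s1; rewrite defx s1 mulg1.
have p's: p^'.-elt s by apply: p_elt_constt.
have [Zu|nZu] := boolP (u \in Z).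
  have [h Hh [y Py defs]] := p'elt_conj Gs p's.
  have sP: s ^: P = h ^: P by rewrite defs classGidl.
  have h1: h \in H^# by rewrite !inE Hh andbT; apply: contraNneq nts => h1; rewrite defs h1 conj1g.
  have cy: y \in 'C(Z) by apply: (subsetP cPZ).
  have ch: h \in 'C(Z) by rewrite (canRL (conjgK y) (esym defs)) groupJ ?groupV.
  have cuP y' : y' \in P -> u ^ y' = u.
    by move=> Py'; apply/conjg_fixP/commgP; have /setIP[_ /centP cu] := Zu; apply: cu.
  rewrite -[RHS](zH h1 (groupM Gw Gu) ch) -sP.
  have -> : x ^: P = [set u * d | d in s ^: P].
    rewrite -imset_comp; apply: eq_in_imset => y' Py' /=.
    by rewrite defx conjMg cuP.
  rewrite big_imset /= => [|d1 d2 _ _ /mulgI//].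
  by apply: eq_bigr => d _; rewrite mulgA.
pose A := <[s]>%G; pose N := 'C_P(A)%G; pose R := [~: P, A].
have cZA: A \subset 'C(Z) by rewrite cycle_subG.
have nPA: A \subset 'N(P) by rewrite cycle_subG (subsetP (normal_norm nPG)).
have coPA: coprime #|P| #|A| by apply: pnat_coprime pP p's.
have defP: R * N = P := coprime_commg_cent nPA coPA solP.
have cRN: R \subset 'C(N) by apply/commG1P/commg_cent_comm.
have sNP: N \subset P by apply: subsetIl.
have nNP: P \subset 'N(N).
  rewrite sub_der1_norm //; apply: subset_trans (_ : Z \subset _); first by rewrite -defZ.
  by rewrite subsetI sZP centsC.
have Nu: u \in N by rewrite inE Pu /= cent_cycle; apply/cent1P.
have sN n : n \in N -> commute s n.
  by rewrite inE /= cent_cycle => /andP[_ /cent1P].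
apply: (sum_class_orbits (N := N)) => _ /imsetP[y Py ->].
  by apply: subset_trans (classS _ sNP) _; rewrite classGidl.
have Nuy: u ^ y \in N by rewrite memJ_norm ?(subsetP nNP).
have Puy: u ^ y \in P by rewrite memJ_norm ?(subsetP (normG P)).
have nZuy: u ^ y \notin Z by rewrite memJ_norm ?(subsetP (normal_norm nZG)) ?(subsetP sPG).
rewrite sum_class_commg -[RHS](zP' (w * x ^ y) Puy nZuy).
have eqN n : n \in N -> [~ x ^ y, n] = [~ u ^ y, n].
  move=> Nn; have Pn := subsetP sNP n Nn.
  have csn: (s ^ y) ^ n = s ^ y.
    rewrite -conjgM [y * n]conjgCV conjgM; congr (_ ^ y).
    apply/conjg_fixP/commgP/sN; rewrite memJ_norm // ?groupV.
    exact: (subsetP nNP).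
  have cZsy: s ^ y \in 'C(Z) by rewrite groupJ // (subsetP cPZ).
  rewrite {1}defx conjMg commMgJ.
  rewrite [X in _ * X](eqP (introT commgP _)) ?mulg1; last by apply/commgP/conjg_fixP.
  apply/conjg_fixP/commgP; apply: commute_sym; apply: (centP cZsy).
  exact: commPZ.
rewrite (_ : [set _ | n in N] = [set [~ u ^ y, n] | n in P]); last first.
  apply/setP=> m; apply/imsetP/imsetP=> [] [n Nn ->].
    by exists n; [apply: (subsetP sNP) | apply: eqN].
  have: n \in R * N by rewrite defP.
  case/mulsgP=> r c Rr Nc ->; exists c; rewrite ?eqN // commgMJ.
  have /commgP/eqP-> : commute (u ^ y) r by apply/commute_sym/(centP (subsetP cRN r Rr)).
  by rewrite conj1g mulg1.
by apply: eq_bigr => m _; rewrite mulgA.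
Qed.

(** Multiplying z by the class sum of x means summing z over translates of the
    class of x^-1. For x in Z the scalar is the length of the class. Otherwise
    it is zero: the class is cut into orbits of P or of Z, and z sums to zero
    over each translated orbit. *)
Lemma eigen_criterion : {in G & P, forall g u, z (g * u) = z g}.
Proof.
apply: eigenP; split=> // x Gx; have Gx' := groupVr Gx.
have [Zx|nZx] := boolP (x \in Z).
  exists #|x ^: G|%:R%R => g Gg; rewrite (sum_classV G x (fun d => z (g * d)%g)).
  have [Pg|nPg] := boolP (g \in P).
    by rewrite zZ ?groupV // classVg card_invg.
  rewrite (z0 nPg) mulr0; apply: big1 => _ /imsetP[y Gy ->]; rewrite zM0 //.
  by rewrite memJ_norm ?(subsetP (normal_norm nPG)) // groupV (subsetP sZP).
exists 0%R => g Gg; rewrite mul0r (sum_classV G x (fun d => z (g * d)%g)).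
set x' := x^-1; have nZx': x' \notin Z by rewrite groupV.
have nsub (N : {group gT}) : N \subset G -> forall c, c \in x' ^: G -> c ^: N \subset x' ^: G.
  move=> sNG _ /imsetP[y Gy ->]; apply: subset_trans (classS _ sNG) _.
  by rewrite classGidl.
have clG (U : {group gT}) : G \subset 'N(U) -> forall c, c \in x' ^: G -> (c \in U) = (x' \in U).
  by move=> nUG _ /imsetP[y Gy ->]; rewrite memJ_norm ?(subsetP nUG).
have Gcl c : c \in x' ^: G -> c \in G.
  by move=> xc; rewrite (clG G (normG G) c xc).
have [Px|nPx] := boolP (x' \in P).
  apply: (sum_class_orbits (N := P)); first exact: nsub.
  move=> c xc; rewrite sum0_P //; first by rewrite (clG P (normal_norm nPG) c xc).
  by rewrite (clG 'Z(P)%G (normal_norm nZG) c xc).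
have [Cx|nCx] := boolP (x' \in 'C(Z)).
  apply: (sum_class_orbits (N := P)); first exact: nsub.
  move=> c xc; apply: sum0_C => //; first exact: Gcl.
    by rewrite (clG P (normal_norm nPG) c xc).
  by rewrite (clG 'C(Z)%G (subset_trans (normal_norm nZG) (cent_norm _)) c xc).
apply: (sum_class_orbits (N := 'Z(P)%G)); first exact: nsub (normal_sub nZG).
move=> c xc; rewrite sum0_nC ?Gcl //.
by rewrite (clG 'C(Z)%G (subset_trans (normal_norm nZG) (cent_norm _)) c xc).
Qed.

End EigenCriterion.

Lemma pgroup_dvd_class (N : {group gT}) a : p.-group N -> a \notin 'C(N) ->
  p %| #|a ^: N|.
Proof.
move=> pN nCa; rewrite -index_cent1; apply: contraR nCa => pNa.
have pi : p.-nat #|N : 'C_N[a]| by apply: pnat_dvd pN; apply: dvdn_indexg.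
move: pNa; rewrite -p'natE // => /(pnat_1 pi)/eqP; rewrite indexg_eq1 => sNC.
by rewrite -sub_cent1 (subset_trans sNC) // subsetIr.
Qed.

Lemma sum_const_class (N : {group gT}) a w (z : gT -> F) :
    p.-group N -> a \notin 'C(N) -> {in N, forall y, z (w * [~ a, y]) = z w} ->
  (\sum_(m in [set [~ a, y] | y in N]) z (w * m)%g = 0)%R.
Proof.
move=> pN nCa zw; rewrite (eq_bigr (fun=> z w)) => [|_ /imsetP[y Ny ->]]; last exact: zw.
rewrite sumr_const; set M := [set _ | _ in _].
have -> : #|M| = #|a ^: N| by rewrite class_commg (card_imset _ (@mulgI _ a)).
have /dvdnP[q ->] := pgroup_dvd_class pN nCa.
by rewrite mulnC mulrnA (mulrn_pchar hp) mul0rn.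
Qed.

(** When z is constant on the cosets of Z, the conditions other than the one
    on H concern sums of a constant, over sets whose order is divisible by p
    except for central classes. *)
Lemma eigen_criterion_Z (z : gT -> F) :
    (forall w, w \notin P -> z w = 0%R) ->
    {in G &, forall w x, z (w ^ x) = z w} ->
    {in Z & P, forall c w, z (w * c) = z w} ->
    {in H^# & G, forall h w, h \in 'C(Z) -> (\sum_(d in h ^: P) z (w * d)%g = 0)%R} ->
  {in G & P, forall g u, z (g * u) = z g}.
Proof.
move=> z0 zJ zZ zH; apply: eigen_criterion => //.
- move=> c0 w Zc0 Pw; rewrite (eq_bigr (fun=> z w)) => [|c c0c].
    by rewrite sumr_const mulr_natl.
  by rewrite zZ // (subsetP _ c c0c) // class_sub_norm ?normal_norm.
- move=> a w Pa Pw nZa; apply: sum_const_class => // [|y Py]; last first.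
    by rewrite zZ ?commPZ.
  by apply: contra nZa => Ca; rewrite inE Pa.
move=> a w Ga Pw nCa; apply: sum_const_class => // [|y Zy].
  exact: pgroupS sZP pP.
rewrite zZ // commgEr groupM // memJ_norm ?groupV //.
by rewrite (subsetP (normal_norm nZG)).
Qed.

(** The indicator function of U satisfies the criterion: a nontrivial h in H
    does not centralise U, so its U-orbit has order divisible by p and lies in
    one coset of U. *)
Lemma normal_cent_triv_eq (U : {group gT}) :
    Z \subset U -> U \subset P -> G \subset 'N(U) -> 'C_H(U) = 1 -> U :=: P.
Proof.
move=> sZU sUP nUG CHU; apply/eqP; rewrite eqEsubset sUP /=.
pose z g : F := (g \in U)%:R%R.
have zU g u : u \in U -> z (g * u) = z g by move=> Uu; rewrite /z groupMr.
suff zP : {in G & P, forall g u, z (g * u) = z g}.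
  apply/subsetP=> u Pu; have := zP 1 u (group1 G) Pu.
  by rewrite /z mul1g group1 /=; case: (u \in U) => // /eqP; rewrite eq_sym oner_eq0.
apply: eigen_criterion_Z.
- by move=> w nPw; rewrite /z (contraNF (subsetP sUP w)).
- by move=> w x Gw Gx; rewrite /z memJ_norm // (subsetP nUG).
- by move=> c w Zc _; rewrite zU // (subsetP sZU).
move=> h w /setD1P[nth Hh] Gw ch.
apply: (sum_class_orbits (N := U)) => _ /imsetP[y Py ->].
  by apply: subset_trans (classS _ sUP) _; rewrite classGidl.
have Gy := subsetP sPG y Py; have Gh := subsetP sHG h Hh.
rewrite sum_class_commg.
rewrite (eq_bigr (fun m => z (w * h ^ y * m)%g)) => [|m _]; last by rewrite mulgA.
apply: sum_const_class => [||u Uu]; first exact: pgroupS sUP pP.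
  have nCUG: G \subset 'N('C(U)) by apply: subset_trans nUG (cent_norm _).
  rewrite memJ_norm ?(subsetP nCUG) //.
  apply: contra nth => CUh; have: h \in 'C_H(U) by rewrite inE Hh.
  by rewrite CHU => /set1P->.
apply: zU; rewrite commgEr groupM // memJ_norm ?groupV //.
by rewrite (subsetP nUG) ?groupJ.
Qed.

(** * The supplements [P, C_H(U)] of the maximal normal subgroups *)

(** These subgroups index the factors of G. The factor belonging to U will be
    generated by K = [P, C_H(U)], which supplements U in P and centralises it,
    and by the elements of H that centralise the groups K of all other
    indices. *)
Definition max_normal : {set {group gT}} :=
  [set U : {group gT} | [max U | [&& Z \subset U, U \proper P & G \subset 'N(U)]]].

Section MaxNormal.

Variable U : {group gT}.
Hypothesis maxU : U \in max_normal.
Local Notation A := 'C_H(U).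
Local Notation K := [~: P, 'C_H(U)].

Let maxUP : [&& Z \subset U, U \proper P & G \subset 'N(U)]
  /\ (forall V : {group gT}, [&& Z \subset V, V \proper P & G \subset 'N(V)] ->
        U \subset V -> V :=: U).
Proof. by move: maxU; rewrite inE => /maxgroupP. Qed.

Lemma max_normal_sub : Z \subset U. Proof. by have [/and3P[]] := maxUP. Qed.
Lemma max_normal_proper : U \proper P. Proof. by have [/and3P[]] := maxUP. Qed.
Lemma max_normal_norm : G \subset 'N(U). Proof. by have [/and3P[]] := maxUP. Qed.
Let sUP : U \subset P. Proof. exact: proper_sub max_normal_proper. Qed.

Lemma max_normal_eq (V : {group gT}) : U \subset V -> V \subset P ->
  G \subset 'N(V) -> V :=: U \/ V :=: P.
Proof.
move=> sUV sVP nVG; have [|nVP] := eqVproper sVP; first by right.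
left; have [_ mx] := maxUP; apply: mx => //.
by rewrite nVP nVG (subset_trans max_normal_sub).
Qed.

Lemma max_normal_cent_ntriv : A != 1.
Proof.
apply: contraTneq max_normal_proper => /(normal_cent_triv_eq max_normal_sub sUP max_normal_norm) ->.
by rewrite properE subxx.
Qed.

Lemma norm_PH (V : {group gT}) : P \subset 'N(V) -> H \subset 'N(V) -> G \subset 'N(V).
Proof. by move=> nVP nVH; rewrite -defPH mul_subG. Qed.

(** C_P(h) is normal in G because it contains P' and H is abelian; it is not P
    because H acts faithfully. *)
Lemma max_normal_cent1 h : h \in A^# -> 'C_P[h] = U.
Proof.
case/setD1P=> nth /setIP[Hh cUh].
have sUC: U \subset 'C_P[h] by rewrite subsetI sUP sub_cent1.
have nC: G \subset 'N('C_P[h]).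
  apply: norm_PH; last first.
    by rewrite normsI // normsG // sub_cent1 (subsetP cHH).
  rewrite sub_der1_norm ?subsetIl // -defZ; exact: subset_trans max_normal_sub sUC.
have [//|eqP] := max_normal_eq sUC (subsetIl _ _) nC.
have: h \in 'C_H(P) by rewrite inE Hh /= -sub_cent1 -eqP subsetIr.
by rewrite faithH => /set1P h1; rewrite h1 eqxx in nth.
Qed.

Lemma max_normal_cent : 'C_P(A) = U.
Proof.
have /trivgPn[h Ah nth] := max_normal_cent_ntriv.
apply/eqP; rewrite eqEsubset; apply/andP; split; last first.
  by rewrite subsetI sUP centsC subsetIr.
have Ah1: h \in A^# by apply/setD1P.
have sACC: A \subset 'C('C(A)) by rewrite centsC.
apply: subset_trans (_ : 'C_P[h] \subset U); last by rewrite max_normal_cent1.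
by rewrite setIS // sub_cent1 (subsetP sACC).
Qed.

Let sAH : A \subset H. Proof. exact: subsetIl. Qed.
Let cAU : A \subset 'C(U). Proof. exact: subsetIr. Qed.
Let cZA : A \subset 'C(Z).
Proof. exact: subset_trans cAU (centS max_normal_sub). Qed.
Let nPA : A \subset 'N(P). Proof. exact: subset_trans sAH nPH. Qed.
Let coPA : coprime #|P| #|A|. Proof. exact: coprimegS sAH coPH. Qed.
Let sKP : K \subset P. Proof. by rewrite commg_subl. Qed.

Lemma comm_max_normal_norm : G \subset 'N(K).
Proof.
apply: norm_PH; first exact: commg_norml.
by rewrite normsR // cents_norm // centsC (subset_trans sAH).
Qed.
Let nKG := comm_max_normal_norm.

Lemma comm_max_normal_mul : K * U = P.
Proof. by have := coprime_commg_cent nPA coPA solP; rewrite /= max_normal_cent. Qed.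

Lemma comm_max_normal_id : [~: K, A] = K.
Proof. exact: coprime_commg_id. Qed.

Lemma comm_max_normal_cent : K \subset 'C(U).
Proof.
by have /commG1P := commg_cent_comm cZA nPA; rewrite /= max_normal_cent.
Qed.

Lemma comm_max_normalI_sub : K :&: U \subset Z.
Proof.
rewrite subsetI (subset_trans (subsetIl _ _) sKP) /= centsC.
have: K * U \subset 'C(K :&: U); last by rewrite comm_max_normal_mul.
apply: mul_subG; rewrite centsC; last exact: subset_trans (subsetIl _ _) comm_max_normal_cent.
by apply: subset_trans (subsetIr _ _) _; rewrite centsC comm_max_normal_cent.
Qed.

(** An element of K in Z is centralised by A, while A has no nontrivial fixed
    point on the abelian group K / K' = [K / K', A]. *)
Lemma comm_max_normalIZ : K :&: Z = K^`(1).
Proof.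
apply/eqP; rewrite eqEsubset andbC subsetI der_sub /=.
rewrite defZ dergS //=.
have nDA: A \subset 'N(K^`(1)).
  apply: char_norm_trans (der_char 1 _) _; exact: subset_trans (subset_trans sAH sHG) nKG.
have nDK := der_norm 1 [group of K].
have TI := coprime_abel_cent_TI (A := A / K^`(1)) (G := K / K^`(1)).
apply/subsetP=> x /setIP[Kx]; rewrite -defZ => Zx.
apply: coset_idr; first exact: (subsetP nDK).
apply/set1P; rewrite -[[set 1]]TI ?quotient_norms ?coprime_morph ?sub_der1_abelian //.
- rewrite -quotientR //= comm_max_normal_id inE mem_quotient //=.
  apply/centP=> _ /morphimP[a Na Aa ->].
  have Nx: x \in 'N(K^`(1)) by apply: (subsetP nDK).
  rewrite /commute -!morphM //; congr (coset _ _).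
  by apply: commute_sym; apply: (centP (subsetP cZA a Aa)).
- by rewrite (subset_trans sAH) // (subset_trans sHG).
by rewrite (coprimeSg sKP).
Qed.

Lemma comm_max_normalI : K :&: U = K^`(1).
Proof.
apply/eqP; rewrite eqEsubset -comm_max_normalIZ subsetI subsetIl /=.
by rewrite comm_max_normalI_sub setIS // max_normal_sub.
Qed.

(** The subgroup W U is normal in G and lies between U and P, and W is
    recovered from it by intersecting with K. *)
Lemma comm_max_normal_irr (W : {group gT}) :
    K^`(1) \subset W -> W \subset K -> H \subset 'N(W) ->
  W :=: K^`(1) \/ W :=: K.
Proof.
move=> sDW sWK nWH.
have nWP: P \subset 'N(W).
  rewrite -comm_max_normal_mul mul_subG //; first by rewrite sub_der1_norm.
  by rewrite cents_norm // (subset_trans _ (centS sWK)) // centsC comm_max_normal_cent.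
have nWG := norm_PH nWP nWH.
have sUWU: U \subset W <*> U by apply: joing_subr.
have sWUP: W <*> U \subset P by rewrite join_subG (subset_trans sWK).
have defWU: W <*> U = W * U.
  by rewrite norm_joinEr // (subset_trans sUP).
have nWUG: G \subset 'N(W <*> U) by rewrite normsY // max_normal_norm.
have [eqU|eqPP] := max_normal_eq sUWU sWUP nWUG.
  left; apply/eqP; rewrite eqEsubset sDW andbT -comm_max_normalI subsetI sWK /=.
  by rewrite -eqU joing_subl.
right; apply/eqP; rewrite eqEsubset sWK /=.
have eqK: W * U :&: K = K by apply/setIidPr; rewrite -defWU eqPP.
have: W * (U :&: K) = K by rewrite group_modl.
by move=> <-; rewrite mul_subG // setIC comm_max_normalI.
Qed.

End MaxNormal.

Definition max_comm (U : {group gT}) : {group gT} := [~: P, 'C_H(U)]%G.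

Lemma max_comm_subP U : max_comm U \subset P.
Proof. by rewrite commg_subl (subset_trans (subsetIl _ _)). Qed.

Lemma max_comm_norm U : G \subset 'N(max_comm U).
Proof. exact: comm_max_normal_norm. Qed.

(** Maximality gives P = W U, and C_H(U) centralises U, so that [P, C_H(U)]
    lies in W. *)
Lemma max_comm_sub U W : U \in max_normal -> W \in max_normal -> U != W ->
  max_comm U \subset W.
Proof.
move=> maxU maxW neUW; have nUG := max_normal_norm maxU; have nWG := max_normal_norm maxW.
have [sUP sWP] := (proper_sub (max_normal_proper maxU), proper_sub (max_normal_proper maxW)).
have defWU: W <*> U = W * U by rewrite norm_joinEr // (subset_trans (subset_trans sUP sPG)).
have [eqWU|eqP] : W <*> U = U \/ W <*> U = P.
- by apply: (max_normal_eq maxU); rewrite ?joing_subr ?normsY ?join_subG ?sWP.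
- have sWU : W \subset U by rewrite -eqWU joing_subl.
  have [eqUW|eqUP] := max_normal_eq maxW sWU sUP nUG.
    by rewrite -val_eqE /= eqUW eqxx in neUW.
  by have := max_normal_proper maxU; rewrite eqUP properxx.
have : [~: W * U, 'C_H(U)] \subset W.
  have nWA: 'C_H(U) \subset 'N(W).
    by rewrite (subset_trans (subsetIl _ _)) // (subset_trans sHG).
  rewrite commMG /=.
    have /commG1P->: U \subset 'C('C_H(U)) by rewrite centsC subsetIr.
    by rewrite mulg1 commg_subl.
  rewrite normsR //; first by rewrite (subset_trans sUP) // (subset_trans sPG).
  by rewrite cents_norm // centsC subsetIr.
by rewrite -defWU eqP.
Qed.

Lemma max_comm_not_sub U : U \in max_normal -> ~~ (max_comm U \subset U).
Proof.
move=> maxU; apply: contraL (max_normal_proper maxU) => sKU.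
by rewrite -(comm_max_normal_mul maxU) mulSGid // properxx.
Qed.

(** The subgroup Q generated is normal in G, and no maximal U contains Z Q, so
    Z Q = P. Then Z = P' = Q' lies in Q. *)
Lemma gen_max_comm : << \bigcup_(U in max_normal) max_comm U >> = P.
Proof.
set Q := << _ >>; have sQP: Q \subset P.
  by rewrite gen_subG; apply/bigcupsP=> U _; apply: max_comm_subP.
have nQG: G \subset 'N(Q).
  by rewrite norms_gen // norms_bigcup //; apply/bigcapsP=> U _; apply: max_comm_norm.
have nZQ: Q \subset 'N(Z) by rewrite (subset_trans sQP) // (subset_trans sPG) // normal_norm.
have eqP : Z * Q = P.
  rewrite -norm_joinEr //; apply/eqP; apply: contraT => neqP.
  have [U] : {U : {group gT} | [max U | [&& Z \subset U, U \proper P & G \subset 'N(U)]] & Z <*> Q \subset U}.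
    apply: maxgroup_exists; rewrite joing_subl properEneq neqP join_subG sZP sQP /=.
    by rewrite normsY // normal_norm.
  move=> maxU; rewrite join_subG => /andP[_ sQU].
  have {}maxU : U \in max_normal by rewrite inE.
  case/negP: (max_comm_not_sub maxU); apply: subset_trans sQU.
  by rewrite sub_gen // (bigcup_sup U).
have cZQ: Z \subset 'C(Q) by rewrite centsC (subset_trans sQP).
suff sZQ : Z \subset Q by rewrite -eqP mulSGid.
have ZP1: [~: Z, P] = 1 by apply/commG1P/subsetIr.
have ZQ1: [~: Z, Q] = 1 by apply/commG1P.
rewrite defZ derg1 -{1}eqP commMG ?ZP1 ?norms1 // mul1g commGC.
by rewrite -eqP commMG ?ZQ1 ?norms1 // mul1g commg_subl normG.
Qed.

Lemma cent_max_comm (A : {set gT}) : (forall U, U \in max_normal -> A \subset 'C(max_comm U)) ->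
  A \subset 'C(P).
Proof.
move=> cA; rewrite -gen_max_comm cent_gen centsC; apply/bigcupsP=> U maxU.
by rewrite centsC cA.
Qed.

Lemma max_comm_der_cent U : (max_comm U)^`(1) \subset Z.
Proof. by rewrite defZ dergS // max_comm_subP. Qed.

(** A coprime automorphism acting trivially modulo K', which lies in the
    Frattini subgroup, is trivial on K. *)
Lemma coprime_max_comm_cent (U : {group gT}) h : h \in H -> U \in max_normal ->
    {in max_comm U, forall k, [~ h, k] \in (max_comm U)^`(1)} -> h \in 'C(max_comm U).
Proof.
move=> Hh maxU cD; set K := max_comm U in cD *; pose A := <[h]>%G.
have nKA: A \subset 'N(K).
  by rewrite cycle_subG (subsetP (max_comm_norm U)) // (subsetP sHG).
have nDA: A \subset 'N(K^`(1)) := char_norm_trans (der_char 1 K) nKA.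
have sKP := max_comm_subP U.
have coKA: coprime #|K| #|A|.
  by apply: coprimegS (coprimeSg sKP coPH); rewrite cycle_subG.
have solK: solvable K := solvableS sKP solP.
have eqQ := coprime_quotient_cent (der_sub 1 K) nDA coKA solK.
have nDK := der_norm 1 K.
have sKCD: K \subset K^`(1) * 'C_K(A).
  rewrite -quotientSK // eqQ subsetI subxx /= centsC quotient_cycle ?cycle_subG; last first.
    by rewrite -cycle_subG.
  have nDh: h \in 'N(K^`(1)) by rewrite -cycle_subG.
  apply/centP=> _ /morphimP[k Nk Kk ->]; apply/commgP.
  by rewrite -morphR //= coset_id ?cD.
have pK := pgroupS sKP pP.
have sDPhi: K^`(1) \subset 'Phi(K) by rewrite (Phi_joing pK) joing_subl.
have: 'Phi(K) <*> 'C_K(A) = K.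
  apply/eqP; rewrite eqEsubset join_subG Phi_sub subsetIl /=.
  apply: subset_trans sKCD _; rewrite mul_subG ?joing_subr //.
  exact: subset_trans sDPhi (joing_subl _ _).
move/Phi_nongen; rewrite genGid => eqC.
by rewrite -sub_cent1 -eqC -cent_cycle subsetIr.
Qed.

(** The elements k of K with [h, k] in K' form an H-invariant subgroup between
    K' and K, hence equal to one of them. *)
Lemma max_comm_fpf U h : U \in max_normal -> h \in H -> h \notin 'C(max_comm U) ->
  {in max_comm U, forall k, [~ h, k] \in (max_comm U)^`(1) -> k \in (max_comm U)^`(1)}.
Proof.
move=> maxU Hh nCh k Kk Dk; set K := max_comm U in nCh Kk Dk *; set D := K^`(1) in Dk *.
pose W := [set k in K | [~ h, k] \in D].
have nDG: G \subset 'N(D) by apply: char_norm_trans (der_char 1 K) (max_comm_norm U).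
have sKG := subset_trans (max_comm_subP U) sPG.
have gW: group_set W.
  apply/group_setP; split; first by rewrite inE group1 commg1 group1.
  move=> a b /setIdP[Ka Da] /setIdP[Kb Db]; rewrite inE groupM // commgMJ groupM //.
  by rewrite memJ_norm // (subsetP nDG) // (subsetP sKG).
have sDW : D \subset Group gW.
  apply/subsetP=> d Dd; rewrite inE (subsetP (der_sub 1 K)) //.
  rewrite commgEr groupM // memJ_norm ?groupV // (subsetP nDG) //.
  exact: (subsetP sHG).
have sWK : Group gW \subset K by apply/subsetP=> a /setIdP[].
have nWH : H \subset 'N(Group gW).
  apply/subsetP=> x Hx; rewrite inE; apply/subsetP=> _ /imsetP[a /setIdP[Ka Da] ->].
  have Gx := subsetP sHG x Hx.
  rewrite inE memJ_norm ?(subsetP (max_comm_norm U)) // Ka.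
  have -> : h = h ^ x by rewrite conjgE (centsP cHH h Hh x Hx) mulKg.
  by rewrite -conjRg memJ_norm // (subsetP nDG).
have [/= eqWD|/= eqWK] := comm_max_normal_irr maxU sDW sWK nWH.
  by rewrite /D -[K^`(1)]eqWD inE Kk.
case/negP: nCh; apply: coprime_max_comm_cent => // a Ka.
have: a \in W by rewrite eqWK.
by case/setIdP.
Qed.

(** * Transitivity of H on families of cosets *)

Lemma max_comm_fpfJ U h y : U \in max_normal -> h \in H -> h \notin 'C(max_comm U) ->
    y \in P ->
  {in max_comm U, forall k, [~ h ^ y, k] \in (max_comm U)^`(1) -> k \in (max_comm U)^`(1)}.
Proof.
move=> maxU Hh nCh Py k Kk; set K := max_comm U in nCh Kk *.
have Gy := subsetP sPG y Py.
have nK: {in G, forall x, x \in 'N(K)} by apply/subsetP/max_comm_norm.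
have nD: {in G, forall x, x \in 'N(K^`(1))}.
  by apply/subsetP; apply: char_norm_trans (der_char 1 K) (max_comm_norm U).
rewrite -[k](conjgKV y) -conjRg !(memJ_norm _ (nD y Gy)).
by apply: max_comm_fpf => //; rewrite memJ_norm ?groupV ?nK.
Qed.

Lemma max_comm_mul U : U \in max_normal -> max_comm U * U = P.
Proof. exact: comm_max_normal_mul. Qed.

Lemma max_commI U : U \in max_normal -> max_comm U :&: U = (max_comm U)^`(1).
Proof. exact: comm_max_normalI. Qed.

(** Modulo K', the commutators [e, k] run through K exactly once since e acts
    without fixed points; and K / K' is P / U. So the set [e, K] meets every
    coset of U in P exactly once. *)
Lemma comm_transversal U e : U \in max_normal -> e \in G -> e \in 'C(Z) ->
    {in max_comm U, forall k, [~ e, k] \in (max_comm U)^`(1) -> k \in (max_comm U)^`(1)} ->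
  {in P, forall b, exists2 m0, m0 \in [set [~ e, k] | k in max_comm U] &
    {in [set [~ e, k] | k in max_comm U], forall m, (b * m \in U) = (m == m0)}}.
Proof.
move=> maxU Ge cZe fpf b Pb; set K := max_comm U in fpf *; set D := K^`(1) in fpf *.
have nKe: e \in 'N(K) by rewrite (subsetP (max_comm_norm U)).
have nDe: e \in 'N(D).
  by rewrite (subsetP (char_norm_trans (der_char 1 K) (max_comm_norm U))).
have sDK: D \subset K := der_sub 1 K.
have nDK: D <| K := der_normal 1 K.
have sDU: D \subset U by rewrite /D /K -(max_commI maxU) subsetIr.
have sKP := max_comm_subP U.
have sDZ: D \subset Z := max_comm_der_cent U.
have KT k : k \in K -> [~ e, k] \in K.
  by move=> Kk; rewrite commgEr groupM // memJ_norm // groupV.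
have: b^-1 \in K * U by rewrite max_comm_mul ?groupV.
case/mulsgP=> k u Kk Uu defb; have [k1 Kk1 Dk1] := commg_onto nDK nKe nDe fpf Kk.
have bE: b = u^-1 * k^-1 by rewrite -invMg -defb invgK.
have kE: k = [~ e, k1] * ([~ e, k1]^-1 * k) by rewrite mulKVg.
have Ub1: b * [~ e, k1] \in U.
  rewrite bE -mulgA groupM ?groupV //.
  by rewrite -groupV invMg invgK (subsetP sDU).
exists [~ e, k1]; first exact: imset_f.
move=> _ /imsetP[k2 Kk2 ->]; apply/idP/eqP=> [Ub2|-> //].
have D12: [~ e, k1]^-1 * [~ e, k2] \in D.
  rewrite /D /K -(max_commI maxU) inE groupM ?groupV ?KT //=.
  have -> : [~ e, k1]^-1 * [~ e, k2] = (b * [~ e, k1])^-1 * (b * [~ e, k2]).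
    by rewrite (invMg b) -[RHS]mulgA mulKg.
  by rewrite groupM ?groupV.
have cDe d : d \in D -> [~ e, d] = 1.
  by move=> Dd; apply/eqP/commgP; apply: (centP cZe); apply: (subsetP sDZ).
have cDK d k' : d \in D -> k' \in K -> d ^ k' = d.
  move=> Dd Kk'; apply/conjg_fixP/commgP; have /setIP[_ /centP cd] := subsetP sDZ d Dd.
  by apply: cd; apply: (subsetP sKP).
pose k3 := k2 * k1^-1; have Kk3: k3 \in K by rewrite groupM ?groupV.
have Ek2: k2 = k3 * k1 by rewrite mulgKV.
have Dk3: k3 \in D.
  apply: fpf => //; have:= D12; rewrite {1}Ek2 commgMJ mulKg.
  by rewrite memJ_norm // (subsetP (normal_norm nDK)).
by rewrite Ek2 commgMJ (cDe k3) // conj1g mulg1.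
Qed.

Lemma cent_coset_sum U e b : U \in max_normal -> e \in G -> e \in 'C(Z) ->
    {in max_comm U, forall k, [~ e, k] \in (max_comm U)^`(1) -> k \in (max_comm U)^`(1)} ->
    b \in P ->
  (\sum_(m in [set [~ e, k] | k in max_comm U]) ((b * m)%g \in U)%:R = 1 :> F)%R.
Proof.
move=> maxU Ge cZe fpf Pb; have [m0 Tm0 eqm] := comm_transversal maxU Ge cZe fpf Pb.
rewrite (bigD1 m0) //= eqm // eqxx big1 ?addr0 // => m /andP[Tm /negPf ntm].
by rewrite eqm // ntm.
Qed.

(** The function z w is the sum over x in H of the product over U of [w in
    g0^x U] - [w in U]. Its sum over an orbit h^P with h <> 1 vanishes: h acts
    nontrivially on some K = max_comm U, and on a translated K-orbit all
    factors but that of U are constant, while both indicator functions in the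
    factor of U sum to 1. So z is constant on P. At g0 its value is the order
    of a subgroup of H, which is prime to p; so z g <> 0, and some x in H has
    all its factors at g nonzero. *)
Lemma max_normal_trans g0 g : g0 \in P -> g \in P ->
    (forall U, U \in max_normal -> g0 \notin U) ->
    (forall U, U \in max_normal -> g \notin U) ->
  exists2 x, x \in H & forall U, U \in max_normal -> (g0 ^ x)^-1 * g \in U.
Proof.
move=> Pg0 Pg nU0 nU.
pose f (U : {group gT}) w x : F := ((((g0 ^ x)^-1 * w)%g \in U)%:R - (w \in U)%:R)%R.
pose z w : F := if w \in P then (\sum_(x in H) \prod_(U in max_normal) f U w x)%R else 0%R.
have sU U : U \in max_normal -> U \subset P by move=> maxU; apply/proper_sub/max_normal_proper.
have nUG U x : U \in max_normal -> x \in G -> x \in 'N(U).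
  by move=> maxU; apply/subsetP/max_normal_norm.
have Pg0x x : x \in H -> g0 ^ x \in P.
  by move=> Hx; rewrite memJ_norm // (subsetP nPH).
have UMr (U : {group gT}) w c : c \in U -> (w * c \in U) = (w \in U) by move=> Uc; rewrite groupMr.
have fZ U w x c : U \in max_normal -> c \in U -> f U (w * c) x = f U w x.
  by move=> maxU Uc; rewrite /f mulgA !(UMr U _ c Uc).
have zPc : {in G & P, forall g u, z (g * u) = z g}.
  apply: eigen_criterion_Z => //.
  - by move=> w nPw; rewrite /z (negPf nPw).
  - have zJP : {in G & P, forall w y, z (w ^ y) = z w}.
      move=> w y Gw Py; rewrite /z memJ_norm ?(subsetP (normG P)) //.
      case: ifP => // Pw; apply: eq_bigr => x Hx; apply: eq_bigr => U maxU.
      by rewrite conjg_mulR fZ // (subsetP (max_normal_sub maxU)) ?commPZ.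
    have zJH : {in G & H, forall w y, z (w ^ y) = z w}.
      move=> w y Gw Hy; have Gy := subsetP sHG y Hy.
      rewrite /z memJ_norm ?(subsetP nPH) //; case: ifP => // Pw.
      rewrite (reindex_inj (mulIg y)) /=; apply: eq_big => [x|x Hx].
        by rewrite groupMr.
      apply: eq_bigr => U maxU; rewrite /f conjgM -conjVg -conjMg.
      by rewrite !memJ_norm ?nUG.
    move=> w x Gw; rewrite -{1}defPH => /mulsgP[y h Py Hh ->].
    have Gy := subsetP sPG y Py; by rewrite conjgM zJH ?groupJ ?zJP.
  - move=> c w Zc Pw; rewrite /z groupMr ?(subsetP sZP c) //; case: ifP => // _.
    apply: eq_bigr => x Hx; apply: eq_bigr => U maxU.
    by rewrite fZ // (subsetP (max_normal_sub maxU)).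
  move=> h w /setD1P[nth Hh] Gw ch.
  have [U maxU nCh] : exists2 U, U \in max_normal & h \notin 'C(max_comm U).
    apply/exists_inP; apply: contraR nth; rewrite negb_exists_in => /forall_inP cU.
    have: h \in 'C_H(P).
      rewrite inE Hh -sub1set; apply: cent_max_comm => U maxU.
      by rewrite sub1set; have := cU U maxU; rewrite negbK.
    by rewrite faithH => /set1P->.
  set K := max_comm U in nCh.
  apply: (sum_class_orbits (N := K)) => _ /imsetP[y Py ->].
    by apply: subset_trans (classS _ (max_comm_subP U)) _; rewrite classGidl.
  have Gh := subsetP sHG h Hh; have Gy := subsetP sPG y Py.
  have fpf := max_comm_fpfJ maxU Hh nCh Py; set e := h ^ y in fpf *.
  have Ge: e \in G by rewrite groupJ.
  have cZe: e \in 'C(Z) by rewrite groupJ // (subsetP cPZ).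
  rewrite sum_class_commg; set T := [set _ | _ in _].
  have sTK m : m \in T -> m \in K.
    case/imsetP=> k Kk ->; rewrite commgEr groupM // memJ_norm ?groupV //.
    by rewrite (subsetP (max_comm_norm U)).
  have sKP := subsetP (max_comm_subP U).
  have [Pa|nPa] := boolP (w * e \in P); last first.
    apply: big1 => m Tm; rewrite /z mulgA groupMr ?(negPf nPa) //.
    by apply: sKP; apply: sTK.
  rewrite (eq_bigr (fun m => \sum_(x in H) \prod_(V in max_normal) f V (w * e * m)%g x)%R);
    last first.
    by move=> m Tm; rewrite /z mulgA groupMr ?Pa //; apply: sKP; apply: sTK.
  rewrite exchange_big /=; apply: big1 => x Hx.
  rewrite (eq_bigr (fun m => f U (w * e * m)%g x *
     \prod_(V in max_normal | V != U) f V (w * e)%g x))%R; last first.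
    move=> m Tm; rewrite (bigD1 U) //=; congr (_ * _)%R.
    apply: eq_bigr => V /andP[maxV neVU]; rewrite fZ //.
    by apply: (subsetP (max_comm_sub maxU maxV _)); rewrite 1?eq_sym // sTK.
  rewrite -mulr_suml sumrB.
  rewrite [X in (_ - X)%R](cent_coset_sum maxU Ge cZe fpf Pa).
  rewrite (eq_bigr (fun m => (((g0 ^ x)^-1 * (w * e) * m)%g \in U)%:R)%R) => [|m _]; last by rewrite mulgA.
  rewrite (cent_coset_sum maxU Ge cZe fpf) ?subrr ?mul0r //.
  by rewrite groupM // groupV Pg0x.
(* As g0 is in none of the U, the product at w = g0 is 1 for x in S and 0
   otherwise. *)
pose S := [set x in H | [forall U in max_normal, (g0 ^ x)^-1 * g0 \in U]].
have zg0 : z g0 = (#|S|%:R)%R.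
  rewrite /z Pg0 -sumr_const big_mkcond [RHS]big_mkcond /=; apply: eq_bigr => x _.
  rewrite inE; case: (x \in H) => //=.
  rewrite (eq_bigr (fun U : {group gT} => (((g0 ^ x)^-1 * g0)%g \in U)%:R)%R) => [|U maxU]; last first.
    by rewrite /f (negPf (nU0 U maxU)) subr0.
  case: ifP => [/forall_inP cS|/forall_inPn[U maxU /negPf nUx]].
    by apply: big1 => U maxU; rewrite cS.
  by rewrite (bigD1 U) //= nUx mul0r.
have gS : group_set S.
  apply/group_setP; split.
    by rewrite inE group1; apply/forall_inP=> U _; rewrite conjg1 mulVg group1.
  move=> a b /setIdP[Ha /forall_inP ca] /setIdP[Hb /forall_inP cb].
  rewrite inE groupM //; apply/forall_inP=> U maxU.
  have -> : (g0 ^ (a * b))^-1 * g0 = ((g0 ^ a)^-1 * g0) ^ b * ((g0 ^ b)^-1 * g0).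
    by rewrite conjMg conjVg -conjgM -[RHS]mulgA mulKVg.
  have Nb: b \in 'N(U) by apply: nUG => //; apply: (subsetP sHG).
  by rewrite groupM ?cb // (memJ_norm _ Nb) ca.
have zne0 : z g0 != 0%R.
  rewrite zg0 -(dvdn_pcharf hp) -p'natE //.
  by apply: (pgroupS (_ : Group gS \subset H) p'H); apply/subsetP=> x /setIdP[].
have : z g != 0%R.
  by rewrite -(mulKVg g0 g) zPc ?groupM ?groupV // (subsetP sPG).
rewrite /z Pg => nz.
have [x Hx] : exists2 x, x \in H & (\prod_(U in max_normal) f U g x)%R != 0%R.
  apply/exists_inP; apply: contraR nz; rewrite negb_exists_in => /forall_inP z0.
  by apply/eqP/big1 => x Hx; apply/eqP; have := z0 x Hx; rewrite negbK.
move/prodf_neq0=> nzU; exists x => // U maxU; have := nzU U maxU.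
by rewrite /f (negPf (nU U maxU)) subr0; case: (_ \in U); rewrite // eqxx.
Qed.

(** * The complements of the factors *)

Definition max_comp (U : {group gT}) : {group gT} :=
  'C_H(<<\bigcup_(W in max_normal | W != U) max_comm W>>)%G.

Lemma max_compP (U : {group gT}) x :
  reflect (x \in H /\ forall W, W \in max_normal -> W != U -> x \in 'C(max_comm W))
          (x \in max_comp U).
Proof.
rewrite inE /= cent_gen; apply: (iffP andP) => -[Hx cx]; split=> //.
  move=> W maxW neWU; apply: subsetP cx; apply: centS; exact: (bigcup_sup W (introT andP (conj maxW neWU))).
rewrite -sub1set centsC; apply/bigcupsP=> W /andP[maxW neWU].
by rewrite centsC sub1set cx.
Qed.

(** All the factors of the product other than k U lie in U. *)
Lemma prod_coset (k : {group gT} -> gT) (r : seq {group gT}) (U : {group gT}) :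
    (forall W, W \in max_normal -> k W \in max_comm W) -> uniq r ->
    {subset r <= max_normal} -> U \in max_normal ->
  if U \in r then (k U)^-1 * \prod_(W <- r) k W \in U else \prod_(W <- r) k W \in U.
Proof.
move=> Kk; elim: r => [|W r IHr] /=; first by rewrite big_nil group1.
case/andP=> nrW uniq_r sr maxU; have maxW : W \in max_normal by apply: sr; rewrite mem_head.
have {}IHr := IHr uniq_r (fun V rV => sr V (@mem_behead _ (W :: r) V rV)) maxU.
rewrite big_cons inE; have [eqUW|neUW] := eqVneq U W.
  by rewrite eqUW mulKg; rewrite eqUW (negPf nrW) in IHr.
have UkW : k W \in U by apply: (subsetP (max_comm_sub maxW maxU _)); rewrite 1?eq_sym ?Kk.
move: IHr; rewrite /=; case: ifP => _ IHr; last by rewrite groupM.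
have -> : (k U)^-1 * (k W * \prod_(V <- r) k V)
   = (k W) ^ (k U) * ((k U)^-1 * \prod_(V <- r) k V).
  by rewrite conjgE !mulgA mulgK.
rewrite groupM // memJ_norm // (subsetP (max_normal_norm maxU)) //.
by rewrite (subsetP sPG) // (subsetP (max_comm_subP U)) ?Kk.
Qed.

(** Choose k0 W in K_W outside W for all W, and replace the choice at U by k
    or by k'. Some x in H maps the product of the first family to that of the
    second, modulo all the U. Modulo K_W', it then fixes k0 W for W <> U,
    hence centralises K_W, and it maps k to k'. *)
Lemma max_comp_trans U : U \in max_normal ->
  {in max_comm U :\: (max_comm U)^`(1) &, forall k k',
     exists2 x, x \in max_comp U & k ^ x * k'^-1 \in (max_comm U)^`(1)}.
Proof.
move=> maxU k k' /setDP[Kk nDk] /setDP[Kk' nDk'].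
have ex0 W : W \in max_normal -> exists2 k0, k0 \in max_comm W & k0 \notin W.
  by move=> maxW; apply/subsetPn; apply: max_comm_not_sub.
pose k0 W := odflt 1 [pick k0 in max_comm W | k0 \notin W].
have k0P W : W \in max_normal -> k0 W \in max_comm W /\ k0 W \notin W.
  move=> maxW; rewrite /k0; case: pickP => [a /andP[]//|no].
  by have [a Ka na] := ex0 W maxW; have := no a; rewrite Ka na.
pose f c W := if W == U then c else k0 W.
pose g c := \prod_(W <- enum max_normal) f c W.
have KU c : c \in max_comm U -> c \notin (max_comm U)^`(1) -> c \notin U.
  by move=> Kc; rewrite -(max_commI maxU) inE Kc.
have fK c W : c \in max_comm U -> W \in max_normal -> f c W \in max_comm W.
  by move=> Kc maxW; rewrite /f; case: eqP => [->|_] //; have [] := k0P W maxW.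
have fN c W : c \notin U -> W \in max_normal -> f c W \notin W.
  by move=> Kc maxW; rewrite /f; case: eqP => [->|_] //; have [] := k0P W maxW.
have gW c W : c \in max_comm U -> W \in max_normal -> (f c W)^-1 * g c \in W.
  move=> Kc maxW; have := @prod_coset (f c) (enum max_normal) W (fun V => fK c V Kc)
    (enum_uniq _) _ maxW.
  by rewrite mem_enum maxW; apply=> V; rewrite mem_enum.
have gP c : c \in max_comm U -> g c \in P.
  move=> Kc; rewrite /g big_seq; apply: group_prod => W; rewrite mem_enum => maxW.
  by apply: (subsetP (max_comm_subP W)); apply: fK.
have gN c W : c \in max_comm U -> c \notin U -> W \in max_normal -> g c \notin W.
  move=> Kc nUc maxW; have := gW c W Kc maxW; apply: contraL => Wg.
  by rewrite groupMr // groupV fN.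
have [x Hx xP] := max_normal_trans (gP k Kk) (gP k' Kk') (fun W => gN k W Kk (KU k Kk nDk))
  (fun W => gN k' W Kk' (KU k' Kk' nDk')).
have nWx W : W \in max_normal -> x \in 'N(W).
  by move=> maxW; rewrite (subsetP (max_normal_norm maxW)) // (subsetP sHG).
have nKx W : x \in 'N(max_comm W).
  by rewrite (subsetP (max_comm_norm W)) // (subsetP sHG).
have xf W : W \in max_normal -> (f k W ^ x)^-1 * f k' W \in (max_comm W)^`(1).
  move=> maxW; rewrite -(max_commI maxW) inE.
  rewrite groupM ?groupV ?(memJ_norm _ (nKx W)) ?fK //=.
  have -> : (f k W ^ x)^-1 * f k' W = (((f k W)^-1 * g k) ^ x) *
       ((g k ^ x)^-1 * g k') * ((f k' W)^-1 * g k')^-1.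
    rewrite conjMg conjVg (invMg (f k' W)^-1) invgK.
    by move: (f k W ^ x) (g k ^ x) (g k') (f k' W) => a b c d; rewrite !mulgA !mulgK.
  apply: groupM; last by rewrite groupV gW.
  by apply: groupM; rewrite ?xP // (memJ_norm _ (nWx W maxW)) gW.
exists x.
  apply/max_compP; split=> // W maxW neWU; apply: contraT => nCx.
  have := xf W maxW; rewrite /f (negPf neWU) => Dx.
  have [KW nWk] := k0P W maxW.
  have Dxk: [~ x, k0 W] \in (max_comm W)^`(1) by rewrite -invg_comm commgEl invMg invgK.
  have := max_comm_fpf maxW Hx nCx KW Dxk.
  by rewrite -(max_commI maxW) inE (negPf nWk) andbF.
have := xf U maxU; rewrite /f eqxx => Dx.
have -> : k ^ x * k'^-1 = ((k ^ x)^-1 * k')^-1 ^ (k ^ x)^-1.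
  by move: (k ^ x) => a; rewrite conjgE (invMg a^-1) !invgK mulgK.
rewrite memJ_norm ?groupV // (subsetP (normal_norm (der_normal 1 _))) //.
by rewrite memJ_norm.
Qed.

Lemma max_comp_sub U : max_comp U \subset H.
Proof. exact: subsetIl. Qed.

Lemma max_comp_cent U W : W \in max_normal -> W != U -> max_comp U \subset 'C(max_comm W).
Proof. by move=> maxW neWU; apply/subsetP=> x /max_compP[_]; apply. Qed.

Lemma max_comp_faithful U x : x \in (max_comp U)^# -> x \notin 'C(max_comm U).
Proof.
case/setD1P=> ntx /max_compP[Hx cx]; apply: contra ntx => cxU.
have: x \in 'C_H(P).
  rewrite inE Hx -sub1set; apply: cent_max_comm => W maxW; rewrite sub1set.
  by have [->|neWU] := eqVneq W U; last exact: cx.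
by rewrite faithH => /set1P->.
Qed.

Lemma max_comp_fpf U : U \in max_normal ->
  {in (max_comp U)^#, forall y, {in max_comm U, forall k,
      [~ y, k] \in (max_comm U)^`(1) -> k \in (max_comm U)^`(1)}}.
Proof.
move=> maxU y Hy; apply: max_comm_fpf => //; last exact: max_comp_faithful.
by case/setD1P: Hy => _; apply: subsetP (max_comp_sub U) y.
Qed.

Lemma max_comm_not_der U : U \in max_normal -> ~~ (max_comm U \subset (max_comm U)^`(1)).
Proof.
move=> maxU; apply: contra (max_comm_not_sub maxU) => sKD.
by apply: subset_trans sKD _; rewrite -(max_commI maxU) subsetIr.
Qed.

(** Transitive and fixed-point-free, the group acts regularly on the
    nontrivial cosets. *)
Lemma card_max_comp U : U \in max_normal ->
  #|max_comp U| = (#|max_comm U : (max_comm U)^`(1)| - 1)%N.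
Proof.
move=> maxU; set K := max_comm U; set D := K^`(1); set B := max_comp U.
have /subsetPn[k Kk nDk] := max_comm_not_der maxU.
have nK x : x \in B -> x \in 'N(K).
  by move=> Bx; rewrite (subsetP (max_comm_norm U)) // (subsetP sHG) // (subsetP (max_comp_sub U)).
have nD x : x \in B -> x \in 'N(D).
  by move=> Bx; rewrite (subsetP (char_norm_trans (der_char 1 K) (subxx _))) ?nK.
have nDK := der_norm 1 K.
have Kkx x : x \in B -> k ^ x \in K by move=> Bx; rewrite memJ_norm ?nK.
have Nkx x : x \in B -> k ^ x \in 'N(D) by move=> Bx; rewrite (subsetP nDK) ?Kkx.
have im_phi: [set coset D (k ^ x) | x in B] = (K / D)^#.
  apply/eqP; rewrite eqEsubset; apply/andP; split.
    apply/subsetP=> _ /imsetP[x Bx ->]; rewrite !inE mem_quotient ?Kkx // andbT.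
    apply: contra nDk => /eqP /coset_idr; rewrite Nkx // => /(_ isT).
    by rewrite memJ_norm ?nD.
  apply/subsetP=> X /setD1P[nt /morphimP[g Ng Kg def_g]]; rewrite {X}def_g /= in nt *.
  have KDg: g \in K :\: D.
    by rewrite inE Kg andbT; apply: contra nt => Dg; rewrite coset_id.
  have KDk: k \in K :\: D by rewrite inE nDk.
  have [x Bx Dx] := max_comp_trans maxU KDk KDg; apply/imsetP; exists x => //.
  apply/eqP; rewrite eq_sym eq_mulgV1 -morphV // -morphM ?groupV ?Nkx //=.
  by rewrite coset_id.
rewrite -card_quotient // (cardsD1 1 (K / D)) group1 addKn -im_phi.
rewrite card_in_imset // => x y Bx By eqxy; apply/eqP; rewrite eq_mulgV1.
have Bz : x * y^-1 \in B by rewrite groupM ?groupV.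
apply: contraR nDk => ntz; apply: (@max_comp_fpf U maxU (x * y^-1) _ k Kk).
  by apply/setD1P.
have Dxy : (k ^ x)^-1 * k ^ y \in D.
  apply: coset_idr; first by rewrite groupM ?groupV ?Nkx.
  by rewrite morphM ?groupV ?Nkx // morphV ?Nkx //= eqxy mulVg.
have -> : [~ x * y^-1, k] = ((k ^ x)^-1 * k ^ y) ^ y^-1.
  by rewrite conjMg conjgK conjVg -conjgM commgEr conjVg.
by rewrite memJ_norm ?groupV ?nD.
Qed.

(** By irreducibility the Frattini subgroup of K is K'. *)
Lemma max_comm_abelem U : U \in max_normal ->
  p.-abelem (max_comm U / (max_comm U)^`(1)).
Proof.
move=> maxU; set K := max_comm U; have pK := pgroupS (max_comm_subP U) pP.
have sDPhi: K^`(1) \subset 'Phi(K) by rewrite (Phi_joing pK) joing_subl.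
have nPhi: H \subset 'N('Phi(K)).
  apply: char_norm_trans (Phi_char K) _; exact: subset_trans sHG (max_comm_norm U).
have [/= <-|/= eqK] := comm_max_normal_irr maxU sDPhi (Phi_sub K) nPhi.
  exact: Phi_quotient_abelem.
case/negP: (max_comm_not_der maxU); have [K1|ntK] := eqVneq (K : {set gT}) 1.
  by rewrite -/K K1 sub1G.
by have := Phi_proper ntK; rewrite eqK properxx.
Qed.

(** An abelian group with a faithful irreducible module, here K / K', is
    cyclic. *)
Lemma max_comp_cyclic U : U \in max_normal -> cyclic (max_comp U).
Proof.
move=> maxU; have abE := max_comm_abelem maxU.
set K := max_comm U in abE *; set D := K^`(1) in abE *; set B := max_comp U.
have sBG: B \subset G := subset_trans (max_comp_sub U) sHG.
have nKB: B \subset 'N(K) := subset_trans sBG (max_comm_norm U).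
have nDB: B \subset 'N(D) := char_norm_trans (der_char 1 K) nKB.
have nDK: K \subset 'N(D) := der_norm 1 K.
have tiDB: D :&: B = 1.
  apply: coprime_TIg; apply: coprimegS (max_comp_sub U) _; apply: coprimeSg coPH.
  exact: subset_trans (der_sub 1 K) (max_comm_subP U).
rewrite (isog_cyclic (quotient_isog nDB tiDB)).
have ntE: K / D != 1 by rewrite -subG1 quotient_sub1 ?max_comm_not_der.
have nEA: B / D \subset 'N(K / D) by apply: quotient_norms.
have faith: 'C_(B / D)(K / D) = 1.
  apply/trivgP/subsetP=> _ /setIP[/morphimP[x Nx Bx ->] cx].
  apply: contraT => ntx; have B1x : x \in B^#.
    by apply/setD1P; split=> //; apply: contraNneq ntx => ->; rewrite morph1 group1.
  case/negP: (max_comm_not_der maxU); apply/subsetP=> k Kk.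
  apply: (max_comp_fpf maxU B1x Kk); have Nk := subsetP nDK k Kk.
  apply: coset_idr; first by rewrite groupR.
  rewrite morphR //=; apply/eqP/commgP/commute_sym; apply: commute_sym.
  by apply: (centP cx); rewrite mem_quotient.
apply: (mx_faithful_irr_abelian_cyclic (rG := abelem_repr abE ntE nEA)).
- by rewrite /mx_faithful rker_abelem faith.
- apply/abelem_mx_irrP/mingroupP; split=> [|V /andP[ntV nVA] sVE]; first by rewrite ntE.
  apply/eqP; rewrite eqEsubset sVE /=.
  have /trivgPn[v Vv ntv] := ntV; have := subsetP sVE v Vv.
  case/morphimP=> k Nk Kk def_v; rewrite {v}def_v /= in Vv ntv.
  have KDk: k \in K :\: D by rewrite inE Kk andbT; apply: contra ntv => Dk; rewrite coset_id.
  apply/subsetP=> _ /morphimP[g Ng Kg ->] /=.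
  have [Dg|nDg] := boolP (g \in D); first by rewrite coset_id ?group1.
  have KDg: g \in K :\: D by rewrite inE nDg.
  have [x Bx Dx] := max_comp_trans maxU KDk KDg.
  have Nx := subsetP nDB x Bx; have Nkx: k ^ x \in 'N(D) by rewrite groupJ.
  have <- : coset D (k ^ x) = coset D g.
    apply/eqP; rewrite eq_mulgV1 -morphV // -morphM ?groupV //=.
    by rewrite coset_id.
  by rewrite morphJ //= memJ_norm // (subsetP nVA) // mem_quotient.
by rewrite quotient_abelian // (abelianS (max_comp_sub U)).
Qed.

(** Given h in H, multiply elements of the max_comp U, one U after the other,
    to obtain b acting like h on one nontrivial coset k U of each K_U'. Then h
    b^-1 fixes these cosets, so it centralises all the K_U, hence P. *)
Lemma gen_max_comp : << \bigcup_(U in max_normal) max_comp U >> = H.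
Proof.
set B := << _ >>.
have sBH: B \subset H by rewrite gen_subG; apply/bigcupsP=> U _; apply: max_comp_sub.
have sUB U : U \in max_normal -> max_comp U \subset B.
  by move=> maxU; rewrite sub_gen // (bigcup_sup U).
apply/eqP; rewrite eqEsubset sBH; apply/subsetP=> h Hh.
have Gh := subsetP sHG h Hh.
have nK U x : x \in H -> x \in 'N(max_comm U).
  by move=> Hx; rewrite (subsetP (max_comm_norm U)) // (subsetP sHG).
have nD U x : x \in H -> x \in 'N((max_comm U)^`(1)).
  move=> Hx; apply: (subsetP (char_norm_trans (der_char 1 _) (max_comm_norm U))).
  exact: (subsetP sHG).
have ex0 U : U \in max_normal -> exists2 k, k \in max_comm U & k \notin (max_comm U)^`(1).
  by move=> maxU; apply/subsetPn; apply: max_comm_not_der.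
pose k U := odflt 1 [pick a in max_comm U | a \notin (max_comm U)^`(1)].
have kP U : U \in max_normal -> k U \in max_comm U :\: (max_comm U)^`(1).
  move=> maxU; rewrite inE andbC /k; case: pickP => [a //|no].
  by have [a Ka na] := ex0 U maxU; have := no a; rewrite Ka na.
have KDJ U c x : x \in H -> c \in max_comm U :\: (max_comm U)^`(1) ->
    c ^ x \in max_comm U :\: (max_comm U)^`(1).
  by move=> Hx; rewrite !inE !memJ_norm ?nK ?nD.
have [b Bb bP] : exists2 b, b \in B & forall U, U \in enum max_normal ->
    k U ^ b * (k U ^ h)^-1 \in (max_comm U)^`(1).
  have: {subset enum max_normal <= max_normal} by move=> U; rewrite mem_enum.
  elim: (enum max_normal) (enum_uniq max_normal) => [|U r IHr] /=; first by exists 1.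
  case/andP=> nrU uniq_r sr; have maxU : U \in max_normal by apply: sr; rewrite mem_head.
  have{} sr: {subset r <= max_normal} by move=> V rV; apply: sr; rewrite inE rV orbT.
  have [b Bb bP] := IHr uniq_r sr.
  have Hb := subsetP sBH b Bb.
  have [x Ux Dx] := max_comp_trans maxU (KDJ U _ b Hb (kP U maxU)) (KDJ U _ h Hh (kP U maxU)).
  have Hx := subsetP (max_comp_sub U) x Ux.
  exists (b * x); first by rewrite groupM // (subsetP (sUB U maxU)).
  move=> V; rewrite inE; have [-> _|neVU /= rV] := eqVneq V U; first by rewrite conjgM.
  have maxV := sr V rV; rewrite conjgM.
  have [_ /(_ V maxV neVU)/centP cx] := max_compP _ _ Ux.
  have KVb: k V ^ b \in max_comm V by have /setDP[] := KDJ V _ b Hb (kP V maxV).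
  rewrite (conjg_fixP (y := x) _) ?bP //.
  by apply/commgP/commute_sym/cx.
have Hb := subsetP sBH b Bb.
suff: h * b^-1 \in 'C_H(P).
  by rewrite faithH => /set1P/eqP; rewrite -eq_mulgV1 => /eqP->.
have Hhb: h * b^-1 \in H by rewrite groupM ?groupV.
rewrite inE Hhb -sub1set; apply: cent_max_comm => U maxU; rewrite sub1set.
apply: contraT => nC; have /setDP[KU /negP[]] := kP U maxU.
apply: (max_comm_fpf maxU Hhb nC KU).
have := bP U; rewrite mem_enum maxU => /(_ isT) Dbh.
have -> : [~ h * b^-1, k U] = ((k U ^ h)^-1 * (k U ^ b)) ^ b^-1.
  by rewrite conjMg conjgK conjVg -conjgM commgEr conjVg.
rewrite memJ_norm ?groupV ?nD //.
have -> : (k U ^ h)^-1 * k U ^ b = (k U ^ b * (k U ^ h)^-1) ^ (k U ^ h).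
  by rewrite [RHS]conjgE mulgKV.
rewrite memJ_norm // (subsetP (normal_norm (der_normal 1 _))) //.
by rewrite memJ_norm ?nK.
Qed.

(** * The Camina property: two elementary cases *)

Section CaminaPart.

Variable U : {group gT}.
Hypothesis maxU : U \in max_normal.
Local Notation K := (max_comm U).
Local Notation D := (max_comm U)^`(1).
Local Notation B := (max_comp U).

Let sKP : K \subset P. Proof. exact: max_comm_subP. Qed.
Let sKG : K \subset G. Proof. exact: subset_trans sKP sPG. Qed.
Let sDK : D \subset K. Proof. exact: der_sub. Qed.
Let sDZ : D \subset Z. Proof. exact: max_comm_der_cent. Qed.
Let sBG : B \subset G. Proof. exact: subset_trans (max_comp_sub U) sHG. Qed.
Let nKG : G \subset 'N(K). Proof. exact: max_comm_norm. Qed.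
Let nDG : G \subset 'N(D). Proof. exact: char_norm_trans (der_char 1 _) nKG. Qed.
Let sDU : D \subset U. Proof. by rewrite -(max_commI maxU) subsetIr. Qed.
Let sUP : U \subset P. Proof. exact: proper_sub (max_normal_proper maxU). Qed.

Let cDP d y : d \in D -> y \in P -> d ^ y = d.
Proof.
move=> Dd Py; apply/conjg_fixP/commgP; have /setIP[_ /centP cd] := subsetP sDZ d Dd.
exact: cd.
Qed.
Let cDK d y : d \in D -> y \in K -> d ^ y = d.
Proof. by move=> Dd Ky; rewrite cDP ?(subsetP sKP). Qed.
Let KD1 u w : u \in K -> w \in K -> [~ u, w] \in D.
Proof. by move=> Ku Kw; rewrite derg1 mem_commg. Qed.
Let RM u w1 w2 : u \in K -> w1 \in K -> w2 \in K ->
  [~ u, w1 * w2] = [~ u, w1] * [~ u, w2].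
Proof.
move=> Ku K1 K2; rewrite commgMJ (cDK (KD1 Ku K1) K2).
apply: (centsP (subset_trans sDZ (subsetIr _ _))); first exact: KD1.
by rewrite (subsetP sKP) // (subsetP sDK) ?KD1.
Qed.
Let LM u w1 w2 : u \in K -> w1 \in K -> w2 \in K ->
  [~ w1 * w2, u] = [~ w1, u] * [~ w2, u].
Proof. by move=> Ku K1 K2; rewrite commMgJ (cDK (KD1 K1 Ku) K2). Qed.
Let RD u d : u \in K -> d \in D -> [~ u, d] = 1.
Proof.
move=> Ku Dd; rewrite -invg_comm; apply/eqP; rewrite invg_eq1; apply/conjg_fixP.
exact: cDK.
Qed.
Let LD u d : u \in K -> d \in D -> [~ d, u] = 1.
Proof. by move=> Ku Dd; apply/eqP/conjg_fixP; apply: cDK. Qed.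

(** As K has class two, this set of commutators is a subgroup of K', and the
    Camina property says that it is K' for every v outside K'. *)
Definition comm_set v := [set [~ v, k] | k in K].

Lemma comm_set_group v : v \in K -> group_set (comm_set v).
Proof.
move=> Kv; apply/group_setP; split.
  by apply/imsetP; exists 1; rewrite ?comm1g ?commg1.
move=> _ _ /imsetP[a Ka ->] /imsetP[b Kb ->]; apply/imsetP; exists (a * b).
  exact: groupM.
by rewrite RM.
Qed.

Lemma comm_set_sub v : v \in K -> comm_set v \subset D.
Proof. by move=> Kv; apply/subsetP=> _ /imsetP[k Kk ->]; apply: KD1. Qed.

Lemma comm_set_mulD v d : v \in K -> d \in D -> comm_set (d * v) = comm_set v.
Proof.
move=> Kv Dd; apply: eq_in_imset => k Kk; have Kd := subsetP sDK d Dd.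
by rewrite LM // LD // mul1g.
Qed.

Lemma comm_setJ v x : v \in K -> x \in G -> comm_set (v ^ x) = comm_set v :^ x.
Proof.
move=> Kv Gx; rewrite /conjugate -imset_comp /comm_set.
have Nx := subsetP nKG x Gx.
rewrite -{1}(normP Nx) /conjugate -imset_comp; apply: eq_in_imset => k Kk /=.
by rewrite conjRg.
Qed.

(** Otherwise v would centralise both K and U, hence P, and so lie in Z, which
    meets K in K'. *)
Lemma comm_set_ntriv v : v \in K -> v \notin D -> ~~ (comm_set v \subset [1]).
Proof.
move=> Kv nDv; apply: contra nDv => /subsetP cv.
have KU1: v \in 'Z(P).
  rewrite inE (subsetP sKP) //= -sub1set -(max_comm_mul maxU).
  have cK: [set v] \subset 'C(K).
    rewrite sub1set; apply/centP=> k Kk; apply/commgP/eqP/set1P; apply: cv.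
    exact: imset_f.
  have cU: [set v] \subset 'C(U).
    rewrite sub1set; apply: (subsetP _ _ Kv); exact: comm_max_normal_cent.
  by rewrite centM subsetI cK.
by rewrite -(max_commI maxU) inE Kv (subsetP (max_normal_sub maxU)).
Qed.

(** If K is generated by v, w and K', then K' is generated by [v, w]. *)
Lemma comm_set_2gen v w : v \in K -> w \in K -> K \subset <<[set v; w] :|: D>> ->
  comm_set v = D.
Proof.
move=> Kv Kw genK; apply/eqP; rewrite eqEsubset comm_set_sub //=.
pose N := Group (comm_set_group Kv).
have NV x y : [~ x, y] \in N -> [~ y, x] \in N by rewrite -invg_comm groupV.
have vN k : k \in K -> [~ v, k] \in N by move=> Kk; apply: imset_f.
have centN u (S : {set gT}) : u \in K -> S \subset K -> K \subset <<S>> ->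
    {in S, forall y, [~ u, y] \in N} -> {in K, forall y, [~ u, y] \in N}.
  move=> Ku sSK gS uS; pose C := [set y in K | [~ u, y] \in N].
  have gC: group_set C.
    apply/group_setP; split; first by rewrite inE group1 commg1 group1.
    move=> a b /setIdP[Ka Na] /setIdP[Kb Nb]; rewrite inE groupM //.
    by rewrite RM // groupM.
  suff sKC: K \subset Group gC by move=> y /(subsetP sKC)/setIdP[].
  apply: subset_trans gS _; rewrite gen_subG; apply/subsetP=> y Sy.
  by rewrite inE (subsetP sSK) // uS.
have sSK: [set v; w] :|: D \subset K.
  by rewrite subUset sDK andbT; apply/subsetP=> y /set2P[]->.
have wN : {in K, forall y, [~ w, y] \in N}.
  apply: (centN w _ Kw sSK genK) => y /setUP[/set2P[]->|Dy].
  - exact/NV/vN.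
  - by rewrite commgg group1.
  by rewrite RD ?group1.
have allN : {in K, forall u, {in K, forall y, [~ u, y] \in N}}.
  move=> u Ku; apply: (centN u _ Ku sSK genK) => y /setUP[/set2P[]->|Dy].
  - exact/NV/vN.
  - exact/NV/wN.
  by rewrite RD ?group1.
rewrite derg1 (gen_subG _ N); apply/subsetP=> _ /imset2P[a b Ka Kb ->].
exact: allN.
Qed.

(** Transitivity gives the same order two to all these sets, so all
    centralisers have index two in K. Two of them do not cover K, and a common
    u outside the centralisers of v and w shows that nontrivial commutators of
    v and of w agree with nontrivial commutators of u. So there is only one
    nontrivial commutator. *)
Lemma comm_set_card2 a : a \in K :\: D -> #|comm_set a| = 2 ->
  {in K :\: D, forall v, comm_set v = D}.
Proof.
move=> KDa o2.
have oN v : v \in K :\: D -> #|comm_set v| = 2.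
  move=> KDv; have [x Bx Dx] := max_comp_trans maxU KDv KDa.
  have [/setDP[Kv _] /setDP[Ka _]] := (KDv, KDa).
  rewrite -(cardJg _ x) -comm_setJ ?(subsetP sBG) //.
  by rewrite -[v ^ x](mulgKV a) comm_set_mulD.
have cardC v : v \in K :\: D -> (#|'C_K[v]| * 2)%N = #|K|.
  move=> KDv; rewrite -(oN v KDv) -(Lagrange (subsetIl K 'C[v])); congr (_ * _)%N.
  by rewrite index_cent1 class_commg (card_imset _ (@mulgI _ v)).
have mem2 v k l : v \in K :\: D -> k \in K -> l \in K ->
    [~ v, k] != 1 -> [~ v, l] != 1 -> [~ v, k] = [~ v, l].
  move=> KDv Kk Kl nk nl; apply: contra_eq (oN v KDv) => neq.
  rewrite eq_sym ltn_eqF // (cardsD1 1) (cardsD1 [~ v, k]) (cardsD1 [~ v, l]).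
  have mem x : x \in K -> [~ v, x] \in comm_set v by apply: imset_f.
  have m1: 1 \in comm_set v by rewrite -(commg1 v) mem.
  by rewrite !inE m1 nk nl !mem // eq_sym neq.
have commE v w k l : v \in K :\: D -> w \in K :\: D -> k \in K -> l \in K ->
   [~ v, k] != 1 -> [~ w, l] != 1 -> [~ v, k] = [~ w, l].
  move=> KDv KDw Kk Kl nk nl.
  have [/setDP[Kv nDv] /setDP[Kw nDw]] := (KDv, KDw).
  have: ~~ (K \subset 'C_K[v] :|: 'C_K[w]).
    apply/negP=> /subset_leq_card; rewrite leqNgt; case/negP.
    (* Two subgroups of index two cover less than K, because they share the
       identity. *)
    rewrite cardsU -(ltn_pmul2r (m := 2)) // mulnBl mulnDl !cardC //.
    rewrite [ltnRHS]muln2 -addnn ltn_subrL addn_gt0 muln_gt0 cardG_gt0 andbT.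
    by rewrite (cardG_gt0 ('C_K[v] :&: 'C_K[w])%G).
  case/subsetPn=> u Ku; rewrite in_setU !in_setI Ku /= negb_or => /andP[nvu nwu].
  have nv: [~ v, u] != 1 by apply: contra nvu => /commgP cvu; apply/cent1P/commute_sym.
  have nw: [~ w, u] != 1 by apply: contra nwu => /commgP cwu; apply/cent1P/commute_sym.
  have nDu: u \notin D by apply: contra nv => Du; rewrite RD.
  have KDu: u \in K :\: D by rewrite inE nDu.
  rewrite (mem2 v k u) // (mem2 w l u) // -invg_comm -[RHS]invg_comm; congr (_^-1).
  by apply: mem2 => //; rewrite -invg_comm invg_eq1.
move=> v KDv; have /setDP[Kv nDv] := KDv; apply/eqP; rewrite eqEsubset comm_set_sub //=.
have /subsetPn[_ /imsetP[k Kk ->] nvk] := comm_set_ntriv Kv nDv.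
rewrite derg1 (gen_subG _ (Group (comm_set_group Kv))); apply/subsetP=> _ /imset2P[x y Kx Ky ->] /=.
have [->|nxy] := eqVneq [~ x, y] 1; first by rewrite -(commg1 v) imset_f.
have nDx: x \notin D by apply: contra nxy => Dx; rewrite LD.
rewrite (commE x v y k) ?imset_f //; first by rewrite inE nDx.
by apply: contra nvk => /eqP->; rewrite set11.
Qed.

Section FixedCenter.

Hypothesis ntC : 'C_D(B) != 1.
Local Notation Y := [~: D, B].

Let nDB : B \subset 'N(D). Proof. exact: subset_trans sBG nDG. Qed.
Let coDB : coprime #|D| #|B|.
Proof. exact: coprimeSg (subset_trans sDK sKP) (coprimegS (max_comp_sub U) coPH). Qed.
Let abD : abelian D.
Proof. by rewrite /abelian (subset_trans sDZ) // (subset_trans (subsetIr _ _)) // centS // (subset_trans sDK). Qed.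
Let sYD : Y \subset D. Proof. by rewrite commg_subl. Qed.

Let not_sDY : ~~ (D \subset Y).
Proof.
apply: contra ntC => sDY; have eqD: Y = D by apply/eqP; rewrite eqEsubset sYD.
by rewrite -(coprime_abel_cent_TI nDB coDB abD) {1}eqD.
Qed.

Let nYH : H \subset 'N(Y).
Proof.
apply: normsR; first exact: subset_trans sHG nDG.
by rewrite cents_norm // centsC (subset_trans (max_comp_sub U)).
Qed.

Let sDNY : D \subset 'N(Y). Proof. exact: sub_abelian_norm. Qed.

(** The radical of the commutator form of K / K' with values in K' / Y is
    invariant under H, so it is trivial by irreducibility. Here Y <> K'
    because B has a nontrivial fixed point on the abelian group K'. *)
Let cent_mod u : u \in K -> {in K, forall w, [~ u, w] \in Y} -> u \in D.
Proof.
move=> Ku uY; pose W := [set u in K | [forall w in K, [~ u, w] \in Y]].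
have WP a : reflect (a \in K /\ {in K, forall w, [~ a, w] \in Y}) (a \in W).
  by rewrite inE; apply: (iffP andP) => -[Ka /forall_inP Wa].
have gW: group_set W.
  apply/group_setP; split.
    by apply/WP; split=> // w Kw; rewrite comm1g group1.
  move=> a b /WP[Ka Na] /WP[Kb Nb]; apply/WP; split=> [|w Kw]; first exact: groupM.
  by rewrite LM // groupM ?Na ?Nb.
have sDW : D \subset Group gW.
  apply/subsetP=> d Dd; apply/WP; split=> [|w Kw]; first exact: (subsetP sDK).
  by rewrite LD ?group1.
have sWK : Group gW \subset K by apply/subsetP=> a /WP[].
have nWH : H \subset 'N(Group gW).
  apply/subsetP=> x Hx; rewrite inE; apply/subsetP=> _ /imsetP[a /WP[Ka Na] ->].
  have Nx: x \in 'N(K) by rewrite (subsetP nKG) // (subsetP sHG).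
  apply/WP; split=> [|w Kw]; first by rewrite memJ_norm.
  rewrite -[w](conjgKV x) -conjRg memJ_norm ?(subsetP nYH) //.
  by rewrite Na // memJ_norm ?groupV.
have [/= eqWD|/= eqWK] := comm_max_normal_irr maxU sDW sWK nWH.
  have : u \in W by apply/WP.
  by rewrite eqWD.
case/negP: not_sDY; rewrite {1}derg1 gen_subG.
apply/subsetP=> _ /imset2P[a b Ka Kb ->].
have : a \in W by rewrite eqWK.
by case/WP=> _; apply.
Qed.

Let Bcomm x y : x \in B -> y \in B -> x * y = y * x.
Proof.
move=> Bx By; apply: (centsP cHH); first exact: (subsetP (max_comp_sub U)).
exact: (subsetP (max_comp_sub U)).
Qed.

Let KB u x : u \in K -> x \in B -> u ^ x \in K.
Proof. by move=> Ku Bx; rewrite memJ_norm // (subsetP nKG) // (subsetP sBG). Qed.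
Let DB d x : d \in D -> x \in B -> d ^ x \in D.
Proof. by move=> Dd Bx; rewrite memJ_norm // (subsetP nDB). Qed.

(** B permutes the nontrivial cosets of K' transitively, so the coset of v0^h
    v0 is that of v0^k for some k in B; since B is abelian and transitive, u^h
    u and u^k agree modulo K' for all u. *)
Let conj_add h v0 : h \in B -> v0 \in K -> v0 ^ h * v0 \notin D ->
  exists2 k, k \in B & {in K, forall u, exists2 d, d \in D & u ^ k = d * (u ^ h * u)}.
Proof.
move=> Bh Kv0 nD1.
have nDv0: v0 \notin D by apply: contra nD1 => Dv0; rewrite groupM ?DB.
have KDv0: v0 \in K :\: D by rewrite inE nDv0.
have KDv1: v0 ^ h * v0 \in K :\: D by rewrite inE nD1 groupM ?KB.
have [k Bk Dk] := max_comp_trans maxU KDv0 KDv1; exists k => // u Ku.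
have [Du|nDu] := boolP (u \in D).
  exists (u ^ k * (u ^ h * u)^-1); last by rewrite mulgKV.
  by apply: groupM; rewrite ?groupV ?(groupM (DB Du Bh) Du) ?DB.
have KDu: u \in K :\: D by rewrite inE nDu.
have [x Bx Dx] := max_comp_trans maxU KDv0 KDu.
have [d0 Dd0 Ed0] : exists2 d0, d0 \in D & v0 ^ k = d0 * (v0 ^ h * v0).
  by exists (v0 ^ k * (v0 ^ h * v0)^-1); rewrite ?mulgKV.
have [e De Eu] : exists2 e, e \in D & u = e * v0 ^ x.
  by exists (v0 ^ x * u^-1)^-1; rewrite ?groupV // invMg invgK mulgKV.
exists (e ^ k * d0 ^ x * (e ^ h * e)^-1).
  apply: groupM; first by rewrite groupM ?DB.
  by rewrite groupV groupM ?DB.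
have Ek: (v0 ^ x) ^ k = d0 ^ x * ((v0 ^ x) ^ h * v0 ^ x).
  rewrite -conjgM Bcomm // conjgM Ed0 conjMg; congr (_ * _).
  by rewrite conjMg -[(v0 ^ h) ^ x]conjgM (Bcomm Bh Bx) conjgM.
have Kvx := KB Kv0 Bx.
have cev: (v0 ^ x) ^ h * e = e * (v0 ^ x) ^ h.
  by rewrite [RHS]conjgC (cDK De) ?KB.
have -> : u ^ h * u = (e ^ h * e) * ((v0 ^ x) ^ h * v0 ^ x).
  rewrite {1 2}Eu conjMg; move: cev.
  move: (v0 ^ x) (e ^ h) ((v0 ^ x) ^ h) => c a b cev.
  by rewrite !mulgA -[a * b * e]mulgA cev !mulgA.
rewrite {1}Eu conjMg Ek; move: (e ^ k) (d0 ^ x) (e ^ h * e) (_ * v0 ^ x) => a b c d.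
by rewrite !mulgA mulgKV.
Qed.

(** The commutator form with values in K' / Y is invariant under B. Written
    additively, apply this to k, where u^k = u^h + u: from (u^k, w^k) = (u^h,
    w^h) = (u, w) follows (u^h, w) + (u, w^h) + (u, w) = 0. As (u, w^h) =
    (u^(h^-1), w), the element u^h + u^(h^-1) + u is in the radical of the
    form, which is trivial. *)
Let conj_sum h v0 : h \in B -> v0 \in K -> v0 ^ h * v0 \notin D ->
  {in K, forall u, u ^ h * u ^ h^-1 * u \in D}.
Proof.
move=> Bh Kv0 nD1 u Ku; have [k Bk kP] := conj_add Bh Kv0 nD1.
have Bh' := groupVr Bh.
have Kuh := KB Ku Bh; have Kuh' := KB Ku Bh'.
have K2 : u ^ h * u ^ h^-1 \in K by apply: groupM.
have K3 : u ^ h * u ^ h^-1 * u \in K by apply: groupM.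
apply: cent_mod => // w Kw; have Kwh := KB Kw Bh.
pose q := coset Y.
have NY x : x \in D -> x \in 'N(Y) by apply: (subsetP sDNY).
have qM x y : x \in D -> y \in D -> q (x * y) = q x * q y.
  by move=> Dx Dy; rewrite /q morphM ?NY.
have qB x b : x \in D -> b \in B -> q (x ^ b) = q x.
  move=> Dx Bb; have Yxb : [~ x, b] \in Y by apply: mem_commg.
  rewrite conjg_mulR qM //; last exact: (subsetP sYD).
  by rewrite [X in _ * X]coset_id // mulg1.
have [d1 Dd1 E1] := kP u Ku; have [d2 Dd2 E2] := kP w Kw.
have q1: q [~ u ^ k, w ^ k] = q [~ u, w] by rewrite -conjRg qB ?KD1.
have Kd1 := subsetP sDK d1 Dd1; have Kd2 := subsetP sDK d2 Dd2.
have q2: [~ u ^ k, w ^ k] = [~ u ^ h, w ^ h] * [~ u ^ h, w] * ([~ u, w ^ h] * [~ u, w]).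
  have Ku2 : u ^ h * u \in K by apply: groupM.
  have Kw2 : w ^ h * w \in K by apply: groupM.
  have Kw2' : d2 * (w ^ h * w) \in K by apply: groupM.
  rewrite E1 E2 (LM Kw2' Kd1 Ku2) (LD Kw2' Dd1) mul1g (RM Ku2 Kd2 Kw2) (RD Ku2 Dd2) mul1g.
  by rewrite (LM Kw2 Kuh Ku) (RM Kuh Kwh Kw) (RM Ku Kwh Kw).
have q3: q [~ u ^ h, w ^ h] = q [~ u, w] by rewrite -conjRg qB ?KD1.
have q4: q [~ u, w ^ h] = q [~ u ^ h^-1, w].
  by rewrite -{1}[u](conjgKV h) -conjRg qB ?KD1.
have Dt : [~ u, w] \in D by apply: KD1.
have [D1 D2] : [~ u ^ h, w] \in D /\ [~ u, w ^ h] \in D by rewrite !KD1.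
have D3 : [~ u ^ h^-1, w] \in D by apply: KD1.
have D0 : [~ u ^ h, w ^ h] \in D by apply: KD1.
move: q1; rewrite q2 (qM _ _ (groupM D0 D1) (groupM D2 Dt)) (qM _ _ D0 D1) (qM _ _ D2 Dt).
rewrite q3 q4 -mulgA -[RHS]mulg1 => /mulgI eq1.
apply: coset_idr; first by rewrite NY ?KD1.
rewrite (LM Kw K2 Ku) (LM Kw Kuh Kuh') -/q (qM _ _ (groupM D1 D3) Dt) (qM _ _ D1 D3).
by rewrite -mulgA.
Qed.

(** Written additively in K / K', conj_sum says that 1 + h + h^-1 kills K / K'
    for every h in B with v^h <> - v. If all conjugates of v are multiples of
    v, then K = <v> K'. Otherwise choose v^h outside <v>; if v and v^h do not
    generate K / K', some v^k is outside their span, and the relations for h,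
    k, k h and k h^-1 add up to 3 v = 0. In characteristic 3 the relation for
    h says that v^h - v is fixed by h, so that v^h = v, a contradiction. *)
Lemma fixed_center_comm_set : {in K :\: D, forall v, comm_set v = D}.
Proof.
move=> v KDv; have /setDP[Kv nDv] := KDv.
have abE := max_comm_abelem maxU.
have ntE: K / D != 1.
  by rewrite -subG1 quotient_sub1 ?max_comm_not_der // der_norm.
pose r u := abelem_rV abE ntE (coset D u).
have NK u : u \in K -> u \in 'N(D) by apply: (subsetP (der_norm 1 _)).
have EK u : u \in K -> coset D u \in K / D by apply: mem_quotient.
have rM a b : a \in K -> b \in K -> r (a * b) = (r a + r b)%R.
  by move=> Ka Kb; rewrite /r morphM ?NK // abelem_rV_M ?EK.
have r0 a : a \in D -> r a = 0%R.
  by move=> Da; rewrite /r coset_id // abelem_rV_1.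
have rD a : a \in K -> r a = 0%R -> a \in D.
  move=> Ka; rewrite /r -(abelem_rV_1 abE ntE) => eqa.
  by apply: coset_idr; rewrite ?NK // (abelem_rV_inj _ _ eqa) ?EK ?group1.
pose A x i := r (v ^ x) ord0 i.
have Kvx x : x \in B -> v ^ x \in K by apply: KB.
pose L1 := <<[set v; v] :|: D>>.
have sDL (S : {set gT}) : D \subset <<S :|: D>> by rewrite sub_gen // subsetUr.
have vL w : v \in <<[set v; w] :|: D>> by rewrite mem_gen // !inE eqxx.
have wL w : w \in <<[set v; w] :|: D>> by rewrite mem_gen // !inE eqxx orbT.
have [/forall_inP allB|/forall_inPn[h Bh nLh]] := boolP [forall x in B, v ^ x \in L1].
  apply: (@comm_set_2gen v v) => //; apply/subsetP=> u Ku.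
  have [Du|nDu] := boolP (u \in D); first exact: (subsetP (sDL _)).
  have KDu: u \in K :\: D by rewrite inE nDu.
  have [x Bx Dx] := max_comp_trans maxU KDv KDu.
  have -> : u = (v ^ x * u^-1)^-1 * v ^ x by rewrite invMg invgK mulgKV.
  by rewrite groupM ?groupV ?allB // (subsetP (sDL _)).
pose L := <<[set v; v ^ h] :|: D>>.
have Bh' := groupVr Bh; have Kvh := Kvx h Bh.
have sL1L : L1 \subset L.
  by rewrite genS // setSU // subUset !sub1set !inE eqxx.
have DL d : d \in D -> d \in L by apply: (subsetP (sDL _)).
have star x : x \in B -> v ^ x * v \notin D -> {in K, forall u i,
    (r (u ^ x)%g ord0 i + r (u ^ x^-1)%g ord0 i + r u ord0 i = 0)%R}.
  move=> Bx nDx u Ku i; have := conj_sum Bx Kv nDx Ku; move/r0.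
  have Kux := KB Ku Bx; have Kux' := KB Ku (groupVr Bx).
  rewrite (rM _ _ (groupM Kux Kux') Ku) (rM _ _ Kux Kux').
  by move/rowP/(_ i); rewrite !mxE.
have nD1 x : x \in B -> v ^ x \notin L1 -> v ^ x * v \notin D.
  move=> Bx; apply: contra => Dx; rewrite -(mulgK v (v ^ x)).
  by rewrite groupM ?groupV ?vL // (subsetP (sDL _)).
have starh := star h Bh (nD1 h Bh nLh).
have Lvh' : v ^ h^-1 \in L.
  have := conj_sum Bh Kv (nD1 h Bh nLh) Kv => Dh.
  have -> : v ^ h^-1 = (v ^ h)^-1 * (v ^ h * v ^ h^-1 * v) * v^-1.
    by move: (v ^ h) (v ^ h^-1) => a b; rewrite !mulgA mulVg mul1g mulgK.
  by rewrite groupM ?groupV ?vL // groupM ?groupV ?wL ?DL.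
apply: (comm_set_2gen Kv Kvh); apply/subsetP=> y Ky; apply: contraT => nLy.
have nDy: y \notin D by apply: contra nLy; apply: DL.
have KDy: y \in K :\: D by rewrite inE nDy.
have [k Bk Dk] := max_comp_trans maxU KDv KDy.
have nLk: v ^ k \notin L.
  apply: contra nLy => Lk; have -> : y = (v ^ k * y^-1)^-1 * v ^ k.
    by rewrite invMg invgK mulgKV.
  by rewrite groupM ?groupV // DL.
have Bk' := groupVr Bk.
have nDk: v ^ k * v \notin D.
  by apply: nD1 => //; apply: contra nLk; apply: (subsetP sL1L).
have nDkh: v ^ (k * h) * v \notin D.
  apply: contra nLk => Dkh; have := DB Dkh Bh'; rewrite conjMg -conjgM mulgK.
  by move/DL; rewrite groupMr.
have nDkh': v ^ (k * h^-1) * v \notin D.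
  apply: contra nLk => Dkh; have := DB Dkh Bh; rewrite conjMg -conjgM mulgKV.
  by move/DL; rewrite groupMr ?wL.
have E1 i := starh _ (Kvx k Bk) i.
have E2 i := starh _ (Kvx _ Bk') i.
have E3 i := star k Bk nDk v Kv i.
have E4 i := star _ (groupM Bk Bh) nDkh v Kv i.
have E5 i := star _ (groupM Bk Bh') nDkh' v Kv i.
have A3 i : (r v ord0 i * 3%:R = 0)%R.
  have := E1 i; have := E2 i; have := E3 i; have := E4 i; have := E5 i.
  rewrite !(invMg k) invgK -!conjgM (Bcomm Bh' Bk') (Bcomm Bh Bk').
  move: (r v ord0 i) (r (v ^ k) ord0 i) (r (v ^ k^-1) ord0 i)
    (r (v ^ (k * h)) ord0 i) (r (v ^ (k * h^-1)) ord0 i)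
    (r (v ^ (k^-1 * h)) ord0 i) (r (v ^ (k^-1 * h^-1)) ord0 i) => a1 ak ak' akh akh' ak'h ak'h'.
  move=> e5 e4 e3 e2 e1.
  (* The relations for k, k h and k h^-1 at v, minus the relation for h at v^k
     and at its analogue for k^-1. *)
  have -> : (a1 * 3%:R = (akh' + ak'h + a1) + (akh + ak'h' + a1) + (ak + ak' + a1)
      - (ak'h + ak'h' + ak') - (akh + akh' + ak))%R by ring.
  by rewrite e1 e2 e3 e4 e5 !addr0 !subr0.
have [i0 nzi] : exists i, r v ord0 i != 0%R.
  apply/existsP; apply: contraR nDv; rewrite negb_exists => /forallP r0v.
  apply: rD => //; apply/rowP=> i; rewrite [RHS]mxE; apply/eqP.
  by have := r0v i; rewrite negbK.
have three0 : (3%:R = 0 :> 'F_p)%R.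
  by apply/eqP; have /eqP := A3 i0; rewrite mulf_eq0 (negPf nzi).
pose d := v^-1 * v ^ h; have Kd: d \in K by rewrite groupM ?groupV.
have Bh1: h \in B^#.
  apply/setD1P; split=> //; apply: contraNneq nLh => ->; rewrite conjg1; exact: vL.
have rV a : a \in K -> r a^-1 = (- r a)%R.
  move=> Ka; apply/eqP; rewrite -addr_eq0 -rM ?groupV // mulVg r0 //.
have Dd: d \in D.
  apply: (max_comp_fpf maxU Bh1 Kd); have Kdh := KB Kd Bh.
  have Kd' := groupVr Kd; have Kd'h := KB Kd' Bh.
  have -> : [~ h, d] = (d^-1) ^ h * d by rewrite commgEr.
  apply: rD; first by rewrite groupM.
  have Kvhh := KB Kvh Bh; have Kv' := groupVr Kv; have Kvh' := groupVr Kvh.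
  have Ed : (d^-1) ^ h = ((v ^ h) ^ h)^-1 * v ^ h.
    by rewrite /d (invMg v^-1) invgK conjMg conjVg.
  have Kvhh' := groupVr Kvhh.
  rewrite Ed (rM _ _ (groupM Kvhh' Kvh) Kd) (rM _ _ Kvhh' Kvh) (rM _ _ Kv' Kvh) !rV //.
  apply/rowP=> i; rewrite !mxE; have := starh _ Kvh i; rewrite -!conjgM mulgV conjg1.
  move: (r v _ _) (r (v ^ h) _ _) (r (v ^ (h * h)) _ _) => a1 ah ahh e.
  have -> : (- ahh + ah + (- a1 + ah) = ah * 3%:R - (ahh + a1 + ah))%R by ring.
  by rewrite e three0 mulr0 subr0.
case/negP: nLh; have -> : v ^ h = v * d by rewrite mulKVg.
by rewrite groupM ?vL // (subsetP (sDL _)).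
Qed.

End FixedCenter.

Local Notation Q := <<\bigcup_(W in max_normal | W != U) max_comm W>>.

Let sQU : Q \subset U.
Proof.
rewrite gen_subG; apply/bigcupsP=> W /andP[maxW neWU].
exact: max_comm_sub.
Qed.

Let sQP : Q \subset P. Proof. exact: subset_trans sQU sUP. Qed.

Let nQG : G \subset 'N(Q).
Proof.
rewrite norms_gen // norms_bigcup //; apply/bigcapsP=> W _; exact: max_comm_norm.
Qed.

Let cKU : K \subset 'C(U). Proof. exact: comm_max_normal_cent. Qed.
Let cKQ : K \subset 'C(Q). Proof. exact: subset_trans cKU (centS sQU). Qed.
Let cBQ : B \subset 'C(Q). Proof. exact: subsetIr. Qed.

Let defKQ : K * Q = P.
Proof.
rewrite -cent_joinEl //; apply/eqP; rewrite eqEsubset; apply/andP; split.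
  by rewrite join_subG sKP.
rewrite -{1}gen_max_comm gen_subG; apply/bigcupsP=> W maxW.
have [->|neWU] := eqVneq W U; first exact: joing_subl.
apply: subset_trans (joing_subr _ _); rewrite sub_gen //.
by apply: (bigcup_sup W); rewrite maxW.
Qed.

Let defQD : Q * D = U.
Proof.
have eqU: K * Q :&: U = U by apply/setIidPr; rewrite defKQ.
rewrite -[RHS]eqU setIC -group_modr // setIC (max_commI maxU) normC //.
exact: subset_trans (subset_trans sQP sPG) nDG.
Qed.

(** * The Camina property: the remaining case *)

Lemma commg_set_group (S : {group gT}) a : {in S, forall y, [~ a, y] \in 'C(S)} ->
  group_set [set [~ a, y] | y in S].
Proof.
move=> cS; apply/group_setP; split; first by apply/imsetP; exists 1; rewrite ?commg1.
move=> _ _ /imsetP[x Sx ->] /imsetP[y Sy ->]; apply/imsetP; exists (y * x).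
  exact: groupM.
rewrite commgMJ; congr (_ * _); apply/esym/conjg_fixP/commgP.
by apply: (centP (cS y Sy)).
Qed.

Section NotCamina.

Variable v : gT.
Hypotheses (KDv : v \in K :\: D) (neND : comm_set v != D) (trivC : 'C_D(B) = 1).
Hypothesis no2 : {in K :\: D, forall a, #|comm_set a| != 2}.

Let Kv : v \in K. Proof. by case/setDP: KDv. Qed.
Let nDv : v \notin D. Proof. by case/setDP: KDv. Qed.
Let N := Group (comm_set_group Kv).
Let sND : N \subset D. Proof. exact: comm_set_sub. Qed.
Let cDU1 : D \subset 'C(P). Proof. exact: subset_trans sDZ (subsetIr _ _). Qed.

Let tiQD : Q :&: D = 1.
Proof.
apply/trivgP; rewrite -trivC subsetI subsetIr.
by apply: subset_trans (subsetIl _ _) _; rewrite centsC.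
Qed.

(** As Q meets K' in fixed points of B, that is trivially, Q N = U would force
    N = K'. *)
Lemma comm_set_join_neq : Q <*> comm_set v != U.
Proof.
apply: contra neND => /eqP eqU; rewrite eqEsubset sND /=.
have: D \subset Q * N.
  rewrite -norm_joinEr ?eqU //; apply: subset_trans (subset_trans sND sDK) _.
  exact: subset_trans sKG nQG.
move/subsetP=> sDQN; apply/subsetP=> d Dd; have /mulsgP[q n Qq Nn defd] := sDQN d Dd.
have Dn := subsetP sND n Nn.
have /set1P q1: q \in [1].
  rewrite -tiQD inE Qq; suff ->: q = d * n^-1 by rewrite groupM ?groupV.
  by rewrite defd mulgK.
by rewrite defd q1 mul1g.
Qed.

(* An element a of C_H(U) gives g = [a, v], outside U, whose commutators with
   P all lie in N. *)
Let A0 := 'C_H(U).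

Let exa : exists2 a, a \in A0 & a != 1.
Proof. by have /trivgPn := max_normal_cent_ntriv maxU. Qed.

Let a := s2val (sig2W exa).
Let A0a : a \in A0. Proof. exact: (s2valP (sig2W exa)). Qed.
Let nta : a != 1. Proof. exact: (s2valP' (sig2W exa)). Qed.
Let Ha : a \in H. Proof. by case/setIP: A0a. Qed.
Let cUa : a \in 'C(U). Proof. by case/setIP: A0a. Qed.

(** The criterion asks about the h in H that centralise Z. Those outside E are
    dealt with by a sum over an orbit of Q; those in E are the heart of the
    matter. *)
Let E := 'C_H(Z <*> Q)%G.

Let EP e : reflect [/\ e \in H, e \in 'C(Z) & e \in 'C(Q)] (e \in E).
Proof.
rewrite inE /= centY in_setI.
by apply: (iffP and3P).
Qed.

Let Ea : a \in E.
Proof.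
apply/EP; split=> //; first exact: subsetP (centS (max_normal_sub maxU)) a cUa.
exact: subsetP (centS sQU) a cUa.
Qed.

Let sEB : E \subset B.
Proof. by rewrite setIS // centS // joing_subr. Qed.

Let E_fpf e : e \in E -> e != 1 ->
  {in K, forall k, [~ e, k] \in D -> k \in D}.
Proof.
by move=> Ee nte; apply: (max_comp_fpf maxU); apply/setD1P; rewrite (subsetP sEB).
Qed.

Let g := [~ a, v].

Let Kg : g \in K.
Proof.
rewrite /g commgEr groupM // memJ_norm ?groupV //.
by rewrite (subsetP nKG) // (subsetP sHG).
Qed.

Let nUg : g \notin U.
Proof.
apply: contra nDv => Ug; apply: (E_fpf Ea nta Kv).
by rewrite -/g -(max_commI maxU) inE Kg.
Qed.

(** Since a centralises Z, [v^a, k] = [v, k^(a^-1)] is again in N. *)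
Let gN y : y \in P -> [~ g, y] \in N.
Proof.
rewrite -defKQ => /mulsgP[k q Kk Qq ->]; rewrite commgMJ.
have cq: [~ g, q] = 1.
  by apply/eqP/commgP; apply: (centsP cKQ).
rewrite cq mul1g (cDP (KD1 Kg Kk)) ?(subsetP sQP) //.
have cZa: a \in 'C(Z) by case/EP: Ea.
have Nx: a \in 'N(K) by rewrite (subsetP nKG) // (subsetP sHG).
have Kva: v ^ a \in K by rewrite memJ_norm.
have -> : g = (v ^ a)^-1 * v by rewrite /g commgEr conjVg.
rewrite LM ?groupV // groupM ?(imset_f _ Kk) //.
have -> : [~ (v ^ a)^-1, k] = [~ v ^ a, k]^-1.
  by apply/eqP; rewrite eq_sym eq_invg_mul -LM ?groupV // mulgV comm1g.
have Ka' : k ^ a^-1 \in K by rewrite memJ_norm // groupV.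
have -> : [~ v ^ a, k] = [~ v, k ^ a^-1].
  rewrite -{1}[k](conjgKV a) -conjRg; apply/conjg_fixP/commgP/commute_sym.
  by apply: (centP cZa); rewrite (subsetP sDZ) ?KD1.
by rewrite groupV imset_f.
Qed.

(** The preimage in K of the centre of K / N. *)
Let X := [set x in K | [forall k in K, [~ x, k] \in N]].

Let XP x : reflect (x \in K /\ {in K, forall k, [~ x, k] \in N}) (x \in X).
Proof. by rewrite inE; apply: (iffP andP) => -[Kx /forall_inP Xx]. Qed.

Let gX : group_set X.
Proof.
apply/group_setP; split.
  by apply/XP; split=> // w Kw; rewrite comm1g group1.
move=> x y /XP[Kx Nx] /XP[Ky Ny]; apply/XP; split=> [|w Kw]; first exact: groupM.
by rewrite LM // groupM ?Nx ?Ny.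
Qed.

(** Write g = [e, x] modulo D with x in X. The difference lies in [X / N, E],
    as g and [e, x] do, and it is centralised by E, so it is in N because X /
    N is abelian. As commutators with e that agree modulo U are equal, [e, k]
    = [e, x]. *)
Let EU e k : e \in E -> e != 1 -> k \in K -> g^-1 * [~ e, k] \in U ->
  g^-1 * [~ e, k] \in N.
Proof.
move=> Ee nte Kk Uk; pose XG := Group gX; have [He cZe cQe] := EP _ Ee.
have sXK : XG \subset K by apply/subsetP=> x /XP[].
have sDX : D \subset XG.
  apply/subsetP=> d Dd; apply/XP; split=> [|w Kw]; first exact: (subsetP sDK).
  by rewrite LD ?group1.
have Xg : g \in XG by apply/XP; split=> // w Kw; apply: gN; apply: (subsetP sKP).
have Xv : v \in XG by apply/XP; split=> // w Kw; apply: imset_f.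
have Ge := subsetP sHG e He.
have sEC: E \subset 'C(D).
  by apply/subsetP=> b /EP[_ cZb _]; apply: subsetP (centS sDZ) b cZb.
have sENN: E \subset 'N(N) by rewrite cents_norm // (subset_trans sEC) ?centS.
have sXNN: XG \subset 'N(N).
  rewrite cents_norm // (subset_trans sXK) // (subset_trans sKP) // centsC.
  exact: subset_trans sND cDU1.
have nXE: E \subset 'N(XG).
  apply/subsetP=> x Ex; rewrite inE; apply/subsetP=> _ /imsetP[b /XP[Kb Nb] ->].
  have Hx : x \in H by case/EP: Ex.
  have Nx: x \in 'N(K) by rewrite (subsetP nKG) // (subsetP sHG).
  apply/XP; split=> [|w Kw]; first by rewrite memJ_norm.
  rewrite -[w](conjgKV x) -conjRg memJ_norm ?(subsetP sENN) //.
  by rewrite Nb // memJ_norm ?groupV.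
have nDXG : D <| XG by rewrite /normal sDX (subset_trans sXK) // der_norm.
have nXe : e \in 'N(XG) := subsetP nXE e Ee.
have nDe : e \in 'N(D) by apply: (subsetP nDG).
have fpfX : {in XG, forall k, [~ e, k] \in D -> k \in D}.
  by move=> x Xx; apply: E_fpf => //; apply: (subsetP sXK).
have [x Xx Dc] := commg_onto nDXG nXe nDe fpfX Xg.
set c := [~ e, x]^-1 * g in Dc.
have abX: abelian (XG / N).
  rewrite sub_der1_abelian // derg1 gen_subG; apply/subsetP=> _ /imset2P[y w Xy Xw ->].
  by have /XP[_] := Xy; apply; apply: (subsetP sXK).
have coXE: coprime #|XG / N| #|E / N|.
  rewrite coprime_morph //; apply: coprimeSg (subset_trans sXK sKP) _.
  by apply: coprimegS coPH; apply: subsetIl.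
have TI := coprime_abel_cent_TI (quotient_norms N nXE) coXE abX.
have Nc : c \in N.
  have NNc : c \in 'N(N) by rewrite (subsetP sXNN) // (subsetP sDX).
  apply: coset_idr => //; apply/set1P; rewrite -[[set 1]]TI -quotientR // inE.
  rewrite mem_quotient /=.
    apply/centP=> _ /morphimP[b Nb Eb ->]; rewrite /commute -!morphM //.
    by congr (coset _ _); apply: commute_sym; apply: (centP (subsetP sEC b Eb)).
  rewrite groupM //; first by rewrite invg_comm mem_commg.
  by rewrite -[g]invgK groupV invg_comm mem_commg.
have Nc' : g^-1 * [~ e, x] \in N by rewrite -groupV invMg invgK.
have Uc : g^-1 * [~ e, x] \in U.
  by apply: (subsetP _ _ Nc'); apply: subset_trans sND sDU.
have Pg' : g^-1 \in P by rewrite groupV (subsetP sKP).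
have [m0 Tm0 eqm] := comm_transversal maxU Ge cZe (E_fpf Ee nte) Pg'.
have Kx := subsetP sXK x Xx.
have := eqm [~ e, x] (imset_f _ Kx); rewrite Uc => /esym/eqP ex.
have := eqm [~ e, k] (imset_f _ Kk); rewrite Uk => /esym/eqP ->.
by rewrite -ex.
Qed.

(* Such an f is to be shown to vanish on U. *)
Variable f : gT -> F.
Hypotheses (fD : {in U &, forall x y, (f (x * y)%g = f x + f y)%R})
  (f0 : {in Q <*> N, forall y, f y = 0%R}).

Let f1 : f 1 = 0%R.
Proof. by apply: f0; apply: group1. Qed.
Let fQ q : q \in Q -> f q = 0%R.
Proof. by move=> Qq; apply: f0; apply: (subsetP (joing_subl _ _)). Qed.
Let fN n : n \in N -> f n = 0%R.
Proof. by move=> Nn; apply: f0; apply: (subsetP (joing_subr _ _)). Qed.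
Let fV u : u \in U -> f u^-1 = (- f u)%R.
Proof. by move=> Uu; apply/eqP; rewrite -addr_eq0 -fD ?groupV // mulVg f1. Qed.

Let nUx x : x \in G -> x \in 'N(U).
Proof. exact: (subsetP (max_normal_norm maxU)). Qed.

Let commUP u y : u \in U -> y \in P -> [~ u, y] \in Q.
Proof.
rewrite -defQD => /mulsgP[q d Qq Dd ->] Py; rewrite commMgJ.
have -> : [~ d, y] = 1 by apply/eqP/conjg_fixP/cDP.
have Qqy : [~ q, y] \in Q.
  by rewrite commgEl groupM ?groupV // memJ_norm // (subsetP nQG) // (subsetP sPG).
rewrite mulg1 memJ_norm // (subsetP nQG) //.
by rewrite (subsetP sPG) // (subsetP (subset_trans sDK sKP)).
Qed.

Let sumH0 (c : F) : (#|H|%:R * c = 0 -> c = 0)%R.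
Proof.
move/eqP; rewrite mulf_eq0 => /orP[|/eqP//].
by rewrite -(dvdn_pcharf hp) => pH; move: p'H; rewrite /pgroup p'natE // pH.
Qed.

Let tau c : F := (\sum_(x in H) f (c ^ x)%g)%R.

Let UJ u x : u \in U -> x \in H -> u ^ x \in U.
Proof. by move=> Uu Hx; rewrite memJ_norm // nUx // (subsetP sHG). Qed.

Let tauD : {in U &, forall c d, (tau (c * d)%g = tau c + tau d)%R}.
Proof.
move=> c d Uc Ud; rewrite -big_split /=; apply: eq_bigr => x Hx.
by rewrite conjMg fD ?UJ.
Qed.

Let tauJ c b : b \in H -> tau (c ^ b) = tau c.
Proof.
move=> Hb; rewrite /tau [RHS](reindex_inj (mulgI b)) /=.
by apply: eq_big => x; [rewrite groupMl | rewrite conjgM].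
Qed.

(** The function tau is additive and invariant under B, so it vanishes on D =
    [D, B], and it vanishes on Q because f does. *)
Let tau0 c : c \in U -> tau c = 0%R.
Proof.
have tau1 : tau 1 = 0%R by apply: big1 => x _; rewrite conj1g f1.
have tauQ q : q \in Q -> tau q = 0%R.
  move=> Qq; apply: big1 => x Hx; apply: fQ.
  by rewrite memJ_norm // (subsetP nQG) // (subsetP sHG).
have nDB : B \subset 'N(D) := subset_trans sBG nDG.
have coDB : coprime #|D| #|B|.
  exact: coprimeSg (subset_trans sDK sKP) (coprimegS (max_comp_sub U) coPH).
have solD : solvable D := solvableS (subset_trans sDK sKP) solP.
have eqD : [~: D, B] = D.
  by have := coprime_commg_cent nDB coDB solD; rewrite /= trivC mulg1.
pose T := [set d in D | tau d == 0%R].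
have TU d : d \in D -> d \in U by apply: (subsetP sDU).
have gT0 : group_set T.
  apply/group_setP; split; first by rewrite inE group1 tau1 eqxx.
  move=> x y /setIdP[Dx /eqP tx] /setIdP[Dy /eqP ty].
  by rewrite inE groupM // tauD ?TU // tx ty addr0 eqxx.
have sDT : D \subset Group gT0.
  rewrite -{1}eqD gen_subG; apply/subsetP=> _ /imset2P[d b Dd Bb ->].
  have Hb : b \in H by apply: (subsetP (max_comp_sub U)).
  have Ddb : d ^ b \in D by rewrite memJ_norm // (subsetP nDB).
  have Dd' := groupVr Dd.
  rewrite inE commgEl groupM //= tauD ?TU // tauJ //.
  by rewrite -tauD ?TU // mulVg tau1.
rewrite -defQD => /mulsgP[q d Qq Dd ->].
rewrite (tauD (subsetP sQU q Qq) (TU d Dd)) tauQ // add0r.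
by have := subsetP sDT d Dd; rewrite inE => /andP[_ /eqP].
Qed.

(** The sum over H makes z invariant under conjugation by H. The restriction
    to w^x in g U makes it invariant under P, because [g, P] lies in N, where
    f vanishes. *)
Let z w : F :=
  if w \in P then (\sum_(x in H) if (g^-1 * w ^ x)%g \in U then f (g^-1 * w ^ x)%g else 0)%R
  else 0%R.

Let zU w c : w \in P -> c \in U -> z (w * c) =
  (\sum_(x in H) if (g^-1 * w ^ x)%g \in U then f (g^-1 * w ^ x)%g + f (c ^ x)%g else 0)%R.
Proof.
move=> Pw Uc; rewrite /z groupM ?(subsetP sUP c) //; apply: eq_bigr => x Hx.
rewrite conjMg mulgA (groupMr _ (UJ Uc Hx)).
by case: ifP => // Ux; rewrite fD ?UJ.
Qed.

Let zsum (M : {set gT}) w : M \subset U -> w \in P ->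
    {in H, forall x, (\sum_(m in M) f (m ^ x)%g = 0)%R} ->
  (\sum_(m in M) z (w * m)%g = #|M|%:R * z w)%R.
Proof.
move=> /subsetP sMU Pw sM0.
rewrite (eq_bigr (fun m => \sum_(x in H)
  if (g^-1 * w ^ x)%g \in U then f (g^-1 * w ^ x)%g + f (m ^ x)%g else 0)%R); last first.
  by move=> m /sMU Um; rewrite zU.
rewrite exchange_big /= /z Pw mulr_sumr; apply: eq_bigr => x Hx.
case: ifP => _; last by rewrite big1 ?mulr0.
by rewrite big_split /= sM0 // addr0 sumr_const mulr_natl.
Qed.

Let sum_classU c0 x : c0 \in U -> x \in H -> (\sum_(c in c0 ^: G) f (c ^ x)%g = 0)%R.
Proof.
move=> Uc0 Hx; have Gx := subsetP sHG x Hx.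
have clJ y : y \in H -> (\sum_(c in c0 ^: G) f (c ^ y)%g = \sum_(c in c0 ^: G) f c)%R.
  move=> Hy; rewrite [RHS](reindex_inj (conjg_inj y)) /=; apply: eq_bigl => c.
  by rewrite memJ_norm // (subsetP (class_norm _ _)) // (subsetP sHG).
rewrite clJ //; apply: sumH0; rewrite mulr_natl -sumr_const.
rewrite -(eq_bigr _ clJ) exchange_big /=; apply: big1 => c c0c.
apply: tau0; apply: subsetP c c0c; rewrite class_sub_norm //.
exact: max_normal_norm.
Qed.

Let sumM (M : {group gT}) : M \subset U -> #|M| != 2 \/ {in M, forall m, f m = 0%R} ->
  (\sum_(m in M) f m = 0)%R.
Proof.
move=> sMU [neM|fM]; last exact: big1.
apply: (sum_additive0 hp) neM; last exact: pgroupS (subset_trans sMU sUP) pP.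
by move=> x y Mx My; apply: fD; apply: (subsetP sMU).
Qed.

(** The set [b, P] is a subgroup of Z. If it has order two, then b cannot be
    outside Q D, where [b, P] contains some [k, K] of the same order, a case
    excluded by no2; and for b in Q D it is a subset of Q, where f
    vanishes. *)
Let sum_commP b : b \in P -> b \notin Z ->
  (\sum_(m in [set [~ b, y] | y in P]) f m = 0)%R.
Proof.
move=> Pb nZb; have cb: {in P, forall y, [~ b, y] \in 'C(P)}.
  by move=> y Py; have /setIP[] := commPZ Pb Py.
pose M := Group (commg_set_group cb).
have sMZ : M \subset Z by apply/subsetP=> _ /imsetP[y Py ->]; apply: commPZ.
have sMU : M \subset U := subset_trans sMZ (max_normal_sub maxU).
apply: (@sumM M sMU); have [/= o2|] := eqVneq #|M| 2; [right | by left].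
have /mulsgP[k q Kk Qq defb] : b \in K * Q by rewrite defKQ.
have commb k' q' : k' \in K -> q' \in Q -> [~ b, k' * q'] = [~ k, k'] * [~ q, q'].
  move=> Kk' Qq'; have Pq' := subsetP sQP q' Qq'; have Pk' := subsetP sKP k' Kk'.
  have cKQ' x y : x \in K -> y \in Q -> [~ x, y] = 1.
    by move=> Kx Qy; apply/eqP/commgP; apply: (centsP cKQ).
  have cQK' x y : x \in Q -> y \in K -> [~ x, y] = 1.
    by move=> Qx Ky; rewrite -invg_comm cKQ' ?invg1.
  have Pq := subsetP sQP q Qq; have Dkk := KD1 Kk Kk'.
  rewrite defb commMgJ (commgMJ k) (commgMJ q) (cKQ' k q') // (cQK' q k') //.
  by rewrite mul1g conj1g mulg1 (cDP Dkk Pq') (cDP Dkk Pq).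
have [Dk|nDk] := boolP (k \in D).
  move=> m /imsetP[y Py ->]; have: y \in K * Q by rewrite defKQ.
  case/mulsgP=> k' q' Kk' Qq' ->.
  by rewrite commb // LD // mul1g fQ // groupR.
have KDk : k \in K :\: D by rewrite inE nDk.
case/negP: (no2 KDk).
have skM : comm_set k \subset M.
  apply/subsetP=> _ /imsetP[k' Kk' ->]; apply/imsetP; exists (k' * 1).
    by rewrite mulg1 (subsetP sKP).
  by rewrite commb // commg1 mulg1.
have := subset_leq_card skM; rewrite /= o2 => le2.
have gt1 : 1 < #|comm_set k|.
  have := comm_set_ntriv Kk nDk.
  by rewrite (subG1 (Group (comm_set_group Kk))) -(cardG_gt1 (Group (comm_set_group Kk))).
by rewrite eqn_leq le2.
Qed.

(** If the subgroup [b, Z] has order two, then p = 2 and b^2 centralises Z; as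
    H has odd order, so does b. *)
Let sum_commZ b : b \in G -> b \notin 'C(Z) ->
  (\sum_(m in [set [~ b, y] | y in Z]) f m = 0)%R.
Proof.
move=> Gb nCb; have ZJ x y : x \in G -> y \in Z -> y ^ x \in Z.
  by move=> Gx Zy; rewrite memJ_norm // (subsetP (normal_norm nZG)).
have Zc x y : x \in G -> y \in Z -> [~ x, y] \in Z.
  by move=> Gx Zy; rewrite commgEr groupM // ZJ ?groupV.
have abZ : Z \subset 'C(Z) := subset_trans sZP cPZ.
have cb: {in 'Z(P)%G, forall y, [~ b, y] \in 'C('Z(P)%G)}.
  by move=> y Zy; apply: (subsetP abZ); apply: Zc.
pose M := Group (commg_set_group cb).
have sMZ : M \subset Z by apply/subsetP=> _ /imsetP[y Zy ->]; apply: Zc.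
have sMU : M \subset U := subset_trans sMZ (max_normal_sub maxU).
apply: (@sumM M sMU); left; apply: contra nCb => /eqP o2.
have p2 : p = 2.
  have pM : p.-group M := pgroupS (subset_trans sMZ sZP) pP.
  by have := pnat_dvd (dvdnn _) pM; rewrite o2 pnatE // => /eqP->.
have bM m : m \in M -> m ^ b = m.
  move=> Mm; have [->|ntm] := eqVneq m 1; first exact: conj1g.
  have Mmb : m ^ b \in M.
    case/imsetP: Mm => y Zy ->; apply/imsetP; exists (y ^ b); first exact: ZJ.
    by rewrite conjRg [b ^ b]conjgE mulKg.
  apply: contra_eq o2 => neq; rewrite eq_sym ltn_eqF //.
  rewrite (cardsD1 1) (cardsD1 m) (cardsD1 (m ^ b)).
  by rewrite !inE group1 Mm Mmb ntm neq -(inj_eq (conjg_inj b^-1)) conjgK conj1g ntm.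
have cb2 : b * b \in 'C(Z).
  apply/centP=> y Zy; apply/commgP/eqP.
  have My : [~ b, y] \in M by apply: imset_f.
  have := expg_cardG (G := M) My; rewrite o2 expgS expg1 => m2.
  by rewrite commMgJ bM.
have bH : b ^+ #|H| \in 'C(Z).
  apply: (subsetP cPZ); have Nb : b \in 'N(P) by rewrite (subsetP (normal_norm nPG)).
  apply: coset_idr; first exact: groupX.
  rewrite morphX // (card_isog (sdprod_isog defG)).
  by apply: expg_cardG; apply: mem_quotient.
have oddH : odd #|H| by have := p'H; rewrite /pgroup p'natE // p2 dvdn2 negbK.
have := odd_double_half #|H|; rewrite oddH => oH.
by move: bH; rewrite -oH expgD expg1 -mul2n expgM expgS expg1 groupMr // groupX.
Qed.

(** For y in P, moving w^x in g U by y changes the argument of f by elements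
    of N and Q, where f vanishes. *)
Let zJ : {in G &, forall w x, z (w ^ x) = z w}.
Proof.
have zJP : {in G & P, forall w y, z (w ^ y) = z w}.
  move=> w y Gw Py; rewrite /z memJ_norm ?(subsetP (normG P)) //.
  case: ifP => // Pw; apply: eq_bigr => x Hx.
  have Pwx : w ^ x \in P by rewrite memJ_norm // (subsetP nPH).
  have Pyx : y ^ x \in P by rewrite memJ_norm // (subsetP nPH).
  have Zc : [~ w ^ x, y ^ x] \in Z by apply: commPZ.
  have Uc : [~ w ^ x, y ^ x] \in U by apply: (subsetP (max_normal_sub maxU)).
  rewrite conjJg conjg_mulR mulgA (groupMr _ Uc); case: ifP => // Ux.
  rewrite fD // -[RHS]addr0; congr (_ + _)%R.
  have -> : w ^ x = g * (g^-1 * w ^ x) by rewrite mulKVg.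
  rewrite commMgJ; set u := g^-1 * _ in Ux *.
  have Ncg : [~ g, y ^ x] \in N := gN Pyx.
  have Dcg := subsetP sND _ Ncg.
  rewrite (cDP Dcg) ?(subsetP sUP u) // fD ?(subsetP sDU _ Dcg) //.
    by rewrite fN // fQ ?addr0 // commUP.
  by apply: (subsetP sQU); apply: commUP.
have zJH : {in G & H, forall w y, z (w ^ y) = z w}.
  move=> w y Gw Hy; rewrite /z memJ_norm ?(subsetP nPH) //; case: ifP => // Pw.
  rewrite [RHS](reindex_inj (mulgI y)) /=; apply: eq_big => [x|x Hx].
    by rewrite groupMl.
  by rewrite conjgM.
move=> w x Gw; rewrite -{1}defPH => /mulsgP[y h Py Hh ->].
have Gy := subsetP sPG y Py; by rewrite conjgM zJH ?groupJ ?zJP.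
Qed.

(** The function z satisfies the criterion, so it is constant on P. But z 1 =
    0 as g is not in U, while for u in U only the x in C_H(K) contribute to z
    (g u), and each of them contributes f u. *)
Lemma not_camina_fun0 : {in U, forall u, f u = 0%R}.
Proof.
have zc : {in G & P, forall w u, z (w * u) = z w}.
  apply: eigen_criterion => //.
  - by move=> w nPw; rewrite /z (negPf nPw).
  - move=> c0 w Zc0 Pw; have Uc0 := subsetP (max_normal_sub maxU) c0 Zc0.
    apply: zsum => // [|x Hx]; last exact: sum_classU.
    by rewrite class_sub_norm // max_normal_norm.
  - move=> b w Pb Pw nZb; rewrite zsum //.
    + have nCb : b \notin 'C(P) by apply: contra nZb => cb; rewrite inE Pb.
      have := sum_const_class (w := 1) (z := fun=> 1%R) pP nCb (fun y _ => erefl).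
      by rewrite sumr_const => ->; rewrite mul0r.
    + apply/subsetP=> _ /imsetP[y Py ->]; apply: (subsetP (max_normal_sub maxU)).
      exact: commPZ.
    move=> x Hx; have Nx := subsetP nPH x Hx; have Gx := subsetP sHG x Hx.
    have Pbx : b ^ x \in P by rewrite memJ_norm.
    rewrite -[RHS](sum_commP Pbx); last first.
      by rewrite memJ_norm // (subsetP (normal_norm nZG)).
    have -> : [set [~ b ^ x, y] | y in P] = [set m ^ x | m in [set [~ b, y] | y in P]].
      rewrite -[in LHS](normP Nx) /conjugate -!imset_comp; apply: eq_imset => y /=.
      by rewrite conjRg.
    by rewrite [RHS]big_imset //= => y1 y2 _ _ /conjg_inj.
  - move=> b w Gb Pw nCb; rewrite zsum //.
    + have := sum_const_class (N := 'Z(P)%G) (w := 1) (z := fun=> 1%R) (pgroupS sZP pP) nCb (fun y _ => erefl).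
      by rewrite sumr_const => ->; rewrite mul0r.
    + apply/subsetP=> _ /imsetP[y Zy ->]; apply: (subsetP (max_normal_sub maxU)).
      by rewrite commgEr groupM // memJ_norm ?groupV // (subsetP (normal_norm nZG)).
    move=> x Hx; have Gx := subsetP sHG x Hx; have Nx := subsetP (normal_norm nZG) x Gx.
    have Gbx : b ^ x \in G by rewrite groupJ.
    rewrite -[RHS](sum_commZ Gbx); last first.
      by rewrite memJ_norm // (subsetP (subset_trans (normal_norm nZG) (cent_norm _))).
    have -> : [set [~ b ^ x, y] | y in Z] = [set m ^ x | m in [set [~ b, y] | y in Z]].
      rewrite -[in LHS](normP Nx) /conjugate -!imset_comp; apply: eq_imset => y /=.
      by rewrite conjRg.
    by rewrite [RHS]big_imset //= => y1 y2 _ _ /conjg_inj.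
  move=> h w /setD1P[nth Hh] Gw cZh.
  have zQ b q : b \in P -> q \in Q -> z (b * q) = z b.
    move=> Pb Qq; rewrite zU ?(subsetP sQU) // /z Pb; apply: eq_bigr => x Hx.
    by rewrite [f (q ^ x)]fQ ?addr0 // memJ_norm // (subsetP nQG) // (subsetP sHG).
  (* If h does not centralise Q, the sum over a Q-orbit is that of a constant,
     repeated a multiple of p times. *)
  have [cQh|nQh] := boolP (h \in 'C(Q)); last first.
    apply: (sum_class_orbits (N := <<\bigcup_(W in max_normal | W != U) max_comm W>>%G)) => _ /imsetP[y Py ->].
      by apply: subset_trans (classS _ sQP) _; rewrite classGidl.
    have Gy := subsetP sPG y Py; have Gh := subsetP sHG h Hh.
    rewrite sum_class_commg.
    rewrite (eq_bigr (fun m => z (w * h ^ y * m)%g)) => [|m _]; last by rewrite mulgA.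
    apply: sum_const_class => [||q Qq]; first exact: pgroupS sQP pP.
      have nCQG: G \subset 'N('C(Q)) by apply: subset_trans nQG (cent_norm _).
      by rewrite memJ_norm ?(subsetP nCQG).
    have Qc : [~ h ^ y, q] \in Q.
      by rewrite commgEr groupM // memJ_norm ?groupV // (subsetP nQG) ?groupJ.
    have [Pb|nPb] := boolP (w * h ^ y \in P); first exact: zQ.
    by rewrite /z groupMr ?(negPf nPb) // (subsetP sQP).
  have Eh : h \in E by apply/EP.
  have Gh := subsetP sHG h Hh.
  have fpfh := E_fpf Eh nth.
  have cQhk q k : q \in Q -> k \in K -> (h ^ k) ^ q = h ^ k.
    move=> Qq Kk; have eqk : k ^ q = k by apply/conjg_fixP/commgP; apply: (centsP cKQ).
    have eqh : h ^ q = h by apply/conjg_fixP/commgP; apply: (centP cQh).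
    by rewrite conjJg eqk eqh.
  (* If h is in E, its P-orbit is a K-orbit, and z (k0 m) is to be summed over
     m in [h, K]. *)
  have clh : h ^: P = h ^: K.
    apply/eqP; rewrite eqEsubset (classS _ sKP) andbT.
    apply/subsetP=> _ /imsetP[y Py ->]; have: y \in K * Q by rewrite defKQ.
    case/mulsgP=> k q Kk Qq ->.
    by rewrite conjgM cQhk // memJ_class.
  rewrite clh sum_class_commg; set T := [set _ | _ in _].
  have sTK m : m \in T -> m \in K.
    case/imsetP=> k Kk ->; rewrite commgEr groupM // memJ_norm ?groupV //.
    by rewrite (subsetP nKG).
  rewrite (eq_bigr (fun m => z (w * h * m)%g)) => [|m _]; last by rewrite mulgA.
  have [Pb|nPb] := boolP (w * h \in P); last first.
    by apply: big1 => m Tm; rewrite /z groupMr ?(negPf nPb) // (subsetP sKP) ?sTK.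
  have /mulsgP[k0 q0 Kk0 Qq0 eqb] : w * h \in K * Q by rewrite defKQ.
  have Pk0 := subsetP sKP k0 Kk0.
  rewrite {w Gw Pb}eqb (eq_bigr (fun m => z (k0 * m)%g)) => [|m Tm]; last first.
    have -> : k0 * q0 * m = k0 * m * q0.
      by rewrite -!mulgA; congr (_ * _); apply/esym; apply: (centsP cKQ); rewrite ?sTK.
    by rewrite zQ // groupM // (subsetP sKP) ?sTK.
  have nKh : h \in 'N(K) by rewrite (subsetP nKG).
  have nDh : h \in 'N(D) by rewrite (subsetP nDG).
  have nDK : D <| K := der_normal 1 _.
  (* Conjugating by a suitable k1 in K replaces k0 by an element of D. *)
  have [k1 Kk1 Dd] := commg_onto nDK nKh nDh fpfh (groupVr Kk0).
  set d := _ * _ in Dd.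
  have Ek0 : k0 * h^-1 = (d^-1 * h^-1) ^ k1.
    have Dd' := groupVr Dd.
    have defd : d^-1 = k0 * [~ h, k1] by rewrite /d invMg !invgK.
    rewrite conjMg (cDK Dd' Kk1) conjVg defd commgEl; move: (h ^ k1) => e.
    by rewrite -(mulgA k0) mulgK.
  have -> : (\sum_(m in T) z (k0 * m)%g = \sum_(m in T) z (d^-1 * m)%g)%R.
    have e1 b : (\sum_(m in T) z (b * m)%g = \sum_(e in h ^: K) z (b * h^-1 * e)%g)%R.
      by rewrite sum_class_commg; apply: eq_bigr => m _; rewrite -[(b * h^-1 * _)%g]mulgA mulKg.
    rewrite !e1 (reindex_inj (conjg_inj k1)) /=; apply: eq_big => e.
      by rewrite memJ_norm // (subsetP (class_norm _ _)).
    rewrite memJ_norm ?(subsetP (class_norm _ _)) // => he.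
    have Ge : e \in G by case/imsetP: he => y Ky ->; rewrite groupJ // (subsetP sKG).
    have Gd : d \in G by rewrite (subsetP (subset_trans sDK sKG)).
    have Gdhe : d^-1 * h^-1 * e \in G by apply: groupM => //; apply: groupM; rewrite groupV.
    by rewrite Ek0 -(conjMg (d^-1 * h^-1)) (zJ Gdhe (subsetP sKG k1 Kk1)).
  have Dd' := groupVr Dd; move: (d^-1) Dd' => c Dc; have Uc := subsetP sDU c Dc.
  (* Whenever m^x is in g U, it is even in g N by EU, so f only sees the
     factor c; the sum becomes tau c = 0. *)
  rewrite (eq_bigr (fun m => \sum_(x in H) ((g^-1 * m ^ x)%g \in U)%:R * f (c ^ x)%g)%R); last first.
    move=> m Tm; have Km := sTK m Tm; have Pm := subsetP sKP m Km.
    have -> : c * m = m * c by rewrite conjgC (cDP Dc Pm).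
    rewrite zU //; apply: eq_bigr => x Hx; case: ifP => Ux; last by rewrite mul0r.
    have Nx : x \in 'N(K) by rewrite (subsetP nKG) // (subsetP sHG).
    have Nmx : g^-1 * m ^ x \in N.
      case/imsetP: Tm Ux => k Kk ->; rewrite conjRg.
      have -> : h ^ x = h by rewrite conjgE (centsP cHH h Hh x Hx) mulKg.
      by apply: EU => //; rewrite memJ_norm.
    by rewrite (fN Nmx) add0r mul1r.
  rewrite exchange_big /= -[RHS](tau0 Uc); apply: eq_bigr => x Hx.
  have Nx : x \in 'N(K) by rewrite (subsetP nKG) // (subsetP sHG).
  rewrite -mulr_suml -[RHS]mul1r; congr (_ * _)%R.
  have Pg : (g^-1) ^ x^-1 \in P.
    by rewrite (subsetP sKP) // memJ_norm ?groupV.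
  rewrite -[RHS](cent_coset_sum maxU Gh cZh fpfh Pg); apply: eq_bigr => m Tm.
  rewrite -[in RHS](conjgK x m) -(conjMg g^-1) memJ_norm //.
  by rewrite groupV nUx // (subsetP sHG).
move=> u Uu; have Pu := subsetP sUP u Uu; have Pg := subsetP sKP g Kg.
have Gg := subsetP sPG g Pg.
have zgu : z (g * u) = 0%R.
  rewrite zc // -[g]mul1g zc // /z group1; apply: big1 => x Hx.
  by rewrite conj1g mulg1 groupV (negPf nUg).
have fHK x : x \in H -> x \in 'C(K) -> f (u ^ x) = f u.
  move=> Hx cKx; move: (Uu); rewrite -{1}defQD => /mulsgP[q d Qq Dd ->].
  have Qqx : q ^ x \in Q by rewrite memJ_norm // (subsetP nQG) // (subsetP sHG).
  have dx : d ^ x = d.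
    apply/conjg_fixP/commgP/commute_sym; apply: (centP cKx); exact: (subsetP sDK).
  have [Ud Uq] := (subsetP sDU d Dd, subsetP sQU q Qq).
  by rewrite conjMg dx (fD (subsetP sQU _ Qqx) Ud) (fD Uq Ud) (fQ Qqx) (fQ Qq).
have : (#|'C_H(K)|%:R * f u = 0)%R.
  rewrite -[RHS]zgu zU // mulr_natl -sumr_const big_mkcond [RHS]big_mkcond /=.
  apply: eq_bigr => x _; rewrite in_setI; case Hx: (x \in H) => //=.
  have Nx : x \in 'N(K) by rewrite (subsetP nKG) // (subsetP sHG).
  have [cKx|nKx] := boolP (x \in 'C(K)).
    have -> : g ^ x = g by apply/conjg_fixP/commgP/commute_sym; apply: (centP cKx).
    by rewrite mulVg group1 f1 add0r fHK.
  case: ifP => // Ux; case/negP: nUg; apply: (subsetP sDU).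
  apply: (max_comm_fpf maxU Hx nKx Kg); rewrite -invg_comm groupV.
  suff: [~ g, x] \in K :&: U by rewrite (max_commI maxU).
  by rewrite in_setI commgEl Ux andbT groupM ?groupV // memJ_norm.
move/eqP; rewrite mulf_eq0 => /orP[|/eqP//].
have p'C : p^'.-group 'C_H(K) := pgroupS (subsetIl _ _) p'H.
by rewrite -(dvdn_pcharf hp); move: p'C; rewrite /pgroup p'natE // => /negPf->.
Qed.

End NotCamina.

Lemma max_comm_set : {in K :\: D, forall v, comm_set v = D}.
Proof.
move=> v KDv; have [Kv nDv] := setDP KDv.
have [trivC|ntC] := eqVneq ('C_D(B) : {set gT}) 1; last exact: fixed_center_comm_set.
have [/existsP[a /andP[KDa /eqP o2]]|] := boolP [exists a, (a \in K :\: D) && (#|comm_set a| == 2)].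
  exact: (comm_set_card2 KDa o2).
rewrite negb_exists => /forallP no2; apply/eqP; apply: contraT => neND.
have no2' : {in K :\: D, forall a, #|comm_set a| != 2}.
  by move=> a KDa; have := no2 a; rewrite KDa.
pose N := Group (comm_set_group Kv).
have sQNU : Q <*> N \subset U.
  by rewrite join_subG sQU (subset_trans (comm_set_sub Kv) sDU).
have [f [fD f0 [u Uu]]] := additive_fun_exists hp (pgroupS sUP pP) sQNU (comm_set_join_neq KDv neND trivC).
by rewrite (not_camina_fun0 trivC no2' fD f0) ?eqxx.
Qed.

Lemma max_comm_camina : camina_group K.
Proof.
move=> v KDv; rewrite class_commg -/(comm_set v) max_comm_set //.
by rewrite -lcosetE.
Qed.

End CaminaPart.

(** * The central product decomposition *)

Definition max_factor (U : {group gT}) : {group gT} := (max_comm U <*> max_comp U)%G.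

Lemma max_factor_camina U : U \in max_normal -> camina_sdprod_cycle p (max_factor U).
Proof.
move=> maxU; have sKP := max_comm_subP U; have sBH := max_comp_sub U.
have nKB : max_comp U \subset 'N(max_comm U).
  exact: subset_trans sBH (subset_trans sHG (max_comm_norm U)).
have tiKB : max_comm U :&: max_comp U = 1.
  by apply: coprime_TIg; apply: coprimeSg sKP (coprimegS sBH coPH).
have faithB : 'C_(max_comp U)(max_comm U) = 1.
  apply/trivgP/subsetP=> x /setIP[Bx cx]; apply/set1P/eqP; apply: contraLR cx => ntx.
  by apply: max_comp_faithful; apply/setD1P.
have sDZ := max_comm_der_cent U.
have [h Ch nth] : exists2 h, h \in 'C_H(U) & h != 1.
  by have /trivgPn := max_normal_cent_ntriv maxU.
have [Hh cUh] := setIP Ch.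
apply: (@camina_sdprod_cycleI _ p (max_comm U) (max_comp U) _ h).
- by rewrite sdprodEY.
- exact: max_comp_cyclic.
- exact: faithB.
- exact: card_max_comp.
- exact: max_comm_camina.
- exact: pgroupS sKP pP.
- have cK2 : (max_comm U)^`(1) \subset 'Z(max_comm U).
    rewrite subsetI der_sub /=; apply: subset_trans sDZ _.
    by rewrite subIset // centS ?orbT.
  apply/eqP; rewrite eqn_leq nil_class2 cK2 ltnNge nil_class1 /=.
  have /subsetPn[k Kk nDk] := max_comm_not_der maxU.
  apply: contra (comm_set_ntriv maxU Kk nDk) => /centsP cKK.
  by apply/subsetP=> _ /imsetP[l Kl ->]; apply/set1P/eqP/commgP/cKK.
- exact: max_comp_trans.
- apply/setD1P; split=> //; apply/max_compP; split=> // W maxW neWU.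
  exact: subsetP (centS (max_comm_sub maxW maxU neWU)) h cUh.
exact: subsetP (centS (subset_trans sDZ (max_normal_sub maxU))) h cUh.
Qed.

Lemma max_factor_central U W : U \in max_normal -> W \in max_normal -> U != W ->
  [~: max_factor U, max_factor W] = 1.
Proof.
move=> maxU maxW neUW; have neWU : W != U by rewrite eq_sym.
apply/commG1P; rewrite (centY (max_comm W) (max_comp W)).
rewrite join_subG !subsetI -andbA; apply/and4P; split.
- apply: subset_trans (max_comm_sub maxU maxW neUW) _.
  by rewrite centsC; apply: comm_max_normal_cent.
- by rewrite centsC; apply: max_comp_cent.
- exact: max_comp_cent.
exact: subset_trans (max_comp_sub U) (subset_trans cHH (centS (max_comp_sub W))).
Qed.

Lemma gen_max_factor : << \bigcup_(U in max_normal) max_factor U >> = G.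
Proof.
apply/eqP; rewrite eqEsubset gen_subG; apply/andP; split.
  apply/bigcupsP=> U _; rewrite join_subG (subset_trans (max_comm_subP U)) //=.
  exact: subset_trans (max_comp_sub U) sHG.
rewrite -{1}defPH mul_subG //.
  rewrite -{1}gen_max_comm; apply: genS; apply/bigcupsP=> U maxU.
  by apply: subset_trans (bigcup_sup U maxU); apply: joing_subl.
rewrite -{1}gen_max_comp; apply: genS; apply/bigcupsP=> U maxU.
by apply: subset_trans (bigcup_sup U maxU); apply: joing_subr.
Qed.

Lemma central_product_of_max_factor : exists (n : nat) (Gs : 'I_n -> {group gT}),
  central_product_of Gs G /\ forall i : 'I_n, camina_sdprod_cycle p (Gs i).
Proof.
exists #|max_normal|, (fun i => max_factor (enum_val i)); split; last first.
  by move=> i; apply: max_factor_camina; apply: enum_valP.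
split=> [|i j neij]; last first.
  by apply: max_factor_central; rewrite ?enum_valP // (inj_eq enum_val_inj).
rewrite -[RHS]gen_max_factor; congr <<_>>.
by rewrite [RHS]big_enum_val.
Qed.

End Basic.

(** Schur and Zassenhaus give a complement H of G'; it is abelian, and C_H(G')
    is a normal p'-subgroup of G. *)
Lemma basic_group_split (p : nat) (gT : finGroupType) (G : {group gT}) : basic_group p G ->
  exists H : {group gT},
    [/\ G^`(1) ><| H = G, abelian H, p^'.-group H & 'C_H(G^`(1)) = 1].
Proof.
case=> sylP O1; have [sPG pP _] := and3P sylP; have nPG := der_normal 1 G.
have hallP : Hall G G^`(1) := pHall_Hall sylP.
have /splitsP[H /complP[tiPH defG]] := SchurZassenhaus_split hallP nPG.
have sHG : H \subset G by rewrite -defG mulG_subr.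
have defGs : G^`(1) ><| H = G by rewrite sdprodE // (subset_trans sHG (normal_norm nPG)).
have p'H : p^'.-group H.
  by rewrite /pgroup (index_sdprod defGs); have [] := and3P sylP.
have cHH : abelian H.
  by rewrite (isog_abelian (sdprod_isog defGs)) der_abelian.
exists H; split=> //; apply/trivgP; rewrite -O1.
apply: pcore_max; first exact: pgroupS (subsetIl _ _) p'H.
rewrite /normal subIset ?sHG //= -{1}defG mul_subG //.
  by rewrite cents_norm // centsC subsetIr.
exact: subset_trans cHH (subset_trans (centS (subsetIl _ _)) (cent_sub _)).
Qed.

Theorem theorem2 (F : fieldType) (p : nat) (hp : p \in [pchar F]%R)
    (gT : finGroupType) (G : {group gT}) (hG : basic_group p G)
    (hZ : 'Z(G^`(1)) = G^`(2)) :
  ring_ideal (group_ring F G) (ring_socle 'Z(group_ring F G)%MS)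
  <->
  exists (n : nat) (Gs : 'I_n -> {group gT}),
    central_product_of Gs G /\ forall i : 'I_n, camina_sdprod_cycle p (Gs i).
Proof.
split=> [idealS | [n [Gs [cpG camGs]]]]; last exact: (central_product_camina_socle hp cpG camGs).
have [H [defG cHH p'H faithH]] := basic_group_split hG.
have pP : p.-group G^`(1) by case: hG => /and3P[].
apply: (@central_product_of_max_factor F p gT G _ H hp defG cHH pP p'H faithH) => [|f [fJ fE]].
  by rewrite hZ.
exact: socle_ideal_class_fun idealS fJ fE.
Qed.
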